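(* Let $\pi:X\to Y=X/G$ be a Galois covering (possibly ramified) of smooth projective complex curves with finite Galois group $G$. If the genus $g_Y$ of $Y$ satisfies $g_Y\ge 2$, then all irreducible $\mathbb{Q}$-representations of $G$ appear in the isotypical decomposition of the Jacobian $JX$; that is, for every irreducible $\mathbb{Q}$-representation $W$ of $G$ the isotypical component $A_W$ of $JX$ associated to $W$ is nonzero.
   Context: Curves are smooth, irreducible, projective over $\mathbb{C}$, and $G\subset\mathrm{Aut}(X)$. The action of $G$ on $X$ induces an action on $JX$ and hence an algebra homomorphism $\rho:\mathbb{Q}[G]\to\mathrm{End}_{\mathbb{Q}}(JX)$. For $\alpha\in\mathbb{Q}[G]$ put $\mathrm{Im}(\alpha):=\mathrm{Im}(\rho(m\alpha))\subseteq JX$ for any positive integer $m$ with $m\alpha\in\mathbb{Z}[G]$. For an irreducible $\mathbb{Q}$-representation $W$ of $G$ let $e_W$ be the unit element of the simple factor of the semisimple algebra $\mathbb{Q}[G]$ corresponding to $W$ (a central idempotent of $\mathbb{Q}[G]$). The isotypical component of $JX$ associated to $W$ is $A_W:=\mathrm{Im}(e_W)$; the addition map $\prod_W A_W\to JX$ is an isogeny, called the isotypical decomposition. *)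

(* Defs.v *)
From HB Require Import structures.
From mathcomp Require Import all_boot all_algebra all_fingroup all_solvable all_character.
From mathcomp Require Import boolp classical_sets reals complex.
From mathcomp.multinomials Require Import freeg mpoly.

Set Implicit Arguments.
Unset Strict Implicit.
Unset Printing Implicit Defensive.

Import GRing.Theory.
Local Open Scope ring_scope.
Local Open Scope classical_set_scope.

Section ProjectiveSpace.
Variables (C : closedFieldType) (n : nat).

(* The lines through 0 in C^(n+1). *)
Definition pspace := {U : {vspace 'rV[C]_n.+1} | \dim U == 1%N}.
HB.instance Definition _ := Choice.on pspace.

(* Homogeneous coordinates. They are only defined up to a scalar; [coord]
   chooses one, and below is only used in ways that do not depend on it. *)
Definition coord (P : pspace) : 'I_n.+1 -> C := fun i => vpick (val P) 0 i.

Definition proj_closed (Z : set pspace) : Prop :=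
  exists2 S : set {mpoly C[n.+1]},
    (forall F, S F -> exists d, F \is d.-homog) &
    Z = [set P | forall F, S F -> F.@[coord P] = 0].

Definition proj_irreducible (Z : set pspace) : Prop :=
  [/\ proj_closed Z, Z !=set0 &
      forall A B, proj_closed A -> proj_closed B ->
        Z `<=` A `|` B -> Z `<=` A \/ Z `<=` B].

(* Krull dimension one, for an irreducible closed set: the longest chains of
   irreducible closed subsets have length one. *)
Definition dimension_one (X : set pspace) : Prop :=
  (exists2 Z, proj_irreducible Z & Z `<` X) /\
  ~ (exists Z0 Z1, [/\ proj_irreducible Z0, proj_irreducible Z1,
                       Z0 `<` Z1 & Z1 `<` X]).

(* Jacobian criterion: the forms vanishing on X cut out, to first order at P,
   a subspace of dimension 1 + 1 of C^(n+1) (the affine cone over the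
   projective tangent line). *)
Definition smooth_at (X : set pspace) (P : pspace) : Prop :=
  exists2 T : {vspace 'rV[C]_n.+1}, \dim T = 2 &
    forall v, v \in T <->
      forall d (F : {mpoly C[n.+1]}), F \is d.-homog ->
        (forall Q, X Q -> F.@[coord Q] = 0) ->
        \sum_j (mderiv j F).@[coord P] * v 0 j = 0.

End ProjectiveSpace.

Record curve (C : closedFieldType) := Curve {
  ambient : nat;
  locus : set (pspace C ambient);
  locus_irreducible : proj_irreducible locus;
  locus_dim1 : dimension_one locus;
  locus_smooth : forall P, locus P -> smooth_at locus P
}.

Arguments locus {C} X _ : rename.

Definition pt (C : closedFieldType) (X : curve C) := {P | P \in locus X}.
HB.instance Definition _ (C : closedFieldType) (X : curve C) :=
  Choice.on (pt X).

Section Functions.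
Variables (C : closedFieldType) (X : curve C).
Implicit Types (U : set (pt X)) (P Q : pt X) (f : pt X -> C).

Definition zopen U : Prop :=
  exists2 Z, proj_closed Z & forall P, U P <-> ~ Z (val P).

(* Functions on an open set U are represented by functions on all of X, whose
   values outside U are irrelevant. Near P, f is a quotient of forms of the same
   degree; the neighbourhood can be taken to be where H is nonzero, on
   multiplying F and H by a form vanishing off a smaller one. *)
Definition regular_on U f : Prop :=
  forall P, U P -> exists d (F H : {mpoly C[(ambient X).+1]}),
    [/\ F \is d.-homog, H \is d.-homog, H.@[coord (val P)] != 0 &
        forall Q, U Q -> H.@[coord (val Q)] != 0 ->
          f Q = F.@[coord (val Q)] / H.@[coord (val Q)]].

Definition regular_at P f : Prop :=
  exists U, [/\ zopen U, U P & regular_on U f].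

Definition eq_near P f f' : Prop :=
  exists U, [/\ zopen U, U P & forall Q, U Q -> f Q = f' Q].

End Functions.

Definition regular_map (C : closedFieldType) (X Y : curve C)
    (h : pt X -> pt Y) : Prop :=
  forall V, zopen V -> zopen (h @^-1` V) /\
    forall f, regular_on V f -> regular_on (h @^-1` V) (f \o h).

Section Genus.
Variables (C : closedFieldType) (X : curve C).

(* Tangent vectors at P, as C-derivations of the local ring at P. *)
Definition derivation_at (P : pt X) (D : (pt X -> C) -> C) : Prop :=
  [/\ forall f f', eq_near P f f' -> D f = D f',
      forall c f f', regular_at P f -> regular_at P f' ->
        D (fun Q => c * f Q + f' Q) = c * D f + D f' &
      forall f f', regular_at P f -> regular_at P f' ->
        D (fun Q => f Q * f' Q) = f P * D f' + f' P * D f].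

(* A form sends a point and a tangent vector at that point to a scalar; its
   values at other pairs are irrelevant. *)
Definition diff_form := pt X -> ((pt X -> C) -> C) -> C.

(* Locally a sum of terms a db with a and b regular. *)
Definition regular_form (w : diff_form) : Prop :=
  forall P, exists U m (a b : 'I_m -> pt X -> C),
    [/\ zopen U, U P,
        forall i, regular_on U (a i) /\ regular_on U (b i) &
        forall Q D, U Q -> derivation_at Q D ->
          w Q D = \sum_i a i Q * D (b i)].

Definition genus_is (g : nat) : Prop :=
  exists w : 'I_g -> diff_form,
    [/\ forall i, regular_form (w i),
        forall c : 'I_g -> C,
          (forall Q D, derivation_at Q D -> \sum_i c i * w i Q D = 0) ->
          forall i, c i = 0 &
        forall v, regular_form v -> exists c : 'I_g -> C,
          forall Q D, derivation_at Q D -> v Q D = \sum_i c i * w i Q D].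

End Genus.

Section Jacobian.
Variables (C : closedFieldType) (X : curve C).
Implicit Types (P : pt X) (f : pt X -> C).

(* f lies in the k-th power of the maximal ideal of the local ring at P. *)
Fixpoint vanishes_to P (k : nat) f : Prop :=
  if k is k'.+1 then
    exists m (a b : 'I_m -> pt X -> C),
      [/\ forall i, regular_at P (a i) /\ a i P = 0,
          forall i, vanishes_to P k' (b i) &
          eq_near P f (fun Q => \sum_i a i Q * b i Q)]
  else regular_at P f.

Definition order_at P f (k : nat) : Prop :=
  vanishes_to P k f /\ ~ vanishes_to P k.+1 f.

Definition divisor := {freeg (pt X)}.

(* D is the divisor of f, a nonzero rational function (a function on X, up to
   equality on a nonempty open set): at each P, f = a / b as rational
   functions, with a and b nonzero in the local ring at P, and the coefficient
   of P in D is ord_P a - ord_P b. *)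
Definition is_div f (D : divisor) : Prop :=
  forall P, exists a b k l,
    [/\ order_at P a k, order_at P b l,
        (exists U, [/\ zopen U, U !=set0 & forall Q, U Q -> f Q * b Q = a Q]) &
        coeff P D = k%:Z - l%:Z].

Definition principal (D : divisor) : Prop := exists f, is_div f D.

(* Principal divisors already form a subgroup; taking the subgroup that they
   generate makes closure under subtraction immediate. *)
Definition prin (D : divisor) : Prop :=
  exists s t : seq divisor,
    [/\ forall E, E \in s -> principal E, forall E, E \in t -> principal E &
        D = \sum_(E <- s) E - \sum_(E <- t) E].

Lemma prin0 : prin 0.
Proof. by exists [::], [::]; split=> //; rewrite !big_nil subr0. Qed.

Lemma prinB D E : prin D -> prin E -> prin (D - E).
Proof.
move=> [s [t [hs ht ->]]] [s' [t' [hs' ht' ->]]].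
exists (s ++ t'), (t ++ s'); split.
- by move=> F; rewrite mem_cat => /orP[/hs|/ht'].
- by move=> F; rewrite mem_cat => /orP[/ht|/hs'].
- by rewrite !big_cat /= opprB opprD addrACA [- _ + _]addrC addrACA.
Qed.

Definition degree0 : {pred divisor} := fun D => deg D == 0.

Lemma degree0_zmod_closed : zmod_closed degree0.
Proof.
split=> [|D E /eqP hD /eqP hE]; first by rewrite /degree0 unfold_in deg0.
by rewrite unfold_in degB hD hE subr0.
Qed.
HB.instance Definition _ :=
  GRing.isZmodClosed.Build divisor degree0 degree0_zmod_closed.

Definition div0 := {D : divisor | degree0 D}.
HB.instance Definition _ := [isSub of div0 for @sval divisor degree0].
HB.instance Definition _ := [Choice of div0 by <:].
HB.instance Definition _ := [SubChoice_isSubZmodule of div0 by <:].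

Definition prin0_pred : {pred div0} := fun D => `[< prin (val D) >].

Lemma prin_zmod_closed : zmod_closed prin0_pred.
Proof.
split=> [|D E /asboolP hD /asboolP hE]; apply/asboolP.
  by rewrite raddf0; exact: prin0.
by rewrite raddfB; exact: prinB.
Qed.
HB.instance Definition _ :=
  GRing.isZmodClosed.Build div0 prin0_pred prin_zmod_closed.

(* The group of points of JX: divisors of degree 0 up to linear equivalence. *)
Definition jacobian := Quotient.quot (prin0_pred : GRing.ZmodClosed.type _).
HB.instance Definition _ := GRing.Zmodule.on jacobian.

End Jacobian.

Arguments degree0 {C X}.
Arguments prin0_pred {C X}.

(* A finite group G of automorphisms of X: a faithful left action of G on the
   points of X by morphisms (whose inverses are the morphisms given by x^-1). *)
Record aut_group (C : closedFieldType) (X : curve C) (gT : finGroupType)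
    (G : {group gT}) := AutGroup {
  aut_act :> gT -> pt X -> pt X;
  aut_act1 : forall P, aut_act 1%g P = P;
  aut_actM : {in G &, forall x y P,
    aut_act (x * y)%g P = aut_act x (aut_act y P)};
  aut_act_regular : {in G, forall x, regular_map (aut_act x)};
  aut_act_faithful : {in G, forall x, (forall P, aut_act x P = P) -> x = 1%g}
}.

(* Y, with p, is the quotient X/G: p is onto, its fibres are the orbits of G,
   Y has the quotient topology, and the regular functions on an open set V of
   Y are the G-invariant regular functions on p^-1(V). *)
Definition is_quotient (C : closedFieldType) (X Y : curve C)
    (gT : finGroupType) (G : {group gT}) (s : aut_group X G)
    (p : pt X -> pt Y) : Prop :=
  [/\ regular_map p,
      forall Q, exists P, p P = Q,
      forall P P', p P = p P' <-> exists2 x, x \in G & s x P = P',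
      forall V, zopen V <-> zopen (p @^-1` V) &
      forall V f, zopen V -> (regular_on V f <-> regular_on (p @^-1` V) (f \o p))].

Section PushForward.
Variables (C : closedFieldType) (X : curve C).
Implicit Types (h : pt X -> pt X) (D : divisor X).

Definition push h D : divisor X :=
  \sum_(P <- dom D) << coeff P D *g h P >>.

Lemma deg_push h D : deg (push h D) = deg D.
Proof.
rewrite -[RHS](congr1 (@deg _) (freeg_sumE D)) /push !raddf_sum /=.
by apply: eq_bigr => P _; rewrite !degU.
Qed.

Lemma degree0_push h (D : div0 X) : degree0 (push h (val D)).
Proof. by rewrite /degree0 deg_push; exact: (valP D). Qed.

Definition push0 h (D : div0 X) : div0 X :=
  Sub (push h (val D)) (degree0_push h D).

Section Automorphism.
Variables (h h' : pt X -> pt X).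
Hypotheses (hK : cancel h h') (hK' : cancel h' h).
Hypotheses (mh : regular_map h) (mh' : regular_map h').

Lemma coeff_push D Q : coeff Q (push h D) = coeff (h' Q) D.
Proof.
rewrite -[RHS](congr1 (coeff (h' Q)) (freeg_sumE D)) /push !raddf_sum /=.
apply: eq_bigr => P _; rewrite !coeffU; congr (_ * (nat_of_bool _)%:R).
by rewrite -[RHS](can_eq hK) hK'.
Qed.

Lemma pushB D E : push h (D - E) = push h D - push h E.
Proof.
by apply/eqP/freeg_eqP => Q; rewrite coeff_push !coeffB !coeff_push.
Qed.

Lemma regular_at_push P f : regular_at P f -> regular_at (h P) (f \o h').
Proof.
move=> [U [oU UP rU]]; have [oV rV] := mh' oU.
by exists (h' @^-1` U); split=> //=; [rewrite hK | exact: rV].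
Qed.

Lemma eq_near_push P f f' :
  eq_near P f f' -> eq_near (h P) (f \o h') (f' \o h').
Proof.
move=> [U [oU UP eU]]; have [oV _] := mh' oU.
by exists (h' @^-1` U); split=> //=; [rewrite hK | move=> Q /eU].
Qed.

Lemma vanishes_push k P f :
  vanishes_to P k f -> vanishes_to (h P) k (f \o h').
Proof.
elim: k f => [|k IH] f /=; first exact: regular_at_push.
move=> [m [a [b [ha hb e]]]]; exists m, (fun i => a i \o h'), (fun i => b i \o h').
split=> [i|i|].
- have [ra a0] := ha i; split; last by rewrite /= hK.
  exact: regular_at_push.
- exact: IH.
- exact: (eq_near_push e).
Qed.

End Automorphism.

Section AutomorphismPrincipal.
Variables (h h' : pt X -> pt X).
Hypotheses (hK : cancel h h') (hK' : cancel h' h).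
Hypotheses (mh : regular_map h) (mh' : regular_map h').

Lemma order_push P f k : order_at P f k -> order_at (h P) (f \o h') k.
Proof.
move=> [v nv]; split; first exact: vanishes_push.
move=> /(vanishes_push hK' mh); rewrite hK.
suff -> : (f \o h') \o h = f by [].
by apply: funext => Q /=; rewrite hK.
Qed.

Lemma is_div_push f D : is_div f D -> is_div (f \o h') (push h D).
Proof.
move=> fD Q; have [a [b [k [l [oa ob [U [oU [P UP] eU]] cD]]]]] := fD (h' Q).
exists (a \o h'), (b \o h'), k, l; split.
- by rewrite -[Q]hK'; exact: order_push.
- by rewrite -[Q]hK'; exact: order_push.
- exists (h' @^-1` U); split; first by have [] := mh' oU.
    by exists (h P) => /=; rewrite hK.
  by move=> R /= /eU.
- by rewrite (coeff_push hK hK').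
Qed.

Lemma prin_push D : prin D -> prin (push h D).
Proof.
move=> [s [t [hs ht ->]]].
have pS (r : seq (divisor X)) :
    push h (\sum_(E <- r) E) = \sum_(E <- map (push h) r) E.
  elim: r => [|E r IH]; first by rewrite !big_nil /push dom0 big_nil.
  rewrite /= !big_cons -IH; apply/eqP/freeg_eqP => Q.
  by rewrite coeffD !(coeff_push hK hK') coeffD.
exists (map (push h) s), (map (push h) t); split.
- move=> E' /mapP[E Er ->]; have [f fE] := hs E Er.
  by exists (f \o h'); exact: is_div_push.
- move=> E' /mapP[E Er ->]; have [f fE] := ht E Er.
  by exists (f \o h'); exact: is_div_push.
- by rewrite (pushB hK hK') !pS.
Qed.

End AutomorphismPrincipal.
End PushForward.

Section ActionOnJacobian.
Variables (C : closedFieldType) (X : curve C) (gT : finGroupType).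
Variables (G : {group gT}) (s : aut_group X G).

Local Notation class := (\pi_(jacobian X)%qT).

Definition push_ring (a : gT -> int) (D : div0 X) : div0 X :=
  \sum_(x in G) push0 (s x) D *~ a x.

(* The image in End(JX) of the element \sum_x a_x x of Z[G], acting by
   push-forward of divisors. *)
Definition rho (a : gT -> int) (z : jacobian X) : jacobian X :=
  class (push_ring a (generic_quotient.repr z)).

Lemma push_ringB a D E : push_ring a (D - E) = push_ring a D - push_ring a E.
Proof.
rewrite /push_ring -sumrB; apply: eq_bigr => x Gx; rewrite -mulrzBl.
congr (_ *~ _); apply: val_inj.
rewrite [RHS](raddfB val) -[LHS]/(push (s x) (val (D - E))) (raddfB val).
have xV : x^-1%g \in G by rewrite groupV.
apply: (@pushB _ _ _ (s x^-1%g)) => P; rewrite -aut_actM //.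
  by rewrite mulVg aut_act1.
by rewrite mulgV aut_act1.
Qed.

Lemma push_ring_prin a (D : div0 X) :
  prin0_pred D -> prin0_pred (push_ring a D).
Proof.
move=> pD; rewrite -[_ (push_ring _ _)]/(push_ring a D \in prin0_pred).
apply: rpred_sum => x Gx; apply: rpredMz; apply/asboolP.
have xV : x^-1%g \in G by rewrite groupV.
apply: (@prin_push _ _ _ (s x^-1%g)).
- by move=> P; rewrite -aut_actM // mulVg aut_act1.
- by move=> P; rewrite -aut_actM // mulgV aut_act1.
- exact: aut_act_regular.
- exact: aut_act_regular.
- exact/asboolP.
Qed.

Lemma rho_pi a (D : div0 X) : rho a (class D) = class (push_ring a D).
Proof.
rewrite /rho; apply/eqP; rewrite -Quotient.idealrBE -push_ringB.
apply: push_ring_prin.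
have : generic_quotient.repr (class D) - D \in prin0_pred by rewrite Quotient.idealrBE reprK.
by [].
Qed.

Lemma rhoD a : {morph rho a : y z / y + z}.
Proof.
move=> y z; rewrite -[y]reprK -[z]reprK -raddfD !rho_pi -raddfD.
have push_ringN E : push_ring a (- E) = - push_ring a E.
  by rewrite -sub0r push_ringB -[in LHS](subrr 0) push_ringB subrr sub0r.
by rewrite -{1}[generic_quotient.repr z]opprK push_ringB push_ringN opprK.
Qed.

(* Im(alpha) for alpha in Q[G], computed with the multiple m alpha; used for
   m > 0 and m alpha in Z[G], when numq is the identity. *)
Definition image_of (m : nat) (alpha : gT -> rat) : set (jacobian X) :=
  range (rho (fun x => numq (m%:R * alpha x))).

End ActionOnJacobian.

Section Isotypical.
Variables (gT : finGroupType) (G : {group gT}).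

Lemma irrType_exists : exists _ : irrType rat G, True.
Proof.
apply/asboolP; apply: (@socle_exists _ _ _ _ (regular_repr rat G)) => sG.
by apply/asboolP; exists sG.
Qed.

Definition simple_factors : irrType rat G := projT1 (cid irrType_exists).

(* [irr_comp simple_factors W] is the simple factor of Q[G] on which W is
   nonzero, and [Wedderburn_id] its unit, as an endomorphism of the regular
   representation; [gring_row] reads off its coordinates in Q[G]. *)
Definition isotypical_idempotent n (W : mx_representation rat G n) :
    gT -> rat :=
  fun x => gring_row (Wedderburn_id (irr_comp simple_factors W)) 0
                     (gring_index G x).

Lemma gring_mx_sum n (W : mx_representation rat G n) (b : 'rV_#|G|) :
  gring_mx W b = \sum_(x in G) b 0 (gring_index G x) *: W x.
Proof.
rewrite /gring_mx /= mulmx_sum_row linear_sum /= [RHS]big_enum_val /=.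
by apply: eq_bigr => i _; rewrite linearZ /= rowK mxvecK gring_valK.
Qed.

Let charG : ([pchar rat]^'.-group G)%g.
Proof. by apply/pgroupP => p _ _; rewrite inE /= Num.Theory.pchar_num. Qed.

Lemma isotypical_idempotentE n (W : mx_representation rat G n) :
  Wedderburn_id (irr_comp simple_factors W) =
  \sum_(x in G) isotypical_idempotent W x *: regular_repr rat G x.
Proof.
rewrite -gring_mx_sum gring_rowK // -(Wedderburn_sum_pchar simple_factors) //.
exact: (sumsmx_sup (irr_comp simple_factors W)) (Wedderburn_id_mem _).
Qed.

Lemma isotypical_idempotent_id n (W : mx_representation rat G n) :
  mx_irreducible W -> \sum_(x in G) isotypical_idempotent W x *: W x = 1%:M.
Proof.
move=> irrW; rewrite -gring_mx_sum -gring_opE -(gring_op1 W).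
rewrite -(Wedderburn_sum_id_pchar simple_factors charG) linear_sum.
rewrite (bigD1 (irr_comp simple_factors W)) //= big1 ?addr0 // => i ne_iW.
exact: (irr_comp'_op0_pchar charG irrW ne_iW (Wedderburn_id_mem i)).
Qed.

End Isotypical.

Definition isotypical_component (C : closedFieldType) (X : curve C)
    (gT : finGroupType) (G : {group gT}) (s : aut_group X G)
    n (W : mx_representation rat G n) (m : nat) : set (jacobian X) :=
  image_of s m (isotypical_idempotent W).

(* Main.v *)
(** Clear the denominators of the idempotent of W: this gives a nonzero element
    a = \sum_x a_x x of Z[G], so it suffices that no such element kills JX.

    Suppose that it does. Fix Q in X. For every P there is a function f on X
    with divisor \sum_x a_x (xP - xQ). Let u be the pullback to X of a function w
    on Y. As C is uncountable, for generic P the number u(P) is transcendental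
    over a field of definition of X, u and the points xQ, so there is a
    derivation of C that kills this field and maps u(P) to 1. Acting on
    coefficients, it becomes a derivation [delta] of C(X) with
    [delta (u - u P) = -1]. Then h_P = [delta f / f] is regular except at the
    points xP, where u - u(P) is a parameter and h_P has a simple pole with
    coefficient -a_x.

    For generic P and P' the function phi = \sum_g g^* (h_P h_P') is
    G-invariant, so it is a function on Y. Its only possible poles are simple
    ones at the images y of P and y' of P', and its coefficient at y is
    -\sum_g a_g h_P'(gP). This is nonzero for generic P, since
    \sum_g a_g g^* h_P' has a pole at P' with coefficient -\sum_g a_g^2. As Y
    has genus at least 2, there is a nonzero regular form omega on Y that
    vanishes at y', and omega(y) is nonzero for generic P. Hence phi omega has
    exactly one pole, a simple one, against the residue theorem. *)

From HB Require Import structures.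
Require Import Defs.
From mathcomp Require Import all_order all_fingroup all_character.
From mathcomp Require Import reals complex.
From mathcomp Require Import all_boot all_algebra finmap ring lra.
From mathcomp Require Import boolp classical_sets cardinality.
From mathcomp.multinomials Require Import freeg mpoly.

Set Implicit Arguments.
Unset Strict Implicit.
Unset Printing Implicit Defensive.

Import Order.TTheory GRing.Theory Num.Theory.
Local Open Scope ring_scope.
Local Open Scope classical_set_scope.

(** The product h_P h_P' is there because the trace of h_P alone has coefficient -\sum_g a_g at y,
    which is 0 unless W is trivial; the second factor weights the a_g by the values h_P'(gP). A
    derivation of the constants replaces d/du, which would have poles wherever u is ramified and
    would leave poles of df/f at the points xQ. Acting on coefficients, it maps every local ring of
    X into itself, and at a point whose coordinates it kills it preserves the maximal ideal, so that
    f'/f is regular there; in effect f is differentiated in the family parameter u(P). The field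
    over which u(P) must be transcendental has to be fixed before P, since f depends on P. The
    residue theorem is needed only for at most two simple poles, and is then proved without
    residues, from the structure of the ring of functions regular off the poles as a module over
    C[phi]. Uncountability of C also gives the Nullstellensatz, through a linear dependence between
    inverses of linear polynomials modulo a maximal ideal, and with it the constancy of everywhere
    regular functions. *)

Local Notation coord := Defs.coord.

(** * Noetherian rings *)

(** Dependent choice with memory of all earlier terms; it turns the failure of a finiteness
    condition into one infinite sequence. *)
Lemma dependent_sequence (T : choiceType) (Q : seq T -> T -> Prop) :
  (forall s, exists x, Q s x) ->
  exists G : nat -> T, forall k, Q (mkseq G k) (G k).
Proof.
move=> /choice[f Qf]; pose L k := iter k (fun s => rcons s (f s)) [::].
exists (fun k => f (L k)) => k; suff <- : L k = mkseq (fun k => f (L k)) k by [].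
by elim: k => //= k IH; rewrite mkseqS -IH.
Qed.

Section Span.
Variable R : comNzRingType.
Implicit Types (s t : seq R) (x y : R).

Definition span s x := exists a : nat -> R, x = \sum_(i < size s) a i * s`_i.

Lemma span0 s : span s 0.
Proof. by exists (fun=> 0); rewrite big1 // => i _; rewrite mul0r. Qed.

Lemma spanD s x y : span s x -> span s y -> span s (x + y).
Proof.
move=> [a ->] [b ->]; exists (fun i => a i + b i).
by rewrite -big_split; apply: eq_bigr => i _; rewrite mulrDl.
Qed.

Lemma spanM s x y : span s x -> span s (y * x).
Proof.
move=> [a ->]; exists (fun i => y * a i).
by rewrite big_distrr; apply: eq_bigr => i _; rewrite /= mulrA.
Qed.

Lemma span_sum s (I : Type) (r : seq I) (F : I -> R) :
  (forall i, span s (F i)) -> span s (\sum_(i <- r) F i).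
Proof.
by move=> h; elim/big_ind: _ => // [|x y]; [exact: span0|exact: spanD].
Qed.

Lemma mem_span s x : x \in s -> span s x.
Proof.
move=> /(nthP 0)[k ks <-]; exists (fun i => (i == k)%:R).
rewrite (bigD1 (Ordinal ks)) //= eqxx mul1r big1 ?addr0 // => i /eqP ik.
by case: eqP => [e|_]; rewrite ?mul0r //; case: ik; apply: val_inj.
Qed.

Lemma span_trans s t x :
  (forall y, y \in s -> span t y) -> span s x -> span t x.
Proof.
move=> h [a ->]; apply: span_sum => i; apply/spanM/h.
exact: mem_nth.
Qed.

Lemma span_sub s t x : {subset s <= t} -> span s x -> span t x.
Proof. by move=> h; apply: span_trans => y /h; exact: mem_span. Qed.

(** The ascending chain condition in sequence form: the ideals spanned by the initial segments of
    [G] cannot increase strictly forever. *)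
Definition noetherian := forall G : nat -> R, exists m, span (mkseq G m) (G m).

Lemma noetherian_fg (I : set R) : noetherian ->
  exists2 s, (forall x, x \in s -> I x) & forall x, I x -> span s x.
Proof.
move=> N; apply: contrapT => nfg.
pose Q s x := (forall y, y \in s -> I y) -> I x /\ ~ span s x.
have [s|G QG] := @dependent_sequence R Q.
  have [sI|nsI] := pselect (forall y, y \in s -> I y); last by exists 0 => /nsI.
  apply: contrapT => h; apply: nfg; exists s => // x Ix.
  by apply: contrapT => nx; apply: h; exists x.
have GI k : forall y, y \in mkseq G k -> I y.
  elim: k => // k IH y; rewrite mkseqS mem_rcons inE => /predU1P[->|/IH//].
  by have [] := QG k IH.
by have [m] := N G; have [_] := QG m (GI m).
Qed.

End Span.

Lemma noetherian_field (F : fieldType) : noetherian F.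
Proof.
move=> G; have [G0|G0] := eqVneq (G 0%N) 0; first by exists 0%N; rewrite G0; exact: span0.
exists 1%N, (fun=> G 1%N / G 0%N); rewrite size_mkseq big_ord1 /=.
by rewrite divfK.
Qed.

(** Hilbert's basis theorem. In the ideal generated by a counterexample [F], choose successively
    elements of least degree outside the span of the earlier ones; a relation between their leading
    coefficients yields one of smaller degree. *)
Lemma noetherian_poly (R : comNzRingType) : noetherian R -> noetherian {poly R}.
Proof.
move=> N F; apply: contrapT => nF.
have nF' m : ~ span (mkseq F m) (F m) by move=> h; apply: nF; exists m.
pose I x := exists m, span (mkseq F m) x.
have subF m n : (m <= n)%N -> {subset mkseq F m <= mkseq F n}.
  by move=> mn x /mapP[j]; rewrite mem_iota => /= jm ->; apply: map_f;
     rewrite mem_iota /= (leq_trans jm).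
have ID x y : I x -> I y -> I (x + y).
  move=> [m hm] [n hn]; exists (maxn m n).
  apply: spanD; [apply: span_sub hm|apply: span_sub hn]; apply: subF.
    exact: leq_maxl.
  exact: leq_maxr.
have IM x y : I x -> I (y * x) by move=> [m hm]; exists m; exact: spanM.
have nfg s : (forall y, y \in s -> I y) -> exists x, I x /\ ~ span s x.
  move=> sI; have [m hm] : exists m, forall y, y \in s -> span (mkseq F m) y.
    elim: s sI => [|y s IH] sI; first by exists 0%N.
    have [|m hm] := IH; first by move=> z zs; apply: sI; rewrite inE zs orbT.
    have [n hn] := sI y (mem_head _ _); exists (maxn m n) => z.
    rewrite inE => /predU1P[->|/hm hz].
      by apply: span_sub hn; apply: subF; exact: leq_maxr.
    by apply: span_sub hz; apply: subF; exact: leq_maxl.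
  exists (F m); split; last by move=> /(span_trans hm) /nF'.
  by exists m.+1; apply: mem_span; apply: map_f; rewrite mem_iota /=.
pose Q s x := (forall y, y \in s -> I y) ->
  [/\ I x, ~ span s x & forall z, I z -> ~ span s z -> (size x <= size z)%N].
have [s|G QG] := @dependent_sequence _ Q.
  have [sI|nsI] := pselect (forall y, y \in s -> I y); last by exists 0 => /nsI.
  have [x [Ix nx]] := nfg s sI.
  have ex : exists n, `[< exists z : {poly R}, [/\ I z, ~ span s z & size z = n] >].
    by exists (size x); apply/asboolP; exists x.
  case: (ex_minnP ex) => n /asboolP[z [Iz nz zn]] zmin; exists z => _.
  by split=> // w Iw nw; rewrite zn; apply: zmin; apply/asboolP; exists w.
have GI k : forall y, y \in mkseq G k -> I y.
  elim: k => // k IH y; rewrite mkseqS mem_rcons inE => /predU1P[->|/IH//].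
  by have [] := QG k IH.
have {}QG k := QG k (GI k).
have [m [a]] := N (fun k => lead_coef (G k)); rewrite size_mkseq => Gm.
have subG j : (j <= m)%N -> {subset mkseq G j <= mkseq G m}.
  by move=> jm x /mapP[l]; rewrite mem_iota => /= lj ->; apply: map_f;
     rewrite mem_iota /= (leq_trans lj).
have szG (j : 'I_m) : (size (G j) <= size (G m))%N.
  have [_ _ h] := QG j; have [Im nm _] := QG m; apply: h => // /(span_sub (subG _ _)).
  by move=> h; apply: nm; apply: h; exact: ltnW.
have [Im nm mmin] := QG m.
have Gm0 : G m != 0 by apply: contra_notN nm => /eqP->; exact: span0.
(* [T] is spanned by the earlier terms and has the leading term of [G m], so [G m - T] contradicts
   the minimality of [G m]. *)
pose T := \sum_(j < m) (a j)%:P * (G j * 'X^(size (G m) - size (G j))).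
have spT : span (mkseq G m) T.
  apply: span_sum => j; rewrite mulrCA mulrC; apply/spanM/mem_span/map_f.
  by rewrite mem_iota /=.
have IT : I (- T).
  rewrite -mulN1r; apply/IM/(big_ind I) => //; first by exists 0%N; exact: span0.
  by move=> j _; rewrite mulrCA mulrC; apply: IM; have [] := QG j.
have nspan : ~ span (mkseq G m) (G m - T).
  by move=> h; apply: nm; rewrite -[G m](subrK T); exact: spanD.
have := mmin _ (ID _ _ Im IT) nspan; apply/negP; rewrite -ltnNge.
rewrite -size_poly_gt0 in Gm0; pose N' := size (G m).
rewrite -(prednK Gm0) ltnS; apply/leq_sizeP => i Ni; rewrite coefB coef_sum.
under eq_bigr do rewrite coefCM coefMXn.
have [->|iN] := eqVneq i (size (G m)).-1.
  rewrite -/(lead_coef _) Gm; apply/eqP; rewrite subr_eq0; apply/eqP.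
  rewrite [in LHS](eq_bigr (fun j : 'I_m => a j * lead_coef (G j))); last first.
    by move=> j _; rewrite (nth_map 0%N) ?size_iota // nth_iota.
  apply: eq_bigr => j _; congr (_ * _).
  have [->|Gj0] := eqVneq (G j) 0; first by rewrite lead_coef0 coef0 if_same.
  have := szG j; rewrite -size_poly_gt0 in Gj0; rewrite /lead_coef.
  case: (size (G j)) (size (G m)) Gj0 Gm0 => [|n] [|k] //= _ _ nk.
  by rewrite subSS ltnNge leq_subr /= subKn.
have {}Ni : (size (G m) <= i)%N.
  by rewrite -(prednK Gm0) ltn_neqAle eq_sym iN.
rewrite nth_default // big1 ?subr0 // => j _.
case: ifP; rewrite ?mulr0 // => _; rewrite nth_default ?mulr0 //.
by rewrite leq_subRL ?subnK // (leq_trans (leq_subr _ _)).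
Qed.

Lemma noetherian_mpoly (F : fieldType) n : noetherian {mpoly F[n]}.
Proof.
elim: n => [|n IH] G.
  have [m [a e]] := noetherian_field (fun k => (G k)@_0%MM).
  exists m, (fun i => (a i)%:MP); apply/(can_inj (@mpolyKC F)).
  rewrite e raddf_sum !size_mkseq; apply: eq_bigr => i _.
  by rewrite /= mul_mpolyC mcoeffZ !nth_mkseq.
(* A left inverse of [muni]: the last variable is substituted for the polynomial variable. *)
pose psi (p : {poly {mpoly F[n]}}) : {mpoly F[n.+1]} := (mpwiden p).['X_ord_max].
have psiK p : psi (muni p) = p.
  rewrite muniE [RHS]mpolyE /psi !raddf_sum -horner_evalE raddf_sum /=.
  apply: eq_bigr => m _; rewrite horner_evalE.
  rewrite mpwidenZ mwidenZ mwidenX /mpwiden map_polyXn hornerZ hornerXn.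
  rewrite -scalerAl mpolyXn -mpolyXD; congr (_ *: 'X_[_]); apply/mnmP => i.
  rewrite mnmDE mulmnE mnmE.
  have [j ->|->] := unliftP ord_max i; last first.
    by rewrite mnmwiden_ordmax eqxx mul1n.
  have -> : fintype.lift (ord_max : 'I_n.+1) j = widen_ord (leqnSn n) j by apply: val_inj; exact: lift_max.
  by rewrite mnmwiden_widen mnmE eq_sym -val_eqE /= ltn_eqF // mul0n addn0.
have [m [a e]] := noetherian_poly IH (fun k => muni (G k)).
have psiM p q : psi (p * q) = psi p * psi q by rewrite /psi rmorphM hornerM.
exists m, (fun i => psi (a i)); rewrite -[LHS]psiK e size_mkseq.
rewrite /psi raddf_sum -horner_evalE raddf_sum size_mkseq; apply: eq_bigr => i _ /=.
by rewrite !nth_mkseq // horner_evalE -/(psi _) psiM psiK.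
Qed.

(** * The Nullstellensatz over an uncountable field *)

Record proper_ideal (R : comNzRingType) (I : set R) : Prop := ProperIdeal {
  ideal0 : I 0;
  idealD : forall x y, I x -> I y -> I (x + y);
  idealM : forall x y, I y -> I (x * y);
  ideal1 : ~ I 1
}.

Lemma maximal_ideal (R : comNzRingType) (J : set R) : proper_ideal J ->
  exists M, [/\ proper_ideal M, J `<=` M & forall x, ~ M x -> exists g, M (1 - g * x)].
Proof.
(* [Zorn_bigcup] also considers the empty chain, whose union is empty; hence the union with [J] in
   the predicate. *)
move=> pJ; pose P A := proper_ideal (A `|` J).
have [|A [PA Amax]] := @Zorn_bigcup R P.
  move=> F FP Ftot.
  have up x y : (\bigcup_(X in F) X `|` J) x -> (\bigcup_(X in F) X `|` J) y ->
      exists X, [/\ F X \/ X = set0, (X `|` J) x & (X `|` J) y].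
    move=> [[X FX Xx]|Jx] [[X' FX' Xy]|Jy]; last by exists set0; split; right.
    - have [XX'|XX'] := Ftot _ _ FX FX'.
        by exists X'; split; [left|left; exact: XX'|left].
      by exists X; split; [left|left|left; exact: XX'].
    - by exists X; split; [left|left|right].
    - by exists X'; split; [left|right|left].
  have PF X : F X \/ X = set0 -> proper_ideal (X `|` J).
    by move=> [/FP//|->]; rewrite set0U.
  have FU X : F X \/ X = set0 -> X `|` J `<=` \bigcup_(X in F) X `|` J.
    by move=> [FX|->] z [Xz|Jz]; [left; exists X|right|case: Xz|right].
  split.
  - by right; exact: (ideal0 pJ).
  - move=> x y hx hy; have [X [FX Xx Xy]] := up x y hx hy.
    by apply: (FU _ FX); exact: (idealD (PF _ FX)).
  - move=> x y hy; have [X [FX _ Xy]] := up y y hy hy.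
    by apply: (FU _ FX); exact: (idealM (PF _ FX)).
  - move=> h1; have [X [FX _ X1]] := up 1 1 h1 h1.
    exact: (ideal1 (PF _ FX)) X1.
exists (A `|` J); split=> [//||x nMx]; first by move=> z; right.
pose B z := exists m g, (A `|` J) m /\ z = m + g * x.
have AB : A `<=` B by move=> z Az; exists z, 0; split; [left|rewrite mul0r addr0].
have JB : B `|` J = B.
  by apply/setUidPl => z Jz; exists z, 0; split; [right|rewrite mul0r addr0].
apply: contrapT => nB1; suff : ~ P B.
  apply; rewrite /P JB; split.
  - by exists 0, 0; split; [exact: (ideal0 PA)|rewrite mul0r addr0].
  - move=> _ _ [m [g [hm ->]]] [m' [g' [hm' ->]]].
    exists (m + m'), (g + g'); split; first exact: (idealD PA).
    by rewrite mulrDl addrACA.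
  - move=> y _ [m [g [hm ->]]]; exists (y * m), (y * g); split.
      exact: (idealM PA).
    by rewrite mulrDr mulrA.
  - move=> [m [g [hm e]]]; apply: nB1; exists g.
    by rewrite e addrK.
apply: Amax; split=> // BA; apply: nMx; left; apply: BA.
by exists 0, 1; split; [exact: (ideal0 PA)|rewrite mul1r add0r].
Qed.

Section Nullstellensatz.
Variables (C : closedFieldType) (n : nat).
Hypothesis C_uncountable : ~ countable [set: C].

(** If no ['X_i - c] lay in the maximal ideal, their inverses modulo it would be uncountably many
    elements of a space of countable dimension. A linear relation between them makes the class of
    ['X_i] algebraic over [C], hence a constant after all. *)
Lemma weak_nullstellensatz (J : set {mpoly C[n]}) : proper_ideal J ->
  exists v : 'I_n -> C, forall F, J F -> F.@[v] = 0.
Proof.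
move=> /maximal_ideal[M [pM JM Mmax]].
have MB x y : M x -> M y -> M (x - y).
  by move=> hx hy; rewrite -mulN1r; apply: (idealD pM) => //; exact: (idealM pM).
have Mprime x y : M (x * y) -> M x \/ M y.
  move=> Mxy; have [|nx] := pselect (M x); first by left.
  have [g Mg] := Mmax x nx; right; rewrite -[y](subrK (g * x * y)).
  apply: (idealD pM); last by rewrite -mulrA; exact: (idealM pM).
  by rewrite -{1}[y]mul1r -mulrBl mulrC; exact: (idealM pM).
have Mpoint i : exists c, M ('X_i - c%:MP).
  apply: contrapT => nM; have {}nM c : ~ M ('X_i - c%:MP) by move=> h; apply: nM; exists c.
  have /choice[g Mg] c := Mmax _ (nM c).
  (* There are countably many degrees and uncountably many inverses [g c]; infinitely many of one
     degree lie in a finite-dimensional space. *)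
  have [d infd] : exists d, infinite_set [set c | msize (g c) = d].
    apply: contrapT => h; apply: C_uncountable.
    have -> : [set: C] = \bigcup_d [set c | msize (g c) = d].
      by apply/seteqP; split=> // c _; exists (msize (g c)).
    apply: bigcup_countable => // d _; apply: finite_set_countable.
    by apply: contrapT => h'; apply: h; exists d.
  pose K := #|{: 'X_{1..n < d}}|.
  have [B BS KB] := infinite_set_fset K.+1 infd.
  pose cs := take K.+1 (enum_fset B).
  have scs : size cs = K.+1 by rewrite size_takel // -cardfE.
  have ucs : uniq cs by apply/take_uniq/fset_uniq.
  have msz c : c \in cs -> msize (g c) = d by move=> /mem_take /BS.
  pose A := \matrix_(j < K.+1, m < K) (g cs`_j)@_(bmnm (enum_val m)).
  have [l l0 lA] : exists2 l : 'rV_K.+1, l != 0 & l *m A = 0.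
    have : kermx A != 0.
      rewrite -mxrank_eq0 mxrank_ker subn_eq0 -ltnNge ltnS.
      exact: rank_leq_col.
    by move=> /rowV0Pn[l lA l0]; exists l => //; apply/sub_kermxP.
  have lg : \sum_(j < K.+1) l 0 j *: g cs`_j = 0.
    apply/mpolyP => m; rewrite raddf_sum mcoeff0 /=.
    under eq_bigr do rewrite mcoeffZ.
    have [md|md] := ltnP (mdeg m) d.
      transitivity ((l *m A) 0 (enum_rank (BMultinom md))); last by rewrite lA mxE.
      by rewrite mxE; apply: eq_bigr => j _; rewrite mxE enum_rankK.
    rewrite big1 // => j _; rewrite (memN_msupp_eq0 (msize_mdeg_ge _)) ?mulr0 //.
    by rewrite msz // mem_nth ?scs.
  pose x j : {mpoly C[n]} := 'X_i - (cs`_j)%:MP.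
  pose q : {poly C} := \sum_(j < K.+1) l 0 j *: \prod_(k < K.+1 | k != j) ('X - (cs`_k)%:P).
  have qE : (map_poly (@mpolyC n C) q).['X_i] =
      \sum_(j < K.+1) l 0 j *: \prod_(k < K.+1 | k != j) x k.
    rewrite /q rmorph_sum -horner_evalE rmorph_sum; apply: eq_bigr => j _ /=.
    rewrite horner_evalE map_polyZ hornerZ mul_mpolyC; congr (_ *: _).
    rewrite rmorph_prod -horner_evalE rmorph_prod; apply: eq_bigr => k _ /=.
    by rewrite horner_evalE rmorphB /= map_polyX map_polyC /= hornerXsubC.
  have Mq : M (map_poly (@mpolyC n C) q).['X_i].
    rewrite -[_.[_]]subr0 -(mulr0 (\prod_(k < K.+1) x k)) -lg qE big_distrr /= -sumrB.
    apply: (big_ind M) => [||j _]; [exact: (ideal0 pM)|exact: (idealD pM)|].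
    rewrite [X in _ - X * _](bigD1 j) //=; set P := \prod_(k < _ | _) _.
    have -> : l 0 j *: P - x j * P * (l 0 j *: g cs`_j) =
        (l 0 j *: P) * (1 - g cs`_j * x j).
      by rewrite mulrBr mulr1 -scalerAl -scalerAr; congr (_ - _ *: _); ring.
    exact: (idealM pM).
  have q0 : q != 0.
    have /rV0Pn[j lj0] := l0; apply: contraNneq lj0 => q0.
    have : q.[cs`_j] = 0 by rewrite q0 horner0.
    rewrite /q -horner_evalE rmorph_sum (bigD1 j) //= [X in _ + X]big1 ?addr0 => [|k kj].
      rewrite horner_evalE hornerZ => /eqP. rewrite mulf_eq0 => /orP[//|].
      rewrite -horner_evalE rmorph_prod prodf_seq_eq0 => /hasP[k _ /andP[kj]].
      rewrite /= horner_evalE hornerXsubC subr_eq0 nth_uniq ?scs // => /eqP e.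
      by case/eqP: kj; apply: val_inj.
    rewrite horner_evalE hornerZ -horner_evalE rmorph_prod (bigD1 j) 1?eq_sym //=.
    by rewrite horner_evalE hornerXsubC subrr mul0r mulr0.
  have [r qr] := closed_field_poly_normal q.
  move: Mq; rewrite qr map_polyZ hornerZ.
  have Mr : ~ M (map_poly (@mpolyC n C) (\prod_(z <- r) ('X - z%:P))).['X_i].
    elim: r {qr} => [|z r IH].
      by rewrite big_nil rmorph1 hornerC; exact: (ideal1 pM).
    rewrite big_cons rmorphM hornerM /= => /Mprime[|//].
    by rewrite rmorphB /= map_polyX map_polyC /= hornerXsubC; exact: nM.
  move=> /Mprime[|//]; rewrite -lead_coef_eq0 in q0 => h; apply: (ideal1 pM).
  rewrite -[1](_ : (lead_coef q)^-1%:MP * (lead_coef q)%:MP = 1); last first.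
    by rewrite -mpolyCM mulVf.
  exact: (idealM pM).
have /choice[v Mv] := Mpoint; exists v.
have MF F : M (F - F.@[v]%:MP).
  have MM x y : M (x - x.@[v]%:MP) -> M (y - y.@[v]%:MP) -> M (x * y - (x * y).@[v]%:MP).
    move=> hx hy; have -> : x * y - (x * y).@[v]%:MP =
        y * (x - x.@[v]%:MP) + x.@[v]%:MP * (y - y.@[v]%:MP).
      by rewrite mevalM mpolyCM; ring.
    by apply: (idealD pM); exact: (idealM pM).
  have MC c : M (c%:MP - (c%:MP).@[v]%:MP) by rewrite mevalC subrr; exact: (ideal0 pM).
  rewrite [F]mpolyE.
  apply: (big_ind (fun F => M (F - F.@[v]%:MP))) => [|x y hx hy|m _].
  - exact: MC.
  - by rewrite mevalD mpolyCD opprD addrACA; exact: (idealD pM).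
  - rewrite -mul_mpolyC; apply: (MM) => //; rewrite mpolyXE_id.
    apply: (big_ind (fun F => M (F - F.@[v]%:MP))) => [|x y hx hy|i _]; [exact: MC|exact: MM|].
    elim: (m i) => [|k IH]; first exact: MC.
    by rewrite exprS; apply: (MM) => //; rewrite mevalXU.
move=> F /JM MF0; apply/eqP; apply: contrapT => /negP F0; apply: (ideal1 pM).
rewrite -[1](_ : (F.@[v])^-1%:MP * F.@[v]%:MP = 1); last by rewrite -mpolyCM mulVf.
apply: (idealM pM); rewrite -[_%:MP](subKr F); exact: MB.
Qed.
End Nullstellensatz.

(** * Derivations of the ground field *)

Section ExtendDerivation.
Variable C : fieldType.
Hypothesis charC : [pchar C] =i pred0.
Implicit Types (G : set (C * C)) (p q r s : {poly C}).

(** Derivations defined on a subring of [C], as sets of pairs: they are then ordered by inclusion,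
    as Zorn's lemma requires. Single-valuedness at 0 suffices, by subtraction. *)
Record derivation_graph G : Prop := DerivationGraph {
  dgraph1 : G (1, 0);
  dgraphB : forall a b a' b', G (a, b) -> G (a', b') -> G (a - a', b - b');
  dgraphM : forall a b a' b', G (a, b) -> G (a', b') -> G (a * a', a * b' + b * a');
  dgraph_fun : forall b, G (0, b) -> b = 0
}.

(** [q] is [p] with the partial derivation applied to its coefficients, written p^D below. *)
Definition poly_graph G p q := forall i, G (p`_i, q`_i).

Section Extend.
Variables (G : set (C * C)) (dG : derivation_graph G).

Lemma dgraph0 : G (0, 0).
Proof. by have := dgraphB dG (dgraph1 dG) (dgraph1 dG); rewrite !subrr. Qed.

Lemma dgraphD a b a' b' : G (a, b) -> G (a', b') -> G (a + a', b + b').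
Proof.
move=> h h'; rewrite -[a']opprK -[b']opprK; apply: (dgraphB dG) => //.
by rewrite -sub0r -[- b']sub0r; apply: (dgraphB dG) => //; exact: dgraph0.
Qed.

Lemma dgraph_sum n (f g : 'I_n -> C) : (forall i, G (f i, g i)) ->
  G (\sum_i f i, \sum_i g i).
Proof.
by move=> h; apply: (big_ind2 (fun x y => G (x, y))) => *; [exact: dgraph0|exact: dgraphD|].
Qed.

Lemma poly_graphB p q p' q' :
  poly_graph G p q -> poly_graph G p' q' -> poly_graph G (p - p') (q - q').
Proof. by move=> h h' i; rewrite !coefB; apply: (dgraphB dG). Qed.

Lemma poly_graphM p q p' q' :
  poly_graph G p q -> poly_graph G p' q' -> poly_graph G (p * p') (p * q' + q * p').
Proof.
move=> h h' i; rewrite coefD !coefM -big_split /=; apply: dgraph_sum => j.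
exact: (dgraphM dG).
Qed.

Lemma poly_graphC a b : G (a, b) -> poly_graph G a%:P b%:P.
Proof. by move=> h i; rewrite !coefC; case: eqP => // _; exact: dgraph0. Qed.

Lemma poly_graphXn n : poly_graph G 'X^n 0.
Proof.
by move=> i; rewrite coef0 coefXn; case: eqP => _; [exact: (dgraph1 dG)|exact: dgraph0].
Qed.

Lemma poly_graph_deriv p q : poly_graph G p q -> poly_graph G p^`() q^`().
Proof.
move=> h i; rewrite !coef_deriv; have := h i.+1.
move: p`_i.+1 q`_i.+1 => a b Gab; elim: i.+1 => [|k IH]; first by rewrite !mulr0n; exact: dgraph0.
by rewrite !mulrS; exact: dgraphD.
Qed.

(** The extension must send p(x) to p^D(x) + p'(x) y; the hypothesis says that this depends only on
    the value p(x). *)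
Lemma extend_graph x y :
  (forall r s, poly_graph G r s -> r.[x] = 0 -> s.[x] + r^`().[x] * y = 0) ->
  exists G', [/\ derivation_graph G', G `<=` G' & G' (x, y)].
Proof.
move=> K; exists [set z | exists p q, [/\ poly_graph G p q, z.1 = p.[x] &
  z.2 = q.[x] + p^`().[x] * y]]; split.
- split=> /=.
  + exists 1%:P, 0; split; rewrite ?hornerC ?derivC ?horner0 ?mul0r ?addr0 //.
    by apply: poly_graphC; exact: (dgraph1 dG).
  + move=> a b a' b' [p [q [h -> ->]]] [p' [q' [h' -> ->]]].
    exists (p - p'), (q - q'); split; first exact: poly_graphB.
      by rewrite /= !hornerE.
    by rewrite /= derivB !hornerE; ring.
  + move=> a b a' b' [p [q [h -> ->]]] [p' [q' [h' -> ->]]].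
    exists (p * p'), (p * q' + q * p'); split; first exact: poly_graphM.
      by rewrite /= !hornerE.
    by rewrite /= derivM !hornerE; ring.
  + by move=> b [p [q [h e ->]]]; exact: K.
- move=> [a b] Gab; exists a%:P, b%:P; split=> /=; [exact: poly_graphC|by rewrite hornerC|].
  by rewrite derivC !hornerE.
- exists 'X, 0; split=> /=; [exact: (poly_graphXn 1)|by rewrite hornerX|].
  by rewrite derivX !hornerE.
Qed.

(** If [x] is transcendental over the domain, any value will do. Otherwise a relation [m] of least
    degree forces the value - m^D(x) / m'(x), where m'(x) is nonzero by minimality and
    characteristic 0; other relations follow by division by [m]. *)
Lemma extend_graph_root x : exists G' y,
  [/\ derivation_graph G', G `<=` G' & G' (x, y)].
Proof.
have [alg|nalg] := pselect (exists m m1, [/\ poly_graph G m m1, m != 0 & m.[x] = 0]); last first.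
  have [|G' G'P] := @extend_graph x 0; last by exists G', 0.
  move=> r s rs rx; have r0 : r = 0.
    by apply/eqP; apply: contrapT => /negP r0; apply: nalg; exists r, s.
  suff -> : s = 0 by rewrite r0 deriv0 !horner0 mul0r addr0.
  by apply/polyP => i; rewrite coef0; apply: (dgraph_fun dG); have := rs i; rewrite r0 coef0.
have ex : exists n, `[< exists m m1 : {poly C},
    [/\ poly_graph G m m1, m != 0, m.[x] = 0 & size m = n] >].
  by have [m [m1 [? ? ?]]] := alg; exists (size m); apply/asboolP; exists m, m1.
case: (ex_minnP ex) => n /asboolP[m [m1 [hm m0 mx mn]]] nmin.
have small r s : poly_graph G r s -> r.[x] = 0 -> (size r < n)%N -> r = 0.
  move=> rs rx; apply: contraTeq => r0; rewrite -leqNgt; apply: nmin.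
  by apply/asboolP; exists r, s.
have m2 : (1 < n)%N.
  rewrite -mn ltnNge; apply/negP => /size1_polyC e.
  by move: mx m0; rewrite e hornerC => ->; rewrite eqxx.
have mx' : m^`().[x] != 0.
  apply/eqP => /(small _ _ (poly_graph_deriv hm)); rewrite -mn lt_size_deriv // => /(_ erefl).
  have [k nk] : exists k, n = k.+2 by exists n.-2; case: n m2 {ex nmin small mn} => [|[]].
  move=> /(congr1 (fun p : {poly C} => p`_k)); rewrite coef_deriv coef0.
  move=> /eqP; rewrite -mulr_natr mulf_eq0.
  have -> : k.+1 = (size m).-1 by rewrite mn nk.
  rewrite -/(lead_coef m) lead_coef_eq0 (negPf m0) mn nk.
  by have /pcharf0P-> := charC.
have [|G' G'P] := @extend_graph x (- m1.[x] / m^`().[x]); last by exists G', (- m1.[x] / m^`().[x]).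
set y := _ / _; have Km : m1.[x] + m^`().[x] * y = 0.
  by rewrite /y mulrCA mulfV // mulr1 subrr.
move=> r; have [k] := ubnP (size r); elim: k r => // k IH r; rewrite ltnS => rk s rs rx.
have [rn|nr] := ltnP (size r) n.
  have r0 := small _ _ rs rx rn; suff -> : s = 0 by rewrite r0 deriv0 !horner0 mul0r addr0.
  by apply/polyP => i; rewrite coef0; apply: (dgraph_fun dG); have := rs i; rewrite r0 coef0.
(* The domain is only a subring, so [m] cannot be made monic: this is pseudo-division, after
   multiplying [r] by the leading coefficient of [m]. *)
pose l := lead_coef m; pose l1 := m1`_n.-1; pose c := lead_coef r; pose c1 := s`_(size r).-1.
pose X := 'X^(size r - n) : {poly C}.
have hl : G (l, l1) by rewrite /l lead_coefE mn; exact: hm.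
have hc : G (c, c1) by exact: rs.
pose r2 := l%:P * r - c%:P * (X * m).
pose s2 := l%:P * s + l1%:P * r - (c%:P * (X * m1 + 0 * m) + c1%:P * (X * m)).
have h2 : poly_graph G r2 s2.
  apply: poly_graphB; first by apply: poly_graphM => //; exact: poly_graphC.
  apply: poly_graphM; first exact: poly_graphC.
  by apply: poly_graphM => //; exact: poly_graphXn.
have r2x : r2.[x] = 0 by rewrite /r2 hornerD hornerN !hornerM mx rx !mulr0 subrr.
have sz2 : (size r2 < size r)%N.
  have r0 : (0 < size r)%N by rewrite (leq_trans _ nr) // ltnW.
  have n0 : (0 < n)%N by exact: ltnW.
  rewrite -(prednK r0) ltnS; apply/leq_sizeP => i ri; rewrite /r2 coefB !coefCM coefXnM.
  have [->|ir] := eqVneq i (size r).-1.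
    rewrite ifF; last by rewrite ltnNge -subn1 leq_sub2l.
    rewrite -[(size r).-1]subn1 subnAC subKn // subn1 -mn -/(lead_coef m) -/l subn1.
    by rewrite -/(lead_coef r) -/c mulrC subrr.
  have {}ri : (size r <= i)%N by rewrite -(prednK r0) ltn_neqAle eq_sym ir.
  rewrite nth_default // ifF; last by rewrite ltnNge (leq_trans _ ri) // leq_subr.
  rewrite [m`__]nth_default ?mulr0 ?subrr //.
  by rewrite mn leq_subRL ?subnK // (leq_trans (leq_subr _ _)).
have K2 := IH r2 (leq_trans sz2 rk) s2 h2 r2x.
have l0 : l != 0 by rewrite lead_coef_eq0.
apply: (mulfI l0); rewrite mulr0 -[RHS]K2 /s2 /r2.
rewrite derivB !derivM !derivC !(hornerD, hornerN, hornerM, hornerC) mx rx.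
rewrite -[m1.[x]](addrK (m^`().[x] * y)) Km; move: X.[x] X^`().[x] => X0 X1; ring.
Qed.
End Extend.

Lemma derivation_extension G : derivation_graph G ->
  exists D : C -> C, [/\ forall x y, D (x + y) = D x + D y,
    forall x y, D (x * y) = x * D y + D x * y & forall x y, G (x, y) -> D x = y].
Proof.
move=> dG; pose P A := derivation_graph (A `|` G).
have [|A [PA Amax]] := @Zorn_bigcup _ P.
  move=> F FP Ftot; have PF X : F X \/ X = set0 -> derivation_graph (X `|` G).
    by move=> [/FP//|->]; rewrite set0U.
  have FU X : F X \/ X = set0 -> X `|` G `<=` \bigcup_(X in F) X `|` G.
    by move=> [FX|->] z [Xz|Jz]; [left; exists X|right|case: Xz|right].
  have up x y : (\bigcup_(X in F) X `|` G) x -> (\bigcup_(X in F) X `|` G) y ->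
      exists X, [/\ F X \/ X = set0, (X `|` G) x & (X `|` G) y].
    move=> [[X FX Xx]|Jx] [[X' FX' Xy]|Jy]; last by exists set0; split; right.
    - have [XX'|XX'] := Ftot _ _ FX FX'.
        by exists X'; split; [left|left; exact: XX'|left].
      by exists X; split; [left|left|left; exact: XX'].
    - by exists X; split; [left|left|right].
    - by exists X'; split; [left|right|left].
  split.
  - by right; exact: (dgraph1 dG).
  - move=> a b a' b' hx hy; have [X [FX Xx Xy]] := up _ _ hx hy.
    by apply: (FU _ FX); exact: (dgraphB (PF _ FX)).
  - move=> a b a' b' hx hy; have [X [FX Xx Xy]] := up _ _ hx hy.
    by apply: (FU _ FX); exact: (dgraphM (PF _ FX)).
  - move=> b hb; have [X [FX Xb _]] := up _ _ hb hb.
    exact: (dgraph_fun (PF _ FX)).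
have tot x : exists y, (A `|` G) (x, y).
  apply: contrapT => nx; have [G' [y [dG' GG' G'x]]] := extend_graph_root PA x.
  have [] : ~ P G'.
    apply: Amax; split; first by move=> z Az; apply: GG'; left.
    by move=> G'A; apply: nx; exists y; left; exact: G'A.
  rewrite /P; suff -> : G' `|` G = G' by [].
  by apply/setUidPl => z Gz; apply: GG'; right.
have /choice[D DA] := tot.
have funA a b b' : (A `|` G) (a, b) -> (A `|` G) (a, b') -> b = b'.
  move=> h h'; apply/eqP; rewrite -subr_eq0; apply/eqP/(dgraph_fun PA).
  by rewrite -(subrr a); exact: (dgraphB PA).
exists D; split=> [x y|x y|x y Gxy].
- by apply: funA (DA _) _; exact: dgraphD.
- by apply: funA (DA _) _; exact: (dgraphM PA).
- by apply: funA (DA _) _; right.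
Qed.

Section Constants.
Variable S : seq C.

(* Ring expressions in the elements of [S]. These form a countable type, so only
   countably many elements are algebraic over [S]. *)
Fixpoint tree_eval (t : GenTree.tree nat) : C :=
  match t with
  | GenTree.Leaf i => S`_i
  | GenTree.Node 0 [:: a; b] => tree_eval a - tree_eval b
  | GenTree.Node 1 [:: a; b] => tree_eval a * tree_eval b
  | GenTree.Node _ _ => 1
  end.

Definition poly_of_trees (s : seq (GenTree.tree nat)) : {poly C} :=
  Poly [seq tree_eval t | t <- s].

Definition algebraic_over : set C :=
  \bigcup_(s in [set s | poly_of_trees s != 0]) [set t | root (poly_of_trees s) t].

Lemma countable_algebraic_over : countable algebraic_over.
Proof.
apply: bigcup_countable => // s /= s0; apply: finite_set_countable.
apply: contrapT => /(infinite_set_fset (size (poly_of_trees s)))[B BS].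
apply/negP; rewrite -ltnNge; apply: max_poly_roots => //.
  by apply/allP => x /BS.
exact: fset_uniq.
Qed.

(** The zero derivation on the ring generated by [S] extends by t -> 1, there being no relation for
    [t] over that ring, and then to all of [C]. *)
Lemma derivation_over t : ~ algebraic_over t ->
  exists D : C -> C, [/\ forall x y, D (x + y) = D x + D y,
    forall x y, D (x * y) = x * D y + D x * y, forall x, x \in S -> D x = 0 & D t = 1].
Proof.
move=> nt; pose k0 a := exists u, a = tree_eval u.
pose G (z : C * C) := k0 z.1 /\ z.2 = 0.
have dG : derivation_graph G.
  split; rewrite /G /=.
  (* Nodes labelled neither 0 nor 1 evaluate to 1. *)
  - by split=> //; exists (GenTree.Node 2 [::]).
  - move=> a b a' b' [[u ->] ->] [[u' ->] ->]; rewrite subr0; split=> //.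
    by exists (GenTree.Node 0 [:: u; u']).
  - move=> a b a' b' [[u ->] ->] [[u' ->] ->]; rewrite mulr0 mul0r addr0; split=> //.
    by exists (GenTree.Node 1 [:: u; u']).
  - by move=> b [].
have [|G1 [dG1 GG1 G1t]] := @extend_graph G dG t 1.
  move=> r s rs rt; have -> : s = 0 by apply/polyP => i; rewrite coef0; case: (rs i).
  suff -> : r = 0 by rewrite deriv0 !horner0 mul0r addr0.
  apply/eqP; apply: contrapT => /negP r0; apply: nt.
  have /choice[f rf] : forall i, exists u, r`_i = tree_eval u by move=> i; case: (rs i).
  have rE : r = poly_of_trees (mkseq f (size r)).
    apply/polyP => i; rewrite coef_Poly -map_comp.
    have [ir|ri] := ltnP i (size r); first by rewrite nth_mkseq /= ?rf.
    by rewrite !nth_default ?size_mkseq.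
  by exists (mkseq f (size r)); rewrite /= -rE //; apply/eqP.
have [D [DD DM DG]] := derivation_extension dG1.
exists D; split=> // [x xS|]; last exact: DG.
apply/DG/GG1; split=> //; exists (GenTree.Leaf (index x S)).
by rewrite /= nth_index.
Qed.

End Constants.
End ExtendDerivation.

(** * The Zariski topology of a curve *)

Lemma dhomogXn_prod (R : comNzRingType) n (d : nat) (F : {mpoly R[n]}) (c : R) v :
  F \is d.-homog -> F.@[fun i => c * v i] = c ^+ d * F.@[v].
Proof.
move=> /dhomogP hF; rewrite !mevalE big_distrr /=; apply: eq_big_seq => m mF.
rewrite mulrCA; congr (_ * _).
under eq_bigr do rewrite exprMn; rewrite big_split /= prodrXr.
by rewrite -mdegE hF.
Qed.

Section ProjectiveTopology.
Variables (C : closedFieldType) (n : nat).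
Local Notation pspace := (pspace C n).
Implicit Types (P Q : pspace) (Z A B : set pspace) (F : {mpoly C[n.+1]}).

Lemma coord_neq0 P : exists i, coord P i != 0.
Proof.
case: P => U U1; rewrite /coord /=.
have : vpick U != 0 by rewrite vpick0 -dimv_eq0 (eqP U1).
by move=> /rV0Pn.
Qed.

Lemma pspace_line P : val P = <[vpick (val P)]>%VS.
Proof.
apply/esym/eqP; rewrite eqEdim -memvE memv_pick dim_vline (eqP (valP P)).
by rewrite vpick0 -dimv_eq0 (eqP (valP P)).
Qed.

Lemma coord_inj P Q c : (forall i, coord P i = c * coord Q i) -> P = Q.
Proof.
move=> h; apply: val_inj; rewrite /= (pspace_line P) (pspace_line Q).
have e : vpick (val P) = c *: vpick (val Q).
  by apply/rowP => i; rewrite mxE; exact: h.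
have P0 : vpick (val P) != 0 by rewrite vpick0 -dimv_eq0 (eqP (valP P)).
have c0 : c != 0 by apply: contraNneq P0 => c0; rewrite e c0 scale0r.
apply/eqP; rewrite eqEdim !dim_vline -memvE e memvZ ?memv_line //=.
by rewrite scaler_eq0 (negPf c0); case: (_ == 0).
Qed.

Lemma point_of (v : 'I_n.+1 -> C) i : v i != 0 ->
  exists P c, c != 0 /\ forall j, coord P j = c * v j.
Proof.
move=> vi; pose w : 'rV[C]_n.+1 := \row_j v j.
have w0 : w != 0 by apply/rV0Pn; exists i; rewrite mxE.
have w1 : \dim <[w]>%VS == 1%N by rewrite dim_vline w0.
exists (exist (fun U => \dim U == 1%N) _ w1); rewrite /coord /=.
have /vlineP[c hc] := memv_pick <[w]>%VS; exists c; split=> [|j]; last first.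
  by rewrite hc !mxE.
apply/eqP => c0; move: hc; rewrite c0 scale0r => /eqP.
by rewrite vpick0 -dimv_eq0 dim_vline w0.
Qed.

Lemma meval_coord_eq0 d F P (v : 'I_n.+1 -> C) c : F \is d.-homog -> c != 0 ->
  (forall j, coord P j = c * v j) -> (F.@[coord P] == 0) = (F.@[v] == 0).
Proof.
move=> hF c0 e; rewrite (meval_eq (v2 := fun j => c * v j)) // (dhomogXn_prod _ _ hF).
by rewrite mulf_eq0 expf_eq0 (negPf c0) andbF.
Qed.

Lemma proj_closedU A B : proj_closed A -> proj_closed B -> proj_closed (A `|` B).
Proof.
move=> [S hS ->] [T hT ->]; exists [set FG | exists F G, [/\ S F, T G & FG = F * G]].
  move=> _ [F [G [/hS[d hd] /hT[e he] ->]]]; exists (d + e)%N; exact: dhomogM.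
apply/seteqP; split=> P /=.
  by move=> [h|h] _ [F [G [SF TG ->]]]; rewrite mevalM ?(h F SF) ?(h G TG) ?mul0r ?mulr0.
move=> h; have [hP|] := pselect (forall F, S F -> F.@[coord P] = 0); first by left.
move=> /existsNP[F /not_implyP[SF F0]]; right=> G TG.
have /eqP := h _ (ex_intro _ F (ex_intro _ G (And3 SF TG erefl))).
by rewrite mevalM mulf_eq0 => /orP[/eqP//|/eqP].
Qed.

Lemma proj_closedI A B : proj_closed A -> proj_closed B -> proj_closed (A `&` B).
Proof.
move=> [S hS ->] [T hT ->]; exists (S `|` T); first by move=> F [/hS|/hT].
apply/seteqP; split=> P /=.
  by move=> [h h'] F [/h|/h'].
by move=> h; split=> F FS; apply: h; [left|right].
Qed.

Lemma proj_closed_form d F : F \is d.-homog -> proj_closed [set P | F.@[coord P] = 0].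
Proof.
move=> hF; exists [set F] => [_ ->|]; first by exists d.
by apply/seteqP; split=> P /= h; [move=> _ ->|exact: h].
Qed.

Lemma proj_closed1 P : proj_closed [set P].
Proof.
exists [set F | exists i j, F = coord P j *: 'X_i - coord P i *: 'X_j].
  move=> _ [i [j ->]]; exists 1%N; apply: rpredB; apply: dhomogZ.
    by rewrite dhomogX /= mdeg1.
  by rewrite dhomogX /= mdeg1.
apply/seteqP; split=> Q /=.
  by move=> -> _ [i [j ->]]; rewrite mevalB !mevalZ !mevalXU mulrC subrr.
move=> h; have [j Pj] := coord_neq0 P.
apply: (@coord_inj _ _ (coord Q j / coord P j)) => i.
have := h _ (ex_intro _ i (ex_intro _ j erefl)).
rewrite mevalB !mevalZ !mevalXU => /eqP; rewrite subr_eq0 => /eqP e.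
by rewrite mulrAC -[LHS](mulKf Pj) e; ring.
Qed.

Lemma proj_closed0 : proj_closed (set0 : set pspace).
Proof.
exists [set 1] => [_ ->|]; first by exists 0%N; exact: dhomog1.
apply/seteqP; split=> P //= /(_ _ erefl); rewrite meval1 => /eqP.
by rewrite oner_eq0.
Qed.

Lemma proj_closed_finite A : finite_set A -> proj_closed A.
Proof.
move=> /finite_seqP[s ->]; elim: s => [|P s IH].
  by rewrite (_ : [set` _] = set0); [exact: proj_closed0|apply/seteqP; split].
rewrite (_ : [set` _] = [set P] `|` [set` s]); first exact: proj_closedU (proj_closed1 P) IH.
apply/seteqP; split=> Q /=; first by rewrite inE => /predU1P[->|]; [left|right].
by move=> [->|Qs]; rewrite inE ?eqxx // Qs orbT.
Qed.

Lemma proj_irreducible1 P : proj_irreducible [set P].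
Proof.
split; [exact: proj_closed1|by exists P|move=> A B _ _ AB].
by case: (AB P erefl) => h; [left|right] => _ ->.
Qed.

(** Without a minimal member there is a strictly descending chain, and for each k a form that
    vanishes on the (k+1)-st set but not on the k-th. Some form of this sequence is a combination of
    earlier ones, which vanish on its own set: a contradiction. *)
Lemma minimal_closed (T : set (set pspace)) : (exists Z, T Z) ->
  (forall Z, T Z -> proj_closed Z) ->
  exists Z, T Z /\ forall Z', T Z' -> Z' `<=` Z -> Z' = Z.
Proof.
move=> [Z0 TZ0] Tc; apply: contrapT => nmin.
have step Z : exists Y : set pspace * {mpoly C[n.+1]}, T Z ->
    [/\ T Y.1, Y.1 `<=` Z, forall P, Y.1 P -> Y.2.@[coord P] = 0 &
        exists2 P, Z P & Y.2.@[coord P] != 0].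
  have [TZ|] := pselect (T Z); last by exists (Z, 0).
  have [Z' [TZ' Z'Z ZZ']] : exists Z', [/\ T Z', Z' `<=` Z & ~ Z `<=` Z'].
    apply: contrapT => h; apply: nmin; exists Z; split=> // Z' TZ' Z'Z.
    apply/seteqP; split=> //; apply: contrapT => ZZ'; apply: h.
    by exists Z'.
  have [S hS eZ'] := Tc _ TZ'; move/existsNP: ZZ' => [P /not_implyP[ZP]].
  rewrite eZ' => /existsNP[F /not_implyP[SF /eqP FP]].
  exists (Z', F) => _; split=> //=; last by exists P.
  by rewrite eZ' => Q /(_ F SF).
have /choice[f fP] := step.
pose z k := iter k (fun Z => (f Z).1) Z0.
have Tz k : T (z k) by elim: k => //= k /fP[].
have zS k m : (k <= m)%N -> z m `<=` z k.
  elim: m => [|m IH]; first by rewrite leqn0 => /eqP->.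
  rewrite leq_eqVlt => /predU1P[->//|]; rewrite ltnS => /IH h.
  by apply: subset_trans h; have [] := fP _ (Tz m).
have [m [a]] := noetherian_mpoly (fun k => (f (z k)).2).
rewrite size_mkseq => Fm; have [_ _ _ [P zP]] := fP _ (Tz m).
rewrite Fm raddf_sum big1 ?eqxx // => j _ /=.
rewrite mevalM nth_mkseq //; have [_ _ h _] := fP _ (Tz j).
rewrite (h P) ?mulr0 //; apply: (zS j.+1 m) zP; exact: ltn_ord.
Qed.

(** An infinite closed subset that is minimal among those of [Z] is irreducible, and with one of its
    points and [X] it makes a chain that is too long. *)
Lemma proper_closed_finite (X Z : set pspace) : dimension_one X ->
  proj_closed Z -> Z `<=` X -> Z <> X -> finite_set Z.
Proof.
move=> [_ nchain] cZ ZX neZ; apply: contrapT => infZ.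
pose T Y := [/\ proj_closed Y, Y `<=` Z & infinite_set Y].
have [|Y []|Y [[cY YZ infY] Ymin]] := @minimal_closed T; first by exists Z; split.
  by [].
have irrY : proj_irreducible Y.
  split=> // [|A B cA cB YAB]; first exact: infinite_setN0.
  have [fA|iA] := pselect (finite_set (Y `&` A)); last first.
    left; suff <- : Y `&` A = Y by exact: subIsetr.
    apply: Ymin; last exact: subIsetl.
    by split=> //; [exact: proj_closedI|apply: subset_trans YZ; exact: subIsetl].
  have [fB|iB] := pselect (finite_set (Y `&` B)); last first.
    right; suff <- : Y `&` B = Y by exact: subIsetr.
    apply: Ymin; last exact: subIsetl.
    by split=> //; [exact: proj_closedI|apply: subset_trans YZ; exact: subIsetl].
  case: infY; apply: (@sub_finite_set _ _ ((Y `&` A) `|` (Y `&` B))).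
    by rewrite -setIUr subsetI; split.
  by rewrite finite_setU.
have [P YP] := infinite_setN0 infY.
apply: nchain; exists [set P], Y; split=> //; first exact: proj_irreducible1.
- split; first by move=> _ ->.
  by move=> YP1; apply: infY; apply: sub_finite_set YP1 _; exact: finite_set1.
- split; first by move=> Q /YZ /ZX.
  by move=> XY; apply: neZ; apply/seteqP; split=> // Q /XY /YZ.
Qed.

Lemma dimension_one_infinite (X : set pspace) :
  proj_irreducible X -> dimension_one X -> infinite_set X.
Proof.
move=> [cX [P XP] irrX] [[Z [_ [Q ZQ] _] [ZX nXZ]] _] fX.
have QX : X `<=` [set Q].
  have [|||//|h] := irrX [set Q] (X `\ Q); first exact: proj_closed1.
  - exact/proj_closed_finite/finite_setD.
  - by move=> R XR; have [->|RQ] := pselect (R = Q); [left|right; split].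
  - by case: (h _ (ZX _ ZQ)) => _ [].
by apply: nXZ => R /QX ->.
Qed.

End ProjectiveTopology.

(** * Germs of rational functions *)

Notation ev F Q := (meval (Defs.coord (val Q)) F).

Section Germs.
Variables (C : closedFieldType) (X : curve C).
Implicit Types (P Q R : pt X) (f g : pt X -> C) (c : C).
Local Notation form := {mpoly C[(ambient X).+1]}.
Implicit Types (F H : form).

(** The nonempty open sets of a curve are the cofinite ones ([zopen_ae], [ae_zopen]), so two
    rational functions are equal when they agree off a finite set. *)
Definition ae (A : set (pt X)) : Prop := cofinite_set A.

Lemma aeT A : (forall Q, A Q) -> ae A.
Proof.
move=> h; rewrite /ae (_ : ~` A = set0); first exact: finite_set0.
by apply/seteqP; split=> // Q; apply; exact: h.
Qed.

Lemma aeS (A B : set (pt X)) : (forall Q, A Q -> B Q) -> ae A -> ae B.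
Proof. by move=> AB; apply: sub_finite_set => Q; exact: contra_not (AB Q). Qed.

Lemma aeI (A B : set (pt X)) : ae A -> ae B -> ae (A `&` B).
Proof. by move=> fA fB; rewrite /ae setCI finite_setU; split. Qed.

Lemma ae2 (A B D : set (pt X)) : ae A -> ae B ->
  (forall Q, A Q -> B Q -> D Q) -> ae D.
Proof. by move=> hA hB h; apply: aeS (aeI hA hB) => Q []; exact: h. Qed.

Lemma ae3 (A B D E : set (pt X)) : ae A -> ae B -> ae D ->
  (forall Q, A Q -> B Q -> D Q -> E Q) -> ae E.
Proof. by move=> hA hB hD h; apply: ae2 (aeI hA hB) hD _ => Q []; exact: h. Qed.

Lemma ae_seq (T : eqType) (s : seq T) (A : T -> set (pt X)) :
  (forall x, x \in s -> ae (A x)) -> ae (fun Q => forall x, x \in s -> A x Q).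
Proof.
elim: s => [|x s IH] h; first exact: aeT.
apply: ae2 (h x (mem_head _ _)) (IH _) _ => [y ys|Q hx hs y].
  by apply: h; rewrite inE ys orbT.
by rewrite inE => /predU1P[->|/hs].
Qed.

Lemma ae_fin (T : finType) (A : T -> set (pt X)) :
  (forall x, ae (A x)) -> ae (fun Q => forall x, A x Q).
Proof.
move=> h; apply: aeS (@ae_seq _ (enum T) A _) => // Q hQ x.
by apply: hQ; rewrite mem_enum.
Qed.

Lemma pt_locus Q : locus X (val Q).
Proof. exact: set_mem (valP Q). Qed.

Lemma infinite_pt : infinite_set [set: pt X].
Proof.
move=> fX; apply: (dimension_one_infinite (locus_irreducible X) (@locus_dim1 _ X)).
apply: sub_finite_set (finite_image val fX) => P XP.
by exists (exist _ P (mem_set XP)).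
Qed.

Lemma ae_ex A : ae A -> exists Q, A Q.
Proof.
move=> hA; apply: contrapT => h; apply: infinite_pt; apply: sub_finite_set hA => Q _ AQ.
by apply: h; exists Q.
Qed.

Lemma ae_neq P : ae (fun Q => Q <> P).
Proof. by apply: sub_finite_set (finite_set1 P) => Q /contrapT. Qed.

Lemma ae_closed (Z : set (pspace C (ambient X))) Q : proj_closed Z -> ~ Z (val Q) ->
  ae (fun R => ~ Z (val R)).
Proof.
move=> cZ ZQ; have fZ : finite_set (Z `&` locus X).
  apply: (proper_closed_finite (@locus_dim1 _ X)); last 2 first.
  - exact: subIsetr.
  - by move=> e; apply: ZQ; have [] : (Z `&` locus X) (val Q) by rewrite e; exact: pt_locus.
  - by apply: proj_closedI => //; have [] := locus_irreducible X.
have : finite_set (val @^-1` (Z `&` locus X) : set (pt X)).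
  by apply: finite_preimage => // R R' _ _; exact: val_inj.
by apply: sub_finite_set => R /contrapT ZR; split=> //; exact: pt_locus.
Qed.

Lemma ae_ev d F Q : F \is d.-homog -> ev F Q != 0 -> ae (fun R => ev F R != 0).
Proof.
move=> hF FQ; apply: aeS (@ae_closed [set P | F.@[coord P] = 0] Q _ _).
- by move=> R /eqP.
- exact: proj_closed_form hF.
- exact/eqP.
Qed.

(** Density of cofinite sets; this is what makes the value of a germ well defined. *)
Lemma ae_ev0 d F Q : F \is d.-homog -> ae (fun R => ev F R = 0) -> ev F Q = 0.
Proof.
move=> hF F0; apply/eqP; apply: contrapT => /negP FQ.
have [R [/eqP FR0 FR]] := ae_ex (aeI F0 (ae_ev hF FQ)).
by rewrite FR0 in FR.
Qed.

(* Rational functions are functions on [pt X], up to equality off a finite set.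
   [rv Q f c]: the germ of [f] at [Q] is regular with value [c], which need not be
   the junk value [f Q]. *)
Definition rv Q f c := exists d F H, [/\ F \is d.-homog, H \is d.-homog, ev H Q != 0,
  c = ev F Q / ev H Q & ae (fun R => f R = ev F R / ev H R)].

Definition reg Q f := exists c, rv Q f c.

Lemma rv_form d F H Q : F \is d.-homog -> H \is d.-homog -> ev H Q != 0 ->
  rv Q (fun R => ev F R / ev H R) (ev F Q / ev H Q).
Proof. by move=> hF hH HQ; exists d, F, H; split=> //; exact: aeT. Qed.

Lemma rv_ae Q f g c : ae (fun R => f R = g R) -> rv Q f c -> rv Q g c.
Proof.
move=> e [d [F [H [hF hH HQ cE fE]]]]; exists d, F, H; split=> //.
by apply: ae2 e fE _ => R <-.
Qed.

Lemma eq_rv Q f g c : (forall R, f R = g R) -> rv Q f c -> rv Q g c.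
Proof. by move=> e; apply/rv_ae/aeT. Qed.

Lemma rv_uniq Q f c c' : rv Q f c -> rv Q f c' -> c = c'.
Proof.
move=> [d [F [H [hF hH HQ -> fE]]]] [d' [F' [H' [hF' hH' HQ' -> fE']]]].
have h : F * H' - F' * H \is (d + d').-homog.
  by apply: rpredB; [|rewrite addnC]; exact: dhomogM.
apply/eqP; rewrite eqr_div // -subr_eq0 -!mevalM -mevalB; apply/eqP/(ae_ev0 _ h).
apply: ae3 (aeI fE fE') (ae_ev hH HQ) (ae_ev hH' HQ') _ => R [e e'] HR HR'.
by apply/eqP; rewrite mevalB !mevalM subr_eq0 -eqr_div // -e -e'.
Qed.

Lemma rv_cst Q c : rv Q (fun=> c) c.
Proof.
exists 0%N, c%:MP, 1; rewrite meval1 mevalC divr1 oner_neq0; split=> //.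
- by rewrite -[c]mulr1 mpolyCM mpolyC1 mul_mpolyC dhomogZ // dhomog1.
- exact: dhomog1.
- by apply: aeT => R; rewrite meval1 mevalC divr1.
Qed.

Lemma rvD Q f g c e : rv Q f c -> rv Q g e -> rv Q (fun R => f R + g R) (c + e).
Proof.
move=> [d [F [H [hF hH HQ -> fE]]]] [d' [F' [H' [hF' hH' HQ' -> fE']]]].
exists (d + d')%N, (F * H' + F' * H), (H * H'); rewrite mevalD !mevalM mulf_neq0 //.
split; rewrite ?addf_div //.
- by apply: rpredD; [|rewrite addnC]; exact: dhomogM.
- exact: dhomogM.
- apply: ae3 (aeI fE fE') (ae_ev hH HQ) (ae_ev hH' HQ') _ => R [-> ->] HR HR'.
  by rewrite mevalD !mevalM addf_div.
Qed.

Lemma rvM Q f g c e : rv Q f c -> rv Q g e -> rv Q (fun R => f R * g R) (c * e).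
Proof.
move=> [d [F [H [hF hH HQ -> fE]]]] [d' [F' [H' [hF' hH' HQ' -> fE']]]].
exists (d + d')%N, (F * F'), (H * H'); rewrite !mevalM mulf_neq0 // mulf_div.
split=> //; [exact: dhomogM|exact: dhomogM|].
by apply: ae2 fE fE' _ => R -> ->; rewrite !mevalM mulf_div.
Qed.

Lemma rvN Q f c : rv Q f c -> rv Q (fun R => - f R) (- c).
Proof.
move=> h; rewrite -mulN1r; apply: eq_rv (rvM (rv_cst Q (-1)) h) => R.
by rewrite mulN1r.
Qed.

Lemma rvB Q f g c e : rv Q f c -> rv Q g e -> rv Q (fun R => f R - g R) (c - e).
Proof. by move=> hf hg; apply: rvD hf (rvN hg). Qed.

Lemma rvV Q f c : rv Q f c -> c != 0 -> rv Q (fun R => (f R)^-1) c^-1.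
Proof.
move=> [d [F [H [hF hH HQ -> fE]]]]; rewrite mulf_eq0 invr_eq0 => /norP[FQ _].
exists d, H, F; split=> //; first by rewrite invf_div.
by apply: aeS fE => R ->; rewrite invf_div.
Qed.

Lemma rv_sum (I : Type) (s : seq I) (f : I -> pt X -> C) (c : I -> C) Q :
  (forall i, rv Q (f i) (c i)) -> rv Q (fun R => \sum_(i <- s) f i R) (\sum_(i <- s) c i).
Proof.
move=> h; elim: s => [|i s IH].
  by rewrite big_nil; apply: eq_rv (rv_cst Q 0) => R; rewrite big_nil.
by rewrite big_cons; apply: eq_rv (rvD (h i) IH) => R; rewrite big_cons.
Qed.

Lemma rv_prod (I : Type) (s : seq I) (f : I -> pt X -> C) (c : I -> C) Q :
  (forall i, rv Q (f i) (c i)) -> rv Q (fun R => \prod_(i <- s) f i R) (\prod_(i <- s) c i).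
Proof.
move=> h; elim: s => [|i s IH].
  by rewrite big_nil; apply: eq_rv (rv_cst Q 1) => R; rewrite big_nil.
by rewrite big_cons; apply: eq_rv (rvM (h i) IH) => R; rewrite big_cons.
Qed.

Lemma rvM0 Q f g c : rv Q f 0 -> rv Q g c -> rv Q (fun R => f R * g R) 0.
Proof. by move=> hf hg; have := rvM hf hg; rewrite mul0r. Qed.

Lemma rv_sum0 (I : Type) (s : seq I) (f : I -> pt X -> C) Q :
  (forall i, rv Q (f i) 0) -> rv Q (fun R => \sum_(i <- s) f i R) 0.
Proof.
move=> h; have := @rv_sum I s f (fun=> 0) Q h.
by rewrite big1.
Qed.

Lemma rvZ Q a f c : rv Q f c -> rv Q (fun R => a * f R) (a * c).
Proof. exact: rvM (rv_cst Q a). Qed.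

Lemma rvX Q f c k : rv Q f c -> rv Q (fun R => f R ^+ k) (c ^+ k).
Proof.
move=> h; elim: k => [|k IH]; first exact: rv_cst.
by rewrite exprS; apply: eq_rv (rvM h IH) => R; rewrite exprS.
Qed.

Lemma rv_horner Q f c (p : {poly C}) : rv Q f c -> rv Q (fun R => p.[f R]) p.[c].
Proof.
move=> h; rewrite horner_coef.
apply: (@eq_rv _ (fun R => \sum_(i < size p) p`_i * f R ^+ i)) => [R|].
  by rewrite horner_coef.
by apply: rv_sum => i; exact: rvM (rv_cst Q _) (rvX i h).
Qed.

Lemma rv_meval k Q (f : 'I_k -> pt X -> C) (c : 'I_k -> C) (p : {mpoly C[k]}) :
  (forall i, rv Q (f i) (c i)) -> rv Q (fun R => p.@[fun i => f i R]) p.@[c].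
Proof.
move=> h; rewrite mevalE; pose G m R := p@_m * \prod_i f i R ^+ m i.
apply: (@eq_rv _ (fun R => \sum_(m <- msupp p) G m R)) => [R|]; first by rewrite mevalE.
apply: rv_sum => m; apply: rvM (rv_cst Q _) _.
by apply: rv_prod => i; apply: rvX.
Qed.

Lemma rv_reg Q f c : rv Q f c -> ae (fun R => rv R f (f R)).
Proof.
move=> [d [F [H [hF hH HQ _ fE]]]]; apply: (ae2 (ae_ev hH HQ) fE) => R HR e.
by exists d, F, H; split.
Qed.

Lemma rv_neq0 Q f c : rv Q f c -> c != 0 -> ae (fun R => f R != 0).
Proof.
move=> [d [F [H [hF hH HQ -> fE]]]]; rewrite mulf_eq0 invr_eq0 => /norP[FQ _].
apply: ae3 (ae_ev hF FQ) (ae_ev hH HQ) fE _ => R FR HR ->.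
by rewrite mulf_eq0 invr_eq0 negb_or FR HR.
Qed.

Lemma rv_dichotomy Q f c : rv Q f c -> ae (fun R => f R = 0) \/ ae (fun R => f R != 0).
Proof.
move=> hf; have [f0|] := pselect (ae (fun R => f R = 0)); [by left|move=> nf0; right].
have [R [hR fR]] : exists R, rv R f (f R) /\ f R != 0.
  apply: contrapT => h; apply: nf0; apply: aeS (rv_reg hf) => R hR.
  by apply/eqP; apply: contrapT => /negP fR; apply: h; exists R.
exact: rv_neq0 hR fR.
Qed.

Lemma rv_ae0 Q f c : rv Q f c -> ae (fun R => f R = 0) -> c = 0.
Proof.
move=> h f0; apply: rv_uniq (rv_cst Q 0); apply: rv_ae h; exact: f0.
Qed.

Lemma zopen_form d F : F \is d.-homog -> zopen (fun Q => ev F Q != 0).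
Proof.
move=> hF; exists [set P | F.@[coord P] = 0]; first exact: proj_closed_form hF.
by move=> P /=; split=> /eqP.
Qed.

Lemma zopen_ae (U : set (pt X)) Q : zopen U -> U Q -> ae U.
Proof.
move=> [Z cZ ZU] UQ; apply: aeS (ae_closed cZ (_ : ~ Z (val Q))); last exact/ZU.
by move=> R /ZU.
Qed.

Lemma ae_zopen (U : set (pt X)) : ae U -> zopen U.
Proof.
move=> hU; exists (val @` (~` U)); first exact/proj_closed_finite/finite_image.
move=> P; split=> [UP [Q QU] /val_inj e|h]; first by apply: QU; rewrite e.
by apply: contrapT => UP; apply: h; exists P.
Qed.

Lemma regular_on_rv (U : set (pt X)) f : (forall Q, U Q -> rv Q f (f Q)) -> regular_on U f.
Proof.
move=> h P /h[d [F [H [hF hH HP _ fE]]]]; exists d, F, H; split=> // Q UQ HQ.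
by apply: rv_uniq (h Q UQ) _; exists d, F, H.
Qed.

Lemma regular_at_rv P f : regular_at P f -> rv P f (f P).
Proof.
move=> [U [oU UP /(_ P UP)[d [F [H [hF hH HP fE]]]]]].
exists d, F, H; split=> //; first exact: fE.
by apply: ae2 (zopen_ae oU UP) (ae_ev hH HP) _ => Q UQ HQ; exact: fE.
Qed.

Lemma rv_regular_at P f : rv P f (f P) -> regular_at P f.
Proof.
move=> h; pose U Q := rv Q f (f Q); exists U; split=> //.
  by apply: ae_zopen; exact: rv_reg h.
exact: regular_on_rv.
Qed.

Lemma regular_on_rvE (U : set (pt X)) f : zopen U -> regular_on U f ->
  forall Q, U Q -> rv Q f (f Q).
Proof. by move=> oU rU Q UQ; apply: regular_at_rv; exists U. Qed.

Lemma eq_near_ae P f g : eq_near P f g -> ae (fun R => f R = g R) /\ f P = g P.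
Proof.
move=> [U [oU UP e]]; split; last exact: e.
exact: aeS e (zopen_ae oU UP).
Qed.

Lemma ae_eq_near P f g : ae (fun R => f R = g R) -> f P = g P -> eq_near P f g.
Proof. by move=> e eP; exists (fun R => f R = g R); split=> //; exact: ae_zopen. Qed.

End Germs.

(** * Derivations of the field of functions *)

Lemma quotient_rule_wd (K : fieldType) (F H F' H' DF DH DF' DH' : K) :
  H != 0 -> H' != 0 -> DF * H' + F * DH' - (DF' * H + F' * DH) = 0 ->
  F * H' - F' * H = 0 -> (DF * H - F * DH) / H ^+ 2 = (DF' * H' - F' * DH') / H' ^+ 2.
Proof.
move=> H0 H'0 a0 b0; apply/eqP; rewrite eqr_div ?expf_neq0 // -subr_eq0; apply/eqP.
transitivity (H * H' * (DF * H' + F * DH' - (DF' * H + F' * DH)) -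
  (F * H' - F' * H) * (DH * H' + DH' * H)); first by ring.
by rewrite a0 b0 mulr0 mul0r subrr.
Qed.

Lemma quotient_ruleD (K : fieldType) (F H F' H' DF DH DF' DH' : K) :
  H != 0 -> H' != 0 ->
  ((DF * H' + F * DH' + (DF' * H + F' * DH)) * (H * H') -
    (F * H' + F' * H) * (DH * H' + H * DH')) / (H * H') ^+ 2 =
  (DF * H - F * DH) / H ^+ 2 + (DF' * H' - F' * DH') / H' ^+ 2.
Proof.
move=> H0 H'0; rewrite addf_div ?expf_neq0 // exprMn; congr (_ / _); ring.
Qed.

Lemma quotient_ruleM (K : fieldType) (F H F' H' DF DH DF' DH' : K) :
  H != 0 -> H' != 0 ->
  ((DF * F' + F * DF') * (H * H') - F * F' * (DH * H' + H * DH')) / (H * H') ^+ 2 =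
  F / H * ((DF' * H' - F' * DH') / H' ^+ 2) + F' / H' * ((DF * H - F * DH) / H ^+ 2).
Proof.
move=> H0 H'0; rewrite !mulf_div addf_div ?mulf_neq0 ?expf_neq0 //.
apply/eqP; rewrite eqr_div ?mulf_neq0 ?expf_neq0 ?mulf_neq0 //; apply/eqP; ring.
Qed.

Lemma meval_exp (K : comNzRingType) k (v : 'I_k -> K) (F : {mpoly K[k]}) i :
  (F ^+ i).@[v] = F.@[v] ^+ i.
Proof. exact: rmorphXn. Qed.

Section GradedDerivation.
Variables (C : closedFieldType) (X : curve C).
Implicit Types (P Q R : pt X) (f g : pt X -> C) (c : C).
Local Notation form := {mpoly C[(ambient X).+1]}.
Implicit Types (F H N : form) (E : form -> form).

(* [E] raises degrees by [e]; dividing by the form [N] of degree [e] makes it a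
   derivation of the field of functions. *)
Record graded_derivation E (e : nat) N : Prop := GradedDerivation {
  gderD : forall F H, E (F + H) = E F + E H;
  gderM : forall F H, E (F * H) = E F * H + F * E H;
  gder_homog : forall d F, F \is d.-homog -> E F \is (d + e).-homog;
  gder_norm : N \is e.-homog;
  gder_locus : forall d F, F \is d.-homog -> (forall Q, ev F Q = 0) ->
    forall Q, ev (E F) Q = 0
}.

Definition quot_rule E N F H : pt X -> C := fun R =>
  (ev (E F) R * ev H R - ev F R * ev (E H) R) / ev H R ^+ 2 / ev N R.

Definition represents f (FH : form * form) : Prop :=
  [/\ exists2 d, FH.1 \is d.-homog & FH.2 \is d.-homog,
      exists Q, ev FH.2 Q != 0 & ae (fun R => f R = ev FH.1 R / ev FH.2 R)].

Lemma rv_represents Q f c : rv Q f c -> exists FH, represents f FH.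
Proof.
by move=> [d [F [H [hF hH HQ _ fE]]]]; exists (F, H); split=> //; [exists d|exists Q].
Qed.

Definition der E N f : pt X -> C :=
  if pselect (exists FH, represents f FH) is left ex
  then quot_rule E N (projT1 (cid ex)).1 (projT1 (cid ex)).2 else fun=> 0.

Section Rules.
Variables (E : form -> form) (e : nat) (N : form) (dE : graded_derivation E e N).

Lemma gderB F H : E (F - H) = E F - E H.
Proof. by apply: (addIr (E H)); rewrite -(gderD dE) !subrK. Qed.

(** Independence of the chosen fraction: for two fractions of [f], the form F H' - F' H vanishes on
    the curve, hence so does its image under [E], and the quotient rule gives the same result. *)
Lemma der_represents f F H : represents f (F, H) ->
  ae (fun R => der E N f R = quot_rule E N F H R).
Proof.
move=> fFH; rewrite /der; case: pselect => [ex|[]]; last by exists (F, H).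
case: cid => -[F' H'] /= [[d' /= hF' hH'] [Q' /= HQ'] fE'].
case: fFH => -[d /= hF hH] [Q /= HQ] fE.
have h : F * H' - F' * H \is (d + d').-homog.
  by apply: rpredB; [|rewrite addnC]; exact: dhomogM.
have h0 R : ev (F * H' - F' * H) R = 0.
  apply: (ae_ev0 _ h); apply: ae3 (aeI fE fE') (ae_ev hH HQ) (ae_ev hH' HQ') _ => {}R [e1 e2] HR HR'.
  by apply/eqP; rewrite mevalB !mevalM subr_eq0 -eqr_div // -e1 -e2.
have hE := gder_locus dE h h0.
apply: ae2 (ae_ev hH HQ) (ae_ev hH' HQ') _ => R HR HR'.
have [h1 h2] := (hE R, h0 R); rewrite gderB !(gderM dE) in h1.
rewrite !(mevalB, mevalD, mevalM) in h1 h2.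
rewrite /quot_rule; congr (_ / _). exact: esym (quotient_rule_wd HR HR' h1 h2). 
Qed.

Lemma der_ae f g : ae (fun R => f R = g R) -> ae (fun R => der E N f R = der E N g R).
Proof.
move=> fg; have [[[F H] fFH]|nf] := pselect (exists FH, represents f FH).
  have gFH : represents g (F, H).
    by case: fFH => h1 h2 h3; split=> //; apply: ae2 fg h3 _ => R <-.
  by apply: ae2 (der_represents fFH) (der_represents gFH) _ => R -> ->.
have ng : ~ exists FH, represents g FH.
  move=> [FH [h1 h2 h3]]; apply: nf; exists FH; split=> //.
  by apply: ae2 fg h3 _ => R ->.
by apply: aeT => R; rewrite /der; case: pselect => // _; case: pselect.
Qed.

Lemma der_form d F H Q f : F \is d.-homog -> H \is d.-homog -> ev H Q != 0 ->
  ae (fun R => f R = ev F R / ev H R) -> ev N Q != 0 ->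
  rv Q (der E N f) (quot_rule E N F H Q).
Proof.
move=> hF hH HQ fE NQ.
have fFH : represents f (F, H) by split=> //; [exists d|exists Q].
have NR : ev (H ^+ 2 * N) Q != 0 by rewrite mevalM meval_exp mulf_neq0 ?expf_neq0.
have qE R : quot_rule E N F H R = ev (E F * H - F * E H) R / ev (H ^+ 2 * N) R.
  by rewrite [X in _ / X]mevalM meval_exp mevalB !mevalM invfM mulrA.
exists (d + e + d)%N, (E F * H - F * E H), (H ^+ 2 * N); split=> //.
- apply: rpredB; first by apply: dhomogM => //; exact: (gder_homog dE).
  by rewrite addnC; apply: dhomogM => //; exact: (gder_homog dE).
- rewrite addnAC addnn -muln2; apply: dhomogM (gder_norm dE).
  exact: dhomogMn.
- by apply: aeS (der_represents fFH) => R ->.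
Qed.

Lemma der_rv Q f c : rv Q f c -> ev N Q != 0 -> reg Q (der E N f).
Proof.
move=> [d [F [H [hF hH HQ _ fE]]]] NQ.
by exists (quot_rule E N F H Q); exact: (der_form hF hH HQ fE NQ).
Qed.

Lemma derivD Q f g c c' : rv Q f c -> rv Q g c' ->
  ae (fun R => der E N (fun R => f R + g R) R = der E N f R + der E N g R).
Proof.
move=> [d [F [H [hF hH HQ _ fE]]]] [d' [F' [H' [hF' hH' HQ' _ gE]]]].
have fFH : represents f (F, H) by split=> //; [exists d|exists Q].
have gFH : represents g (F', H') by split=> //; [exists d'|exists Q].
have sFH : represents (fun R => f R + g R) (F * H' + F' * H, H * H').
  split=> /=; [exists (d + d')%N|exists Q; rewrite mevalM mulf_neq0 //|].
  - by apply: rpredD; [|rewrite addnC]; exact: dhomogM.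
  - exact: dhomogM.
  - apply: ae3 (aeI fE gE) (ae_ev hH HQ) (ae_ev hH' HQ') _ => R [-> ->] HR HR'.
    by rewrite mevalD !mevalM addf_div.
apply: ae3 (aeI (ae_ev hH HQ) (ae_ev hH' HQ')) (der_represents sFH)
  (aeI (der_represents fFH) (der_represents gFH)) _ => R [HR HR'] -> [-> ->].
rewrite /quot_rule (gderD dE) !(gderM dE) !(mevalD, mevalM) quotient_ruleD //.
by rewrite mulrDl.
Qed.

Lemma derivM Q f g c c' : rv Q f c -> rv Q g c' ->
  ae (fun R => der E N (fun R => f R * g R) R = f R * der E N g R + g R * der E N f R).
Proof.
move=> [d [F [H [hF hH HQ _ fE]]]] [d' [F' [H' [hF' hH' HQ' _ gE]]]].
have fFH : represents f (F, H) by split=> //; [exists d|exists Q].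
have gFH : represents g (F', H') by split=> //; [exists d'|exists Q].
have sFH : represents (fun R => f R * g R) (F * F', H * H').
  split=> /=; [exists (d + d')%N|exists Q; rewrite mevalM mulf_neq0 //|].
  - exact: dhomogM.
  - exact: dhomogM.
  - by apply: ae2 fE gE _ => R -> ->; rewrite !mevalM mulf_div.
apply: ae3 (aeI (aeI fE gE) (aeI (ae_ev hH HQ) (ae_ev hH' HQ'))) (der_represents sFH)
  (aeI (der_represents fFH) (der_represents gFH)) _ => R [[-> ->] [HR HR']] -> [-> ->].
rewrite /quot_rule !(gderM dE) !(mevalD, mevalM) quotient_ruleM //.
by rewrite mulrDl !mulrA.
Qed.

Lemma der_cst c : E c%:MP = 0 -> ae (fun R => der E N (fun=> c) R = 0).
Proof.
have [Q _] : exists Q : pt X, True by exact: ae_ex (aeT (fun=> I)).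
move=> Ec; have E1 : E 1 = 0.
  by apply: (addrI (E 1)); have := gderM dE 1 1; rewrite !mulr1 mul1r addr0.
have cFH : represents (fun=> c) (c%:MP, 1).
  split=> /=; [exists 0%N|exists Q|].
  - by rewrite -alg_mpolyC dhomogZ // dhomog1.
  - exact: dhomog1.
  - by rewrite meval1 oner_neq0.
  - by apply: aeT => R; rewrite meval1 mevalC divr1.
apply: aeS (der_represents cFH) => R ->.
by rewrite /quot_rule Ec E1 meval0 mulr0 mul0r subrr !mul0r.
Qed.

End Rules.
End GradedDerivation.

(** * Local parameters *)

Section PolynomialTools.
Variables (R : comNzRingType) (n : nat).
Implicit Types F G : {mpoly R[n]}.

Lemma meval_sum I (r : seq I) (P : pred I) (F : I -> {mpoly R[n]}) v :
  (\sum_(i <- r | P i) F i).@[v] = \sum_(i <- r | P i) (F i).@[v].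
Proof. exact: (raddf_sum (meval v)). Qed.

Lemma mderiv_sum I (r : seq I) (P : pred I) (F : I -> {mpoly R[n]}) j :
  mderiv j (\sum_(i <- r | P i) F i) = \sum_(i <- r | P i) mderiv j (F i).
Proof. exact: (raddf_sum (mderiv j)). Qed.

Lemma mpoly_ind (P : {mpoly R[n]} -> Prop) :
  (forall c, P c%:MP) -> (forall i, P 'X_i) ->
  (forall F G, P F -> P G -> P (F + G)) -> (forall F G, P F -> P G -> P (F * G)) ->
  forall F, P F.
Proof.
move=> PC PX PD PM F; rewrite [F]mpolyE; apply: (big_ind P) => [||m _].
- exact: (PC 0).
- exact: PD.
rewrite -mul_mpolyC; apply: (PM) => //; rewrite mpolyXE_id.
apply: (big_ind P) => [||i _]; [exact: (PC 1)|exact: PM|].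
by elim: (m i) => [|k IH]; [exact: (PC 1)|rewrite exprS; exact: PM].
Qed.

Lemma mpoly_factor (q : 'I_n -> R) F : exists G : 'I_n -> {mpoly R[n]},
  F = F.@[q]%:MP + \sum_j ('X_j - (q j)%:MP) * G j.
Proof.
elim/mpoly_ind: F => [c|i|F F' [G e] [G' e']|F F' [G e] [G' e']].
- by exists (fun=> 0); rewrite mevalC big1 ?addr0 // => j _; rewrite mulr0.
- exists (fun j => (i == j)%:R); rewrite mevalXU (bigD1 i) //= eqxx mulr1 big1 ?addr0.
    by rewrite addrC subrK.
  by move=> j ji; rewrite eq_sym (negPf ji) mulr0.
- exists (fun j => G j + G' j); rewrite {1}e {1}e' mevalD mpolyCD addrACA; congr (_ + _).
  by rewrite -big_split; apply: eq_bigr => j _; rewrite mulrDr.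
- exists (fun j => G j * F' + F.@[q]%:MP * G' j).
  rewrite {1}e mulrDl [in X in X + _]e' mevalM mpolyCM mulrDr -addrA; congr (_ + _).
  rewrite addrC big_distrl big_distrr /= -big_split; apply: eq_bigr => j _ /=.
  by ring.
Qed.

Lemma mderiv_XU (i j : 'I_n) : mderiv i ('X_j : {mpoly R[n]}) = (i == j)%:R.
Proof.
rewrite mderivX mnmE eq_sym; case: eqP => [->|_]; last by rewrite scale0r.
have -> : (U_(j) - U_(j) = 0)%MM by apply/mnmP => k; rewrite !mnmE subnn.
by rewrite scale1r mpolyX0.
Qed.

Lemma mpoly_taylor2 (q : 'I_n -> R) F : exists H : 'I_n -> 'I_n -> {mpoly R[n]},
  forall z, F.@[z] = F.@[q] + \sum_j (mderiv j F).@[q] * (z j - q j) +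
    \sum_j \sum_k (z j - q j) * (z k - q k) * (H j k).@[z].
Proof.
have [G e] := mpoly_factor q F.
have dG j : (mderiv j F).@[q] = (G j).@[q].
  have dk k : (mderiv j (('X_k - (q k)%:MP) * G k)).@[q] = (j == k)%:R * (G k).@[q].
    rewrite mderivM mderivB mderivC subr0 mderiv_XU mevalD !mevalM mevalB mevalXU mevalC.
    by rewrite subrr mul0r addr0 rmorph_nat.
  rewrite {1}e mderivD mderivC add0r mderiv_sum meval_sum (bigD1 j) //= big1 => [|k kj].
    by rewrite dk eqxx mul1r addr0.
  by rewrite dk eq_sym (negPf kj) mul0r.
have /choice[H eH] j := mpoly_factor q (G j).
exists H => z; rewrite {1}e mevalD mevalC meval_sum -addrA; congr (_ + _).
rewrite -big_split; apply: eq_bigr => j _ /=.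
rewrite {1}(eH j) mevalM mevalB mevalXU mevalC mevalD mevalC meval_sum mulrDr dG mulrC.
congr (_ + _); rewrite big_distrr; apply: eq_bigr => k _ /=.
by rewrite mevalM mevalB mevalXU mevalC mulrA.
Qed.

Lemma dhomog_mderiv d F j : F \is d.-homog -> mderiv j F \is (d.-1).-homog.
Proof.
move=> /dhomogP hF; rewrite [F]mpolyE mderiv_sum big_seq; apply: rpred_sum => m mF.
rewrite /= mderivZ mderivX; apply: dhomogZ.
have [->|mj] := posnP (m j); first by rewrite scale0r; exact: dhomog0.
apply: dhomogZ; rewrite dhomogX /=.
have Um : (U_(j) <= m)%MM by apply/mnm_lepP => k; rewrite mnmE; case: eqP => // <-.
have <- : mdeg m = d := hF m mF.
by rewrite -[in X in _ == X](submK Um) mdegD mdeg1 addn1.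
Qed.

Lemma euler_homog d F (q : 'I_n -> R) : F \is d.-homog ->
  \sum_j (mderiv j F).@[q] * q j = d%:R * F.@[q].
Proof.
move=> /dhomogP hF; rewrite {2}[F]mpolyE meval_sum big_distrr /=.
under eq_bigr do rewrite {1}[F]mpolyE mderiv_sum meval_sum big_distrl /=.
rewrite exchange_big /= big_seq [RHS]big_seq; apply: eq_bigr => m mF.
have -> : d%:R = \sum_j (m j)%:R :> R by rewrite -natr_sum -mdegE; congr (_%:R); rewrite -(hF m mF).
rewrite big_distrl /=; apply: eq_bigr => j _.
rewrite mderivZ !mevalZ mderivX mevalZ.
have [->|mj] := posnP (m j); first by rewrite !(mul0r, mulr0).
have -> : ('X_[m] : {mpoly R[n]}).@[q] = ('X_[m - U_(j)]).@[q] * q j.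
  rewrite -[X in _ * X](mevalXU q) -mevalM -mpolyXD submK //.
  by apply/mnm_lepP => k; rewrite mnmE; case: eqP => // <-.
ring.
Qed.

Lemma dhomog_det k (A : 'M[{mpoly R[n]}]_k) (r : 'I_k -> nat) :
  (forall i j, A i j \is (r i).-homog) -> \det A \is (\sum_i r i).-homog.
Proof.
move=> hA; apply: rpred_sum => s _; rewrite -signr_odd.
have h : \prod_i A i (s i) \is (\sum_i r i).-homog.
  elim/big_rec2: _ => [|i d F _ hF]; first exact: dhomog1.
  exact: dhomogM.
by case: (odd _); rewrite ?expr0 ?expr1 ?mul1r // mulN1r dhomogN.
Qed.

End PolynomialTools.

Section JacobianDerivation.
Variables (C : fieldType) (m k : nat) (mk : m = k.+2) (i0 : 'I_m).
Variables (G : 'I_k -> {mpoly C[m]}) (d : 'I_k -> nat).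
Hypothesis G_homog : forall i, G i \is (d i).-homog.

(** [E F] is ['X_i0] times the determinant whose rows are the gradients of [F], of ['X_i0] and of
    the [G i]. It differentiates along the common zeros of the [G i] in the chart where ['X_i0] is
    constant, and vanishes where the rows have a common kernel vector. *)
Lemma jacobian_derivation : exists (E : {mpoly C[m]} -> {mpoly C[m]}) (e : nat),
  [/\ forall F H, E (F + H) = E F + E H,
      forall F H, E (F * H) = E F * H + F * E H,
      forall c, E c%:MP = 0 /\ E 'X_i0 = 0,
      forall n F, F \is n.-homog -> E F \is (n + e).-homog &
      forall F v, v i0 != 0 ->
        ((E F).@[v] = 0 <-> exists w : 'I_m -> C, [/\ exists j, w j != 0, w i0 = 0,
          \sum_j (mderiv j F).@[v] * w j = 0 &
          forall i, \sum_j (mderiv j (G i)).@[v] * w j = 0])].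
Proof.
subst m; pose B (i : 'I_k.+1) (j : 'I_k.+2) : {mpoly C[k.+2]} :=
  if unlift ord0 i is Some i' then mderiv j (G i') else (j == i0)%:R.
pose A (T : Type) (f : {mpoly C[k.+2]} -> T) (a : 'I_k.+2 -> T) : 'M_k.+2 :=
  \matrix_(i, j) (if unlift ord0 i is Some i' then f (B i' j) else a j).
(* Cofactors along the first row do not involve that row, so it is filled with zeros. *)
pose c j := cofactor (A _ id (fun=> 0)) ord0 j.
pose r (i : 'I_k.+1) := if unlift ord0 i is Some i' then (d i').-1 else 0%N.
have c_homog j : c j \is (\sum_i r i).-homog.
  rewrite /c /cofactor -signr_odd.
  suff h : \det (row' ord0 (col' j (A _ id (fun=> 0)))) \is (\sum_i r i).-homog.
    by case: (odd _); rewrite ?expr0 ?expr1 ?mul1r // mulN1r dhomogN.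
  apply: dhomog_det => i l; rewrite !mxE liftK /B /r.
  case: unlift => [i'|]; first exact: dhomog_mderiv.
  by case: eqP => _; [exact: dhomog1|exact: dhomog0].
(* The factor ['X_i0] restores the degree lost in differentiating [F]. *)
pose E F := 'X_i0 * \sum_j mderiv j F * c j.
have EE F v : (E F).@[v] = v i0 * \det (A _ (meval v) (fun j => (mderiv j F).@[v])).
  rewrite /E mevalM mevalXU meval_sum (expand_det_row _ ord0); congr (_ * _).
  apply: eq_bigr => j _; rewrite mevalM mxE unlift_none; congr (_ * _).
  rewrite /c /cofactor mevalM -[(-1) ^+ _]/((-1) ^+ _) rmorphXn rmorphN1.
  rewrite -det_map_mx; congr (_ * \det _); apply/matrixP => i l.
  by rewrite !mxE liftK.
exists E, (\sum_i r i)%N; split.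
- move=> F H; rewrite /E -mulrDr -big_split; congr (_ * _); apply: eq_bigr => j _.
  by rewrite mderivD mulrDl.
- move=> F H; rewrite /E.
  have -> : \sum_j mderiv j (F * H) * c j =
      (\sum_j mderiv j F * c j) * H + F * (\sum_j mderiv j H * c j).
    rewrite big_distrl big_distrr -big_split; apply: eq_bigr => j _ /=.
    by rewrite mderivM; ring.
  ring.
- move=> a; split; rewrite /E; first by rewrite big1 ?mulr0 // => j _; rewrite mderivC mul0r.
  have -> : \sum_j mderiv j 'X_i0 * c j = \det (A _ id (fun j => (j == i0)%:R)).
    rewrite (expand_det_row _ ord0); apply: eq_bigr => j _.
    rewrite mxE unlift_none mderiv_XU; congr (_ * _); rewrite /c /cofactor; congr (_ * \det _).
    by apply/matrixP => i l; rewrite !mxE liftK.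
  rewrite (@determinant_alternate _ _ _ ord0 (fintype.lift ord0 ord0)) ?mulr0 // => j.
  by rewrite !mxE unlift_none liftK /B unlift_none.
- move=> n F hF; rewrite /E.
  have [n0|n0] := posnP n.
    rewrite big1 ?mulr0; first exact: dhomog0.
    move=> j _; rewrite (_ : mderiv j F = 0) ?mul0r //; apply/mpolyP => u.
    rewrite mcoeff_mderiv mcoeff0 (dhomog_nemf_coeff hF) ?mul0rn //=.
    by rewrite n0 mdegD mdeg1 addn1.
  rewrite -(prednK n0) addSn -[(_ + _).+1]add1n; apply: dhomogM.
    by rewrite dhomogX /= mdeg1.
  by apply: rpred_sum => j _; apply: dhomogM => //; exact: dhomog_mderiv.
- move=> F v vi0; rewrite EE; set M := A _ _ _.
  have M0 (w : 'I_k.+2 -> C) : \sum_j M ord0 j * w j = \sum_j (mderiv j F).@[v] * w j.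
    by apply: eq_bigr => j _; rewrite mxE unlift_none.
  have M1 (w : 'I_k.+2 -> C) : \sum_j M (fintype.lift ord0 ord0) j * w j = w i0.
    rewrite (bigD1 i0) //= big1 => [|j ji]; rewrite mxE liftK /B unlift_none rmorph_nat.
      by rewrite eqxx mul1r addr0.
    by rewrite (negPf ji) mul0r.
  have M2 (w : 'I_k.+2 -> C) i : \sum_j M (fintype.lift ord0 (fintype.lift ord0 i)) j * w j =
      \sum_j (mderiv j (G i)).@[v] * w j.
    by apply: eq_bigr => j _; rewrite mxE liftK /B liftK.
  split.
    move=> /eqP; rewrite mulf_eq0 (negPf vi0) /= -det_tr => /det0P[w w0 wM].
    have {}wM i : \sum_j M i j * w 0 j = 0.
      transitivity ((w *m M^T) 0 i); last by rewrite wM mxE.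
      by rewrite mxE; apply: eq_bigr => j _; rewrite [in RHS]mxE mulrC.
    exists (fun j => w 0 j); rewrite -M0 -M1 wM; split=> // [|i].
      by have /rV0Pn := w0.
    by rewrite -M2.
  move=> [w [[j wj] wi0 Fw Gw]]; suff -> : \det M = 0 by rewrite mulr0.
  rewrite -det_tr; apply/eqP/det0P; exists (\row_j w j).
    by apply/rV0Pn; exists j; rewrite mxE.
  apply/rowP => i; rewrite !mxE.
  transitivity (\sum_j M i j * w j); first by apply: eq_bigr => l _; rewrite !mxE mulrC.
  have [i' ->|->] := unliftP ord0 i; last by rewrite M0.
  have [i'' ->|->] := unliftP ord0 i'; last by rewrite M1.
  by rewrite M2.
Qed.
End JacobianDerivation.

Section Tangent.
Variables (C : closedFieldType) (X : curve C).
Implicit Types (P Q R : pt X) (f g : pt X -> C) (c : C).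
Local Notation m := (ambient X).+1.
Local Notation form := {mpoly C[m]}.
Implicit Types (F H : form).

Definition vanishing F : Prop := (exists d, F \is d.-homog) /\ forall Q : pt X, ev F Q = 0.

Definition tangent R (w : 'I_m -> C) : Prop :=
  forall F, vanishing F -> \sum_j ev (mderiv j F) R * w j = 0.

Lemma tangent_basis R : exists2 B : 'M[C]_(2, m), row_free B &
  forall w : 'rV_m, (w <= B)%MS <-> tangent R (fun j => w 0 j).
Proof.
have [T dT hT] := locus_smooth (pt_locus R).
have hT' (w : 'rV_m) : w \in T <-> tangent R (fun j => w 0 j).
  split.
    by move=> /hT h F [[d hF] F0]; apply: (h d) => // Q XQ; exact: (F0 (exist _ Q (mem_set XQ))).
  move=> h; apply/hT => d F hF F0; apply: h; split=> [|Q]; first by exists d.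
  exact/F0/pt_locus.
pose b i := (vbasis T)`_i; pose B := \matrix_(i < \dim T) b i.
have BT (u : 'rV_(\dim T)) : u *m B = \sum_i u 0 i *: b i.
  by rewrite mulmx_sum_row; apply: eq_bigr => i _; rewrite rowK.
have Bfree : row_free B.
  rewrite -kermx_eq0; apply/eqP/row_matrixP => i; rewrite row0.
  set u := row i _; have : u *m B = 0 by apply/sub_kermxP; exact: row_sub.
  rewrite BT; have /freeP fr := basis_free (vbasisP T); move=> /fr h.
  by apply/rowP => j; rewrite h mxE.
have BE (w : 'rV_m) : (w <= B)%MS <-> w \in T.
  split=> [/submxP[u ->]|wT].
    rewrite BT; apply: memv_suml => i _; apply: memvZ; apply: vbasis_mem.
    by apply: mem_nth; rewrite size_tuple.
  rewrite (coord_vbasis wT); apply: summx_sub => i _; apply: scalemx_sub.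
  by rewrite -/(b i) -[b i](rowK b); exact: row_sub.
clear BT; move: @B Bfree BE; rewrite {}/b; move: (\matrix_(i < \dim T) _).
rewrite dT => B Bfree BE; exists B => // w.
by rewrite BE.
Qed.

Lemma tangent_coord R : tangent R (coord (val R)).
Proof. by move=> F [[d hF] F0]; rewrite (euler_homog _ hF) F0 mulr0. Qed.

Lemma tangent_hyperplane R i0 : exists w, [/\ tangent R w, exists j, w j != 0 & w i0 = 0].
Proof.
have [B Bfree BE] := tangent_basis R.
have [u u0 uB] : exists2 u : 'rV_2, u != 0 & u *m (B *m delta_mx i0 (0 : 'I_1)) = 0.
  have : kermx (B *m delta_mx i0 (0 : 'I_1)) != 0.
    rewrite -mxrank_eq0 mxrank_ker subn_eq0 -ltnNge ltnS.
    exact: rank_leq_col.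
  by move=> /rowV0Pn[u uK u0]; exists u => //; apply/sub_kermxP.
exists (fun j => (u *m B) 0 j); split.
- by apply/BE; exact: submxMl.
- suff : u *m B != 0 by move=> /rV0Pn.
  apply: contra_neq u0 => uB0; apply: (row_free_inj Bfree).
  by rewrite uB0 mul0mx.
- transitivity ((u *m (B *m delta_mx i0 (0 : 'I_1))) 0 0); last by rewrite uB mxE.
  rewrite mulmxA [RHS]mxE (bigD1 i0) //= [delta_mx _ _ _ _]mxE !eqxx mulr1 big1 ?addr0 // => j ji.
  by rewrite [delta_mx _ _ _ _]mxE (negPf ji) mulr0.
Qed.

(** By Euler's identity the tangent plane contains the coordinate vector of [R], so it is spanned by
    this vector and [w]; a vector with zero i0-coordinate has no component along the former. *)
Lemma tangent_line R i0 w w' : coord (val R) i0 != 0 ->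
  tangent R w -> (exists j, w j != 0) -> w i0 = 0 -> tangent R w' -> w' i0 = 0 ->
  exists c, forall j, w' j = c * w j.
Proof.
move=> Ri0 tw [j0 wj0] wi0 tw' w'i0; have [B Bfree BE] := tangent_basis R.
pose A := \matrix_(i < 2, j < m) (if i == 0 then w j else coord (val R) j).
have Au (u : 'rV_2) j : (u *m A) 0 j = u 0 0 * w j + u 0 1 * coord (val R) j.
  by rewrite mxE big_ord_recl big_ord1 !mxE /= (_ : fintype.lift _ _ = 1) //; apply: val_inj.
have Afree : row_free A.
  rewrite -kermx_eq0; apply/eqP/row_matrixP => i; rewrite row0.
  set u := row i _; have uA : u *m A = 0 by apply/sub_kermxP; exact: row_sub.
  have u1 : u 0 1 = 0.
    have /rowP/(_ i0) := uA; rewrite Au wi0 mulr0 add0r [RHS]mxE => /eqP.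
    by rewrite mulf_eq0 (negPf Ri0) orbF => /eqP.
  have u0 : u 0 0 = 0.
    have /rowP/(_ j0) := uA; rewrite Au u1 mul0r addr0 [RHS]mxE => /eqP.
    by rewrite mulf_eq0 (negPf wj0) orbF => /eqP.
  apply/rowP => j; rewrite [RHS]mxE; have [->|j1] := eqVneq j 0; first by [].
  by rewrite (_ : j = 1) //; apply: val_inj; case: j j1 => -[|[]].
have AB : (A <= B)%MS.
  apply/row_subP => i; apply/BE; suff : tangent R (A i).
    by move=> h F hF; rewrite -[RHS](h F hF); apply: eq_bigr => j _; rewrite !mxE.
  move=> F hF; have [i0'|i0'] := boolP (i == 0).
    by rewrite -[RHS](tw F hF); apply: eq_bigr => j _; rewrite mxE i0'.
  by rewrite -[RHS](@tangent_coord R F hF); apply: eq_bigr => j _; rewrite mxE (negPf i0').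
have BA : (B <= A)%MS by rewrite -(geq_leqif (mxrank_leqif_sup AB)) (eqP Afree) (eqP Bfree).
have w'A : (\row_j w' j <= A)%MS.
  apply: submx_trans BA; apply/BE => F hF; rewrite -[RHS](tw' F hF).
  by apply: eq_bigr => j _; rewrite mxE.
have [u uE] := submxP w'A.
have wE j : w' j = u 0 0 * w j + u 0 1 * coord (val R) j by rewrite -Au -uE mxE.
have /eqP := wE i0; rewrite w'i0 wi0 mulr0 add0r eq_sym mulf_eq0 (negPf Ri0) orbF => /eqP u1.
by exists (u 0 0) => j; rewrite wE u1 mul0r addr0.
Qed.

(** Take a maximal family of forms vanishing on the curve with independent gradients at [R]: every
    other gradient at [R] is a combination of theirs, and smoothness fixes their number. The curve
    need not be a complete intersection away from [R]. *)
Lemma equations_of_tangent R : exists k (G : 'I_k -> form) (d : 'I_k -> nat),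
  [/\ m = k.+2, forall i, G i \is (d i).-homog, forall i, vanishing (G i) &
      forall w, (forall i, \sum_j ev (mderiv j (G i)) R * w j = 0) -> tangent R w].
Proof.
pose gr F : 'rV_m := \row_j ev (mderiv j F) R.
pose Pk k := `[< exists G : 'I_k -> form,
  (forall i, vanishing (G i)) /\ row_free (\matrix_(i < k) gr (G i)) >].
have ex : exists k, Pk k.
  exists 0%N; apply/asboolP; exists (fun=> 0); split; first by case.
  by rewrite /row_free -leqn0 rank_leq_row.
have bd k : Pk k -> (k <= m)%N.
  by move=> /asboolP[G [_ /eqP <-]]; exact: rank_leq_col.
case: (ex_maxnP ex bd) => k /asboolP[G [Gv Gfree]] kmax.
set M := \matrix_(i < k) _ in Gfree.
have MF F : vanishing F -> (gr F <= M)%MS.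
  move=> hF; apply: contrapT => nFM; have /kmax : Pk k.+1; last by rewrite ltnn.
  apply/asboolP; exists (fun i => if unlift ord0 i is Some i' then G i' else F); split.
    by move=> i; case: unlift.
  set M' := \matrix_(i < _) _.
  have MM' : (M <= M')%MS.
    apply/row_subP => i; rewrite rowK (_ : gr (G i) = row (fintype.lift ord0 i) M').
      exact: row_sub.
    by rewrite rowK liftK.
  have FM' : (gr F <= M')%MS.
    by rewrite (_ : gr F = row ord0 M') ?row_sub // rowK unlift_none.
  rewrite /row_free eqn_leq rank_leq_row /=.
  apply: (@leq_ltn_trans (\rank M)); first by rewrite (eqP Gfree).
  apply: rank_ltmx.
  rewrite ltmxE MM' /=; apply/negP => M'M; apply: nFM; exact: submx_trans M'M.
have Mt (w : 'rV_m) : w *m M^T = 0 <-> tangent R (fun j => w 0 j).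
  have wM i : (w *m M^T) 0 i = \sum_j ev (mderiv j (G i)) R * w 0 j.
    by rewrite mxE; apply: eq_bigr => j _; rewrite !mxE mulrC.
  split=> [w0 F hF|tw]; last by apply/rowP => i; rewrite wM tw // mxE.
  have [u uE] := submxP (MF F hF).
  have : gr F *m w^T = 0 by rewrite uE -mulmxA -[M]trmxK -trmx_mul w0 trmx0 mulmx0.
  move=> /matrixP/(_ 0 0); rewrite !mxE => e; rewrite -[RHS]e.
  by apply: eq_bigr => j _; rewrite !mxE.
have [B Bfree BE] := tangent_basis R.
have km : m = k.+2.
  have rK : \rank (kermx M^T) = 2%N.
    rewrite -(eqP Bfree); apply/eqP; rewrite eqn_leq.
    apply/andP; split; apply/mxrankS/rV_subP => w.
      by move=> /sub_kermxP/Mt/BE.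
    by move=> /BE/Mt h; apply/sub_kermxP.
  have := mxrank_ker M^T; rewrite rK mxrank_tr (eqP Gfree) => e.
  by rewrite -addn2 e subnKC // -(eqP Gfree) rank_leq_col.
have /choice[d hd] i : exists d, G i \is d.-homog by have [] := Gv i.
exists k, G, d; split=> // w hw.
suff : tangent R (fun j => (\row_j w j) 0 j).
  by move=> h F hF; rewrite -[RHS](h F hF); apply: eq_bigr => j _; rewrite mxE.
apply/Mt/rowP => i; rewrite !mxE -[RHS](hw i).
by apply: eq_bigr => j _; rewrite !mxE mulrC.
Qed.

End Tangent.

Section Frame.
Variables (C : closedFieldType) (X : curve C).
Implicit Types (P Q R : pt X) (f g t : pt X -> C) (c : C).
Local Notation m := (ambient X).+1.
Local Notation form := {mpoly C[m]}.
Implicit Types (F H : form).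

Lemma rv_det k (A : 'I_k -> 'I_k -> pt X -> C) (a : 'I_k -> 'I_k -> C) Q :
  (forall i j, rv Q (A i j) (a i j)) ->
  rv Q (fun R => \det (\matrix_(i, j) A i j R)) (\det (\matrix_(i, j) a i j)).
Proof.
move=> h; rewrite /determinant.
apply: (@eq_rv _ _ _ (fun R => \sum_(s : 'S_k) (-1) ^+ s * \prod_i A i (s i) R)) => [R|].
  by apply: eq_bigr => s _; congr (_ * _); apply: eq_bigr => i _; rewrite mxE.
apply: rv_sum => s; apply: rvM (rv_cst Q _) _.
rewrite (eq_bigr (fun i => a i (s i))) => [|i _]; last by rewrite mxE.
exact: rv_prod.
Qed.

(* Nakayama: [y = t l + M y] with [M] vanishing at [Q], and [1 - M] is
   inverted by its adjugate, as its determinant is 1 at [Q]. *)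
Lemma nakayama k (y : 'I_k -> pt X -> C) t (l : 'I_k -> C) (M : 'I_k -> 'I_k -> pt X -> C) Q :
  (forall i j, rv Q (M i j) 0) ->
  (forall i, ae (fun R => y i R = l i * t R + \sum_j M i j R * y j R)) ->
  exists2 g : 'I_k -> pt X -> C, forall i, reg Q (g i) &
    forall i, ae (fun R => y i R = t R * g i R).
Proof.
move=> hM hy; pose A i j R := (i == j)%:R - M i j R.
pose D R := \det (\matrix_(i, j) A i j R).
have hA i j : rv Q (A i j) ((i == j)%:R).
  by rewrite -[_%:R]subr0; apply: rvB (rv_cst Q _) (hM i j).
have hD : rv Q D 1.
  have := rv_det hA; rewrite (_ : \matrix_(i, j) _ = 1%:M) ?det1 //.
  by apply/matrixP => i j; rewrite !mxE.
pose cof i j R := cofactor (\matrix_(i, j) A i j R) j i.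
have hcof i j : reg Q (cof i j).
  rewrite /cof /cofactor; pose A' (i' j' : 'I_k.-1) := A (fintype.lift j i') (fintype.lift i j').
  exists ((-1) ^+ (j + i) * \det (\matrix_(i', j') ((fintype.lift j i' == fintype.lift i j')%:R : C))).
  apply: (@eq_rv _ _ _ (fun R => (-1) ^+ (j + i) * \det (\matrix_(i', j') A' i' j' R))) => [R|].
    by congr (_ * \det _); apply/matrixP => i' j'; rewrite !mxE.
  by apply: rvM (rv_cst Q _) _; apply: rv_det => i' j'; exact: hA.
exists (fun i R => (\sum_j cof i j R * l j) / D R) => i.
  have /choice[c hc] := hcof i; eexists; apply: rvM; last exact: rvV hD (oner_neq0 _).
  by apply: rv_sum => j; apply: rvM (hc j) (rv_cst Q _).
apply: ae2 (ae_fin hy) (rv_neq0 hD (oner_neq0 _)) _ => R yR DR.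
apply: (mulfI DR); rewrite mulrCA [D R * (_ / _)]mulrCA divff // mulr1.
pose AR := \matrix_(i, j) A i j R.
have Ay : AR *m (\col_j y j R) = t R *: \col_j l j.
  apply/colP => j; rewrite !mxE; transitivity (y j R - \sum_j' M j j' R * y j' R).
    transitivity (\sum_j' ((j == j')%:R * y j' R - M j j' R * y j' R)).
      by apply: eq_bigr => j' _; rewrite !mxE mulrBl.
    rewrite sumrB; congr (_ - _); rewrite (bigD1 j) //= eqxx mul1r big1 ?addr0 //.
    by move=> j' jj'; rewrite eq_sym (negPf jj') mul0r.
  by rewrite yR addrK mulrC.
transitivity (((\adj AR *m AR) *m (\col_j y j R)) i 0).
  by rewrite mul_adj_mx mul_scalar_mx !mxE.
rewrite -mulmxA Ay -scalemxAr !mxE; congr (_ * _); apply: eq_bigr => j _.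
by rewrite !mxE.
Qed.

Definition uniformizer Q t : Prop := rv Q t 0 /\
  forall f, rv Q f 0 -> exists2 g, reg Q g & ae (fun R => f R = t R * g R).

(** The scaling makes z(Q) the chosen homogeneous vector of [Q], so that Taylor expansions at
    [coord (val Q)] can be evaluated at z. *)
Lemma affine_coordinates Q i0 : coord (val Q) i0 != 0 ->
  exists z : 'I_m -> pt X -> C, [/\ forall j, rv Q (z j) (coord (val Q) j),
    forall R j, z j R = coord (val Q) i0 * (coord (val R) j / coord (val R) i0),
    forall d F H, F \is d.-homog -> H \is d.-homog -> ae (fun R =>
      ev F R / ev H R = F.@[fun j => z j R] / H.@[fun j => z j R]) &
    forall F, @vanishing C X F -> ae (fun R => F.@[fun j => z j R] = 0)].
Proof.
move=> Qi0; pose z j R := coord (val Q) i0 * (coord (val R) j / coord (val R) i0).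
have X1 j : ('X_j : form) \is 1.-homog by rewrite dhomogX /= mdeg1.
have hz F d R : F \is d.-homog -> F.@[fun j => z j R] =
    (coord (val Q) i0 / coord (val R) i0) ^+ d * ev F R.
  move=> hF; rewrite -(dhomogXn_prod _ _ hF); apply: meval_eq => j.
  by rewrite /z mulrA mulrAC.
have aeX : ae (fun R => coord (val R) i0 != 0).
  by have := @ae_ev _ X _ _ Q (X1 i0); rewrite mevalXU => /(_ Qi0); apply: aeS => R; rewrite mevalXU.
exists z; split=> [j|//|d F H hF hH|F [[d hF] F0]].
- have := @rv_form _ X _ _ _ Q (X1 j) (X1 i0); rewrite !mevalXU => /(_ Qi0) h.
  have := rvM (rv_cst Q (coord (val Q) i0)) h; rewrite mulrC divfK //.
  by apply: eq_rv => R; rewrite !mevalXU.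
- apply: aeS aeX => R Ri0; rewrite (hz F d) // (hz H d) //.
  by rewrite -mulf_div divff ?mul1r // expf_neq0 // mulf_neq0 // invr_eq0.
- by apply: aeT => R; rewrite (hz F d) // F0 mulr0.
Qed.

(** The derivation plays the part of d/dt: it is regular at [Q] and does not send the parameter [t]
    into the maximal ideal. *)
Record frame Q (E : form -> form) (e : nat) (N : form) t : Prop := Frame {
  frame_der : @graded_derivation C X E e N;
  frame_cst : forall c, E c%:MP = 0;
  frame_norm : ev N Q != 0;
  frame_unif : uniformizer Q t;
  frame_dt : exists2 c, c != 0 & rv Q (der E N t) c
}.

(** The Jacobian criterion. The parameter comes from a coordinate j0 that is not constant along the
    tangent line. The equations of the curve, expanded to second order at [Q], express the other
    affine coordinates as y = t l + M y with [M] vanishing at [Q]; [nakayama] makes them multiples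
    of [t], and then every function vanishing at [Q] is one. *)
Lemma frame_exists Q : exists E e N t, frame Q E e N t.
Proof.
have [k [G [d [mk Gd Gv Gt]]]] := equations_of_tangent Q.
have [i0 Qi0] := coord_neq0 (val Q).
have [E [e [ED EM Ecst Ehom Eker]]] := jacobian_derivation mk i0 Gd.
have [w [tw [j0 wj0] wi0]] := tangent_hyperplane Q i0.
have X1 j : ('X_j : form) \is 1.-homog by rewrite dhomogX /= mdeg1.
pose N : form := 'X_i0 ^+ e.
have NQ : ev N Q != 0 by rewrite meval_exp mevalXU expf_neq0.
have dE : @graded_derivation C X E e N.
  split=> // [|n F hF F0 R]; first by rewrite -[e]mul1n; exact: dhomogMn.
  apply: (ae_ev0 R (Ehom _ _ hF)); have := @ae_ev _ X _ _ Q (X1 i0); rewrite mevalXU => /(_ Qi0).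
  apply: aeS => {}R; rewrite mevalXU => Ri0; apply/(Eker F _ Ri0).
  have [v [tv v0 vi0]] := tangent_hyperplane R i0.
  by exists v; split=> // [|i]; apply: tv => //; split=> //; exists n.
(* Otherwise some nonzero tangent vector would have zero i0- and j0-coordinates, although
   [tangent_line] makes it a multiple of [w]. *)
have EX0 : ev (E 'X_j0) Q != 0.
  apply/eqP => /(Eker 'X_j0 _ Qi0)[v [[j vj] vi0 v1 vG]].
  have vj0 : v j0 = 0.
    rewrite -[RHS]v1 (bigD1 j0) //= big1 => [|i ij0]; rewrite mderiv_XU rmorph_nat.
      by rewrite eqxx mul1r addr0.
    by rewrite (negPf ij0) mul0r.
  have [c vc] := tangent_line Qi0 tw (ex_intro _ j0 wj0) wi0 (Gt v vG) vi0.
  have /eqP := vc j0; rewrite vj0 eq_sym mulf_eq0 (negPf wj0) orbF => /eqP c0.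
  by move: vj; rewrite vc c0 mul0r eqxx.
pose a := coord (val Q) j0 / coord (val Q) i0.
pose L : form := 'X_j0 - a *: 'X_i0.
have hL : L \is 1.-homog by rewrite rpredB // dhomogZ.
have LQ : ev L Q = 0 by rewrite mevalB mevalZ !mevalXU /a divfK // subrr.
pose t R := ev L R / ev 'X_i0 R.
have EL : E L = E 'X_j0.
  rewrite (gderB dE) -mul_mpolyC EM; have [-> _] := Ecst a; have [_ ->] := Ecst 0.
  by rewrite mul0r mulr0 addr0 subr0.
have rt : rv Q t 0.
  by have := @rv_form _ X _ _ _ Q hL (X1 i0); rewrite LQ mul0r mevalXU; apply.
exists E, e, N, t; split=> //; first by move=> c; have [] := Ecst c.
  split=> // f [n [F [H [hF hH HQ f0 fE]]]].
  have FQ : ev F Q = 0.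
    by apply/eqP; move/eqP: f0; rewrite eq_sym mulf_eq0 invr_eq0 (negPf HQ) orbF.
  have [z [hz zE zF zv]] := affine_coordinates Qi0.
  pose y j R := z j R - coord (val Q) j.
  have hy j : rv Q (y j) 0 by rewrite -(subrr (coord (val Q) j)); exact: rvB (hz j) (rv_cst Q _).
  have aeX : ae (fun R => coord (val R) i0 != 0).
    have := @ae_ev _ X _ _ Q (X1 i0); rewrite mevalXU => /(_ Qi0).
    by apply: aeS => R; rewrite mevalXU.
  (* The coordinates j0 and i0 and the k gradients are independent functionals, again by [EX0], so
     every coordinate is a combination of them. On the affine chart the i0-term vanishes, and the
     gradient terms are quadratic in y by the equations. *)
  pose A := \matrix_(i < k.+2, j < m) (if unlift ord0 i is Some i' then
    if unlift ord0 i' is Some i'' then ev (mderiv j (G i'')) Q else (j == i0)%:R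
    else (j == j0)%:R : C).
  have sumd (j1 : 'I_m) (B v : 'I_m -> C) : (forall j, B j = (j == j1)%:R) -> \sum_j B j * v j = v j1.
    move=> hB; rewrite (bigD1 j1) //= hB eqxx mul1r big1 ?addr0 // => j jj1.
    by rewrite hB (negPf jj1) mul0r.
  have A0 (v : 'I_m -> C) : \sum_j A ord0 j * v j = v j0.
    by apply: sumd => j; rewrite mxE unlift_none.
  have A1 (v : 'I_m -> C) : \sum_j A (fintype.lift ord0 ord0) j * v j = v i0.
    by apply: sumd => j; rewrite mxE liftK unlift_none.
  have A2 (v : 'I_m -> C) i : \sum_j A (fintype.lift ord0 (fintype.lift ord0 i)) j * v j =
      \sum_j ev (mderiv j (G i)) Q * v j.
    by apply: eq_bigr => j _; rewrite mxE !liftK.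
  have Av (v : 'I_m -> C) (u : 'rV_k.+2) : \sum_j (u *m A) 0 j * v j =
      u 0 ord0 * v j0 + (u 0 (fintype.lift ord0 ord0) * v i0 +
      \sum_i u 0 (fintype.lift ord0 (fintype.lift ord0 i)) *
        \sum_j ev (mderiv j (G i)) Q * v j).
    rewrite (eq_bigr (fun j => \sum_i u 0 i * (A i j * v j))) => [|j _]; last first.
      by rewrite mxE big_distrl; apply: eq_bigr => i _ /=; rewrite mulrA.
    rewrite exchange_big /= big_ord_recl big_ord_recl -!big_distrr /= A0 A1.
    by congr (_ + (_ + _)); apply: eq_bigr => i _; rewrite -big_distrr A2.
  have Afull (j : 'I_m) : exists u : 'rV_k.+2, delta_mx 0 j = u *m A.
    apply/submxP; apply: submx_full; rewrite /row_full -mxrank_tr -/(row_free A^T).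
    rewrite -kermx_eq0; apply/eqP/row_matrixP => i; rewrite row0.
    set v := row i _; have vA : v *m A^T = 0 by apply/sub_kermxP; exact: row_sub.
    apply/eqP; apply: contrapT => /negP/rV0Pn[j1 vj1].
    have {}vA i' : \sum_j A i' j * v 0 j = 0.
      transitivity ((v *m A^T) 0 i'); last by rewrite vA mxE.
      by rewrite mxE; apply: eq_bigr => j' _; rewrite [A^T _ _]mxE mulrC.
    move/eqP: EX0; apply; apply/(Eker 'X_j0 _ Qi0); exists (fun j => v 0 j).
    split=> [|||i']; first by exists j1.
    - by rewrite -A1 vA.
    - rewrite -[RHS](vA ord0) A0; apply: sumd => j'.
      by rewrite mderiv_XU rmorph_nat.
    - by rewrite -A2 vA.
  have /choice[u hu] := Afull.
  have yu j R : y j R = u j 0 ord0 * y j0 R + (u j 0 (fintype.lift ord0 ord0) * y i0 R +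
      \sum_i u j 0 (fintype.lift ord0 (fintype.lift ord0 i)) *
        \sum_j' ev (mderiv j' (G i)) Q * y j' R).
    rewrite -Av -hu (bigD1 j) //= mxE !eqxx mul1r big1 ?addr0 // => j' jj'.
    by rewrite mxE (negPf jj') andbF mul0r.
  have /choice[T hT] i : exists H : 'I_m -> 'I_m -> form, forall z,
     (G i).@[z] = ev (G i) Q + \sum_j ev (mderiv j (G i)) Q * (z j - coord (val Q) j) +
      \sum_j \sum_k (z j - coord (val Q) j) * (z k - coord (val Q) k) * (H j k).@[z].
    exact: mpoly_taylor2.
  pose S i l R := \sum_j y j R * (T i j l).@[fun j => z j R].
  have GS i : ae (fun R => \sum_j ev (mderiv j (G i)) Q * y j R = - \sum_l S i l R * y l R).
    apply: aeS (zv _ (Gv i)) => R; rewrite hT; have [_ ->] := Gv i; rewrite add0r.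
    move/eqP; rewrite addr_eq0 => /eqP ->; congr (- _); rewrite exchange_big.
    apply: eq_bigr => l _; rewrite /S big_distrl; apply: eq_bigr => j _ /=.
    by rewrite -/(y j R) -/(y l R); ring.
  have [||g hg yg] := @nakayama m y t (fun j => u j 0 ord0 * coord (val Q) i0)
    (fun j l R => - \sum_i u j 0 (fintype.lift ord0 (fintype.lift ord0 i)) * S i l R) Q.
  - move=> j l; suff h : rv Q (fun R => \sum_i u j 0 (fintype.lift ord0 (fintype.lift ord0 i)) * S i l R) 0.
      by have := rvN h; rewrite oppr0.
    apply: rv_sum0 => i.
    suff h : rv Q (S i l) 0.
      by have := rvZ (u j 0 (fintype.lift ord0 (fintype.lift ord0 i))) h; rewrite mulr0.
    by apply: rv_sum0 => j'; apply: rvM0 (hy j') _; exact: rv_meval.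
  - move=> j; apply: ae2 (ae_fin GS) aeX _ => R GSR Ri0; rewrite yu.
    have -> : y i0 R = 0 by rewrite /y zE divff // mulr1 subrr.
    have -> : y j0 R = coord (val Q) i0 * t R.
      have aux (x x' p r : C) : p != 0 -> r != 0 -> p * (x / r) - x' = p * ((x - x' / p * r) / r).
        by move=> p0 r0; field; rewrite p0 r0.
      by rewrite /y zE /t mevalB mevalZ !mevalXU; exact: aux.
    rewrite mulr0 add0r mulrA; congr (_ + _).
    under [RHS]eq_bigr do rewrite mulNr big_distrl /=.
    rewrite sumrN exchange_big -sumrN; apply: eq_bigr => i _ /=.
    rewrite GSR mulrN; congr (- _); rewrite big_distrr; apply: eq_bigr => l _ /=.
    by rewrite mulrA.
  have [K FK] := mpoly_factor (coord (val Q)) F.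
  have /choice[c hc] := hg.
  exists (fun R => (\sum_j g j R * (K j).@[fun j => z j R]) / H.@[fun j => z j R]).
    exists ((\sum_j c j * ev (K j) Q) / ev H Q); apply: rvM; last first.
      by apply: rvV => //; exact: rv_meval.
    by apply: rv_sum => j; apply: rvM (hc j) _; exact: rv_meval.
  apply: ae3 fE (zF _ _ _ hF hH) (ae_fin yg) _ => R -> -> yR.
  rewrite mulrA; congr (_ / _); rewrite FK FQ mevalD mevalC add0r meval_sum big_distrr.
  apply: eq_bigr => j _ /=; rewrite mevalM mevalB mevalXU mevalC -/(y j R) yR mulrA.
  by [].
exists (quot_rule E N L 'X_i0 Q).
  by rewrite /quot_rule EL LQ mul0r subr0 mevalXU !mulf_neq0 ?invr_eq0 ?expf_neq0.
apply: (der_form dE hL (X1 i0)) => //; first by rewrite mevalXU.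
exact: aeT.
Qed.

End Frame.

(** * Orders of vanishing and differential forms *)

Section Order.
Variables (C : closedFieldType) (X : curve C).
Implicit Types (P Q R : pt X) (f g t : pt X -> C) (c : C).
Local Notation m := (ambient X).+1.
Local Notation form := {mpoly C[m]}.
Implicit Types (F H : form).

Lemma der_eq0 E e N f : @graded_derivation C X E e N -> (forall c, E c%:MP = 0) ->
  forall c, ae (fun R => f R = c) -> ae (fun R => der E N f R = 0).
Proof.
move=> dE Ec c fc.
by apply: ae2 (der_ae dE fc) (der_cst dE (Ec c)) _ => R -> ->.
Qed.

(** Otherwise the maximal ideal would be 0, while a frame provides an element of it with nonzero
    derivative. *)
Lemma uniformizer_neq0 Q t : uniformizer Q t -> ae (fun R => t R != 0).
Proof.
move=> [rt ut]; have [t0|//] := rv_dichotomy rt.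
have [E [e [N [t' [dE Ec NQ [rt' _] [c c0 rc]]]]]] := frame_exists Q.
have [g _ tg] := ut t' rt'; case/eqP: c0; apply: rv_ae0 rc _.
by apply: (der_eq0 dE Ec (c := 0)); apply: ae2 tg t0 _ => R -> ->; rewrite mul0r.
Qed.

(** Krull's intersection theorem. If f = t^k g_k for every k, noetherianity gives a relation between
    the numerators of the g_k; as g_j = t^(n-j) g_n, it reads u g_n = 0 with [u] nonzero at [Q]. *)
Lemma finite_order Q t f c : uniformizer Q t -> rv Q f c -> ~ ae (fun R => f R = 0) ->
  exists k e e0, [/\ rv Q e e0, e0 != 0 & ae (fun R => f R = t R ^+ k * e R)].
Proof.
move=> ut rf nf0; apply: contrapT => nord; apply: nf0.
have step k : exists g, reg Q g /\ ae (fun R => f R = t R ^+ k * g R).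
  elim: k => [|k [g [[d rg] fg]]].
    by exists f; split; [exists c|apply: aeT => R; rewrite mul1r].
  have [d0|d0] := eqVneq d 0; last by case: nord; exists k, g, d.
  rewrite d0 in rg; have [h rh gh] := ut.2 g rg; exists h; split=> //.
  by apply: ae2 fg gh _ => R -> ->; rewrite exprSr mulrA.
have /choice[g hg] := step.
have /choice[r hr] k : exists r : nat * form * form, [/\ r.1.2 \is (r.1.1).-homog,
    r.2 \is (r.1.1).-homog, ev r.2 Q != 0 & ae (fun R => g k R = ev r.1.2 R / ev r.2 R)].
  by have [[c' [d [F [H [hF hH HQ _ fE]]]]] _] := hg k; exists (d, F, H).
have [n [a]] := noetherian_mpoly (fun k => (r k).1.2); rewrite size_mkseq => Fn.
have [i0 Qi0] := coord_neq0 (val Q).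
have [z [hz zE zF zv]] := affine_coordinates Qi0.
pose u R := (r n).2.@[fun j => z j R] -
  \sum_(j < n) (a j).@[fun i => z i R] * (r j).2.@[fun i => z i R] * t R ^+ (n - j).
have ru : rv Q u (ev (r n).2 Q).
  rewrite -[ev _ _]subr0; apply: rvB; first exact: rv_meval.
  apply: rv_sum0 => j; rewrite -(mulr0 ((a j).@[coord (val Q)] * (r j).2.@[coord (val Q)])).
  apply: rvM; first by apply: rvM; exact: rv_meval.
  have := rvX (n - j) ut.1; rewrite expr0n subn_eq0 leqNgt ltn_ord; exact.
have [_ _ HnQ _] := hr n.
have hz0 k : ae (fun R => (r k).2.@[fun i => z i R] != 0).
  have [_ _ HkQ _] := hr k; exact: rv_neq0 (rv_meval _ hz) HkQ.
have hgz k : ae (fun R => (r k).1.2.@[fun i => z i R] = (r k).2.@[fun i => z i R] * g k R).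
  have [hF hH HkQ gE] := hr k; apply: ae3 gE (zF _ _ _ hF hH) (hz0 k) _ => R -> -> H0.
  by rewrite mulrCA divff ?mulr1.
pose all_k := @ae_seq _ X _ (iota 0 n.+1).
apply: ae3 (aeI (rv_neq0 ru HnQ) (uniformizer_neq0 ut)) (all_k _ (fun k _ => hgz k))
  (all_k _ (fun k _ => (hg k).2)) _ => R [uR tR] gR fR.
have memn k : (k <= n)%N -> k \in iota 0 n.+1 by rewrite mem_iota.
rewrite (fR n) ?memn //; suff -> : g n R = 0 by rewrite mulr0.
apply: (mulfI uR); rewrite mulr0 /u mulrBl -gR ?memn // Fn meval_sum.
rewrite big_distrl -sumrB big1 // => j _ /=.
have jn : (j <= n)%N by exact: ltnW.
rewrite nth_mkseq // mevalM gR ?memn //.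
suff -> : g j R = t R ^+ (n - j) * g n R by rewrite -!mulrA subrr.
have tj : t R ^+ j != 0 by rewrite expf_neq0.
by apply: (mulfI tj); rewrite -fR ?memn // mulrA -exprD subnKC // -fR ?memn.
Qed.

Hypothesis char0 : [pchar C] =i pred0.

Lemma der_order E e N Q t k f g (g0 : C) c : @graded_derivation C X E e N -> ev N Q != 0 ->
  rv Q t 0 -> rv Q (der E N t) c -> rv Q g g0 ->
  ae (fun R => f R = t R ^+ k.+1 * g R) ->
  exists u, rv Q u (k.+1%:R * g0 * c) /\ ae (fun R => der E N f R = t R ^+ k * u R).
Proof.
move=> dE NQ rt rdt rg fE; have [c' rdg] := der_rv dE rg NQ.
exists (fun R => k.+1%:R * g R * der E N t R + t R * der E N g R); split.
  rewrite -[_ * c]addr0; apply: rvD (rvM0 rt rdg).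
  by apply: rvM => //; apply: rvZ.
have derX : forall i, ae (fun R => der E N (fun R => t R ^+ i.+1) R = i.+1%:R * t R ^+ i * der E N t R).
  elim=> [|i IH].
    by apply: aeT => R; rewrite expr0 mulr1 mul1r.
  have h : ae (fun R => t R ^+ i.+2 = t R * t R ^+ i.+1) by apply: aeT => R; rewrite exprS.
  apply: ae3 (der_ae dE h) (derivM dE rt (rvX i.+1 rt)) IH _ => R -> -> ->.
  by rewrite exprS [i.+2%:R]mulrS; move: (t R ^+ i) => x; ring.
apply: ae3 (der_ae dE fE) (derivM dE (rvX k.+1 rt) rg) (derX k) _ => R -> -> ->.
by rewrite exprS; move: (t R ^+ k) => x; ring.
Qed.

Lemma der_subC E e N Q f c a : @graded_derivation C X E e N -> (forall c, E c%:MP = 0) ->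
  rv Q f c -> ae (fun R => der E N (fun R => f R - a) R = der E N f R).
Proof.
move=> dE Ec rf; apply: ae2 (derivD dE rf (rv_cst Q (- a))) (der_cst dE (Ec (- a))) _ => R ->.
by rewrite addrC => ->; rewrite add0r.
Qed.

(** Near [Q], f - c is t^(k+1) times a unit, so its derivative is t^k times a function with value
    (k+1) g0 d at [Q], which is nonzero in characteristic 0. *)
Lemma nonconstant_der Q E e N t f c : frame Q E e N t -> rv Q f c ->
  ~ ae (fun R => f R = c) -> ae (fun R => der E N f R != 0).
Proof.
move=> [dE Ec NQ ut [d d0 rd]] rf fc.
have rfc : rv Q (fun R => f R - c) 0 by rewrite -(subrr c); exact: rvB rf (rv_cst Q c).
have [|k [g [g0 [rg g00 fE]]]] := finite_order ut rfc.
  by move=> h; apply: fc; apply: aeS h => R /eqP; rewrite subr_eq0 => /eqP.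
case: k fE => [|k] fE.
  case/eqP: g00; apply: (rv_uniq rg); apply: rv_ae rfc.
  by apply: aeS fE => R ->; rewrite mul1r.
have [u [ru uE]] := der_order dE NQ ut.1 rd rg fE.
have /pcharf0P pc := char0.
have u0 : k.+1%:R * g0 * d != 0 by rewrite !mulf_neq0 // pc.
apply: ae3 (aeI uE (der_subC c dE Ec rf)) (rv_neq0 ru u0) (uniformizer_neq0 ut) _ => R [e1 e2] uR tR.
by rewrite -e2 e1 mulf_neq0 // expf_neq0.
Qed.

Lemma uniformizer_mul Q t f e (e0 : C) : uniformizer Q t -> rv Q e e0 -> e0 != 0 ->
  ae (fun R => f R = t R * e R) -> uniformizer Q f.
Proof.
move=> [rt ut] re e00 fE; split.
  have := rvM0 rt re; apply: rv_ae; by apply: aeS fE => R.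
move=> g /ut[h [c rh] gh]; exists (fun R => h R / e R).
  by exists (c / e0); apply: rvM rh (rvV re e00).
apply: ae3 fE gh (rv_neq0 re e00) _ => R -> -> eR.
by rewrite -mulrA [e R * _]mulrC divfK.
Qed.

Lemma unramified E e N Q f c d : @graded_derivation C X E e N -> (forall c, E c%:MP = 0) ->
  ev N Q != 0 -> rv Q f c -> rv Q (der E N f) d -> d != 0 -> uniformizer Q (fun R => f R - c).
Proof.
move=> dE Ec NQ rf rd d0; have [_ [_ [_ [t [_ _ _ ut _]]]]] := frame_exists Q.
have rfc : rv Q (fun R => f R - c) 0 by rewrite -(subrr c); exact: rvB rf (rv_cst Q c).
have [|k [g [g0 [rg g00 fE]]]] := finite_order ut rfc.
  move=> h; case/eqP: d0; apply: rv_ae0 rd _; apply: (der_eq0 dE Ec (c := c)).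
  by apply: aeS h => R /eqP; rewrite subr_eq0 => /eqP.
have [d' rd'] := der_rv dE ut.1 NQ.
case: k fE => [|[|k]] fE.
- case/eqP: g00; apply: (rv_uniq rg); apply: rv_ae rfc.
  by apply: aeS fE => R ->; rewrite mul1r.
- by apply: uniformizer_mul ut rg g00 _; exact: fE.
- have [u [ru uE]] := der_order dE NQ ut.1 rd' rg fE.
  case/eqP: d0; apply: rv_uniq rd _.
  have h : rv Q (fun R => t R ^+ k.+1 * u R) 0.
    by apply: rvM0 ru; have := rvX k.+1 ut.1; rewrite expr0n.
  apply: rv_ae h; apply: ae2 uE (der_subC c dE Ec rf) _ => R.
  by move=> e1 e2; rewrite -e2 e1.
Qed.

Lemma derivation_cst P (D : (pt X -> C) -> C) c : derivation_at P D -> D (fun=> c) = 0.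
Proof.
move=> [Dn Dl DM]; have reg1 a : regular_at P (fun=> a) by exact/rv_regular_at/rv_cst.
have D1 : D (fun=> 1) = 0.
  have := DM _ _ (reg1 1) (reg1 1); rewrite (_ : (fun Q => 1 * 1) = (fun=> 1)); last first.
    by apply: funext => Q; rewrite mulr1.
  rewrite !mul1r => /(congr1 (fun x => x - D (fun=> 1))).
  by rewrite subrr addrK.
have D0 : D (fun=> 0) = 0.
  have : D (fun=> 0) = -1 * D (fun=> 0) + D (fun=> 0); last by rewrite mulN1r addNr.
  rewrite -(Dl (-1) _ _ (reg1 0) (reg1 0)); congr D.
  by apply: funext => Q; rewrite mulr0 addr0.
have : D (fun=> c) = c * D (fun=> 1) + D (fun=> 0); last by rewrite D1 D0 mulr0 addr0.
rewrite -(Dl c _ _ (reg1 1) (reg1 0)); congr D.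
by apply: funext => Q; rewrite mulr1 addr0.
Qed.

(** The tangent space is at most a line: [r f] is the value at [P] of (f - f(P)) / t. *)
Lemma derivation_ratio P : exists r : (pt X -> C) -> C,
  exists2 t : pt X -> C, regular_at P t &
  forall D f, derivation_at P D -> regular_at P f -> D f = r f * D t.
Proof.
have [_ [_ [_ [t [_ _ _ [rt ut] _]]]]] := frame_exists P.
(* [regular_at] and [derivation_at] see the actual value at [P], so a germ known off a finite set
   must have its value there corrected. *)
pose upd g c : pt X -> C := fun R => if pselect (R = P) then c else g R.
have updE g c : ae (fun R => upd g c R = g R).
  by apply: aeS (ae_neq P) => R RP; rewrite /upd; case: pselect.
have updP g c : upd g c P = c by rewrite /upd; case: pselect.
have updr g c : rv P g c -> regular_at P (upd g c).
  move=> rg; apply: rv_regular_at; rewrite updP; apply: rv_ae rg.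
  by apply: aeS (updE g c).
pose t' := upd t 0.
have dec f : exists gc : (pt X -> C) * C, regular_at P f ->
    rv P gc.1 gc.2 /\ ae (fun R => f R - f P = t R * gc.1 R).
  have [rf|] := pselect (regular_at P f); last by exists (f, 0).
  have [|g [c rg] fE] := ut (fun R => f R - f P).
    by rewrite -(subrr (f P)); apply: rvB (rv_cst P _); exact: regular_at_rv.
  by exists (g, c).
have /choice[gc gcE] := dec; exists (fun f => (gc f).2), t'; first exact: updr.
move=> D f DP rf; have [Dn Dl DM] := DP; have [rg fE] := gcE f rf.
set g := (gc f).1 in rg fE; set c := (gc f).2 in rg *.
have rt' := updr t 0 rt; have rg' := updr g c rg.
have rtg : regular_at P (fun R => t' R * upd g c R).
  by apply/rv_regular_at/rvM; exact: regular_at_rv.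
have -> : D f = D (fun R => 1 * (t' R * upd g c R) + f P).
  apply: Dn; apply: ae_eq_near; last by rewrite /t' !updP mul0r mulr0 add0r.
  apply: ae3 (updE t 0) (updE g c) fE _ => R e1 e2 e3.
  by rewrite /t' e1 e2 mul1r -e3 subrK.
rewrite Dl //; last exact/rv_regular_at/rv_cst.
rewrite (derivation_cst _ DP) addr0 mul1r DM // /t' !updP mul0r add0r.
by [].
Qed.

(** All derivations at [P] are multiples of one functional, and [w] is linear in them. Hence the
    quotient w(D) / D f does not depend on [D], which gives a meaning to w / df. *)
Lemma form_wedge (w : diff_form X) P D D' f : regular_form w -> derivation_at P D ->
  derivation_at P D' -> regular_at P f -> w P D * D' f = w P D' * D f.
Proof.
move=> /(_ P)[U [k [a [b [oU UP ab wE]]]]] hD hD' rf.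
have [r [t rt h]] := derivation_ratio P.
have rb i : regular_at P (b i) by exists U; split=> //; have [] := ab i.
rewrite (wE P D UP hD) (wE P D' UP hD') (h D f) // (h D' f) //.
rewrite !big_distrl; apply: eq_bigr => i _ /=.
by rewrite (h D _ hD (rb i)) (h D' _ hD' (rb i)); ring.
Qed.

(** The value is read off the germ, because [der E N f] may take arbitrary values on a finite set;
    it is 0 by default. *)
Definition der_at E N P f : C :=
  if pselect (exists c, rv P (der E N f) c) is left ex then projT1 (cid ex) else 0.

Lemma der_atE E N P f c : rv P (der E N f) c -> der_at E N P f = c.
Proof.
move=> h; rewrite /der_at; case: pselect => [ex|[]]; last by exists c.
by case: cid => c' /= /rv_uniq; apply.
Qed.

Lemma der_at_derivation E e N P : @graded_derivation C X E e N -> (forall c, E c%:MP = 0) ->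
  ev N P != 0 -> derivation_at P (der_at E N P).
Proof.
move=> dE Ec NP; have der_at_rv f : regular_at P f -> rv P (der E N f) (der_at E N P f).
  by move=> /regular_at_rv/(der_rv dE)/(_ NP)[c hc]; rewrite (der_atE hc).
split=> [f g /eq_near_ae[fg _]|c f g rf rg|f g rf rg].
- have [[c hc]|nc] := pselect (exists c, rv P (der E N f) c).
    rewrite (der_atE hc) (der_atE (rv_ae _ hc)) //.
    by apply: aeS (der_ae dE fg).
  rewrite /der_at; case: pselect => // _; case: pselect => // -[c hc]; case: nc.
  exists c; apply: rv_ae hc; by apply: aeS (der_ae dE fg).
- apply: der_atE; apply: rv_ae (rvD (rvZ c (der_at_rv f rf)) (der_at_rv g rg)).
  have rcf := rvZ c (regular_at_rv rf).
  apply: ae3 (derivD dE rcf (regular_at_rv rg)) (derivM dE (rv_cst P c) (regular_at_rv rf))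
    (der_cst dE (Ec c)) _ => R -> -> ->.
  by rewrite mulr0 addr0.
- apply: der_atE; apply: rv_ae (rvD (rvM (regular_at_rv rf) (der_at_rv g rg))
    (rvM (regular_at_rv rg) (der_at_rv f rf))).
  by apply: aeS (derivM dE (regular_at_rv rf) (regular_at_rv rg)) => R ->.
Qed.

Lemma form_rv E e N P (w : diff_form X) : @graded_derivation C X E e N ->
  (forall c, E c%:MP = 0) -> ev N P != 0 -> regular_form w ->
  rv P (fun R => w R (der_at E N R)) (w P (der_at E N P)).
Proof.
move=> dE Ec NP /(_ P)[U [k [a [b [oU UP ab wE]]]]].
have rb i : rv P (b i) (b i P) by apply: regular_at_rv; exists U; split=> //; have [] := ab i.
have ra i : rv P (a i) (a i P) by apply: regular_at_rv; exists U; split=> //; have [] := ab i.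
have rd i : rv P (der E N (b i)) (der_at E N P (b i)).
  by have [c hc] := der_rv dE (rb i) NP; rewrite (der_atE hc).
rewrite (wE P _ UP); last exact: (der_at_derivation dE Ec NP).
apply: rv_ae (rv_sum _ (fun i => rvM (ra i) (rd i))).
apply: ae3 (zopen_ae oU UP) (ae_ev (gder_norm dE) NP) (ae_fin (fun i => rv_reg (rd i))) _ => R UR NR rdR.
rewrite (wE R _ UR); last exact: (der_at_derivation dE Ec NR).
by apply: eq_bigr => i _; rewrite (der_atE (rdR i)).
Qed.

End Order.

(** * Global functions *)

Section GlobalFunctions.
Variables (C : closedFieldType) (X : curve C).
Implicit Types (P Q R : pt X) (f g t : pt X -> C) (c : C).
Local Notation m := (ambient X).+1.
Local Notation form := {mpoly C[m]}.
Implicit Types (F H : form).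

Lemma algebraic_constant Q f c (p : {poly C}) : rv Q f c -> p != 0 ->
  ae (fun R => p.[f R] = 0) -> exists a, ae (fun R => f R = a).
Proof.
move=> rf p0 pf; have [s sE] := closed_field_poly_normal p.
apply: contrapT => nc; have fs a : ae (fun R => f R - a != 0).
  have [h|//] := rv_dichotomy (rvB rf (rv_cst Q a)); case: nc; exists a.
  by apply: aeS h => R /eqP; rewrite subr_eq0 => /eqP.
have [R [pR fR]] := ae_ex (aeI pf (ae_seq (fun a (_ : a \in s) => fs a))).
move/eqP: pR; rewrite sE hornerZ mulf_eq0 lead_coef_eq0 (negPf p0) /= horner_prod.
rewrite prodf_seq_eq0 => /hasP[a sa] /=; rewrite hornerXsubC.
by apply/negP/fR.
Qed.

Lemma homogenization i (A : form) N : (msize A <= N)%N -> exists2 A' : form, A' \is N.-homog &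
  forall v : 'I_m -> C, v i != 0 -> v i ^+ N * A.@[fun j => v j / v i] = A'.@[v].
Proof.
move=> AN; exists (\sum_(u <- msupp A) A@_u *: ('X_[u] * 'X_i ^+ (N - mdeg u))).
  rewrite big_seq; apply: rpred_sum => u uA; apply: dhomogZ.
  have uN : (mdeg u <= N)%N by apply: leq_trans AN; exact/ltnW/msize_mdeg_lt.
  rewrite -[N in N.-homog](subnKC uN); apply: dhomogM; first by rewrite dhomogX /=.
  have X1 : ('X_i : form) \is 1.-homog by rewrite dhomogX /= mdeg1.
  by have := dhomogMn (N - mdeg u) X1; rewrite mul1n.
move=> v vi; rewrite mevalE meval_sum big_distrr /= big_seq [RHS]big_seq.
apply: eq_bigr => u uA; rewrite mevalZ mevalM meval_exp mevalXU mevalX mulrCA; congr (_ * _).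
have uN : (mdeg u <= N)%N by apply: leq_trans AN; exact/ltnW/msize_mdeg_lt.
under eq_bigr do rewrite exprMn; rewrite big_split /= prodrXr -mdegE exprVn.
rewrite -[in LHS](subnK uN) exprD mulrC -!mulrA; congr (_ * _).
by rewrite mulrC -mulrA divff ?mulr1 // expf_neq0.
Qed.

Hypothesis C_uncountable : ~ countable [set: C].

(** The polynomials [B] such that B f is polynomial on the chart form an ideal. If it were proper,
    it would have a common zero: a point of the curve at which [f] is regular although every
    denominator vanishes. *)
Lemma regular_polynomial i f : (forall Q, reg Q f) -> (exists Q : pt X, coord (val Q) i != 0) ->
  exists A : form, ae (fun R => f R = A.@[fun j => coord (val R) j / coord (val R) i]).
Proof.
move=> rf [Q0 Qi]; pose z R j := coord (val R) j / coord (val R) i.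
have X1 : ('X_i : form) \is 1.-homog by rewrite dhomogX /= mdeg1.
have aeX : ae (fun R => coord (val R) i != 0).
  by have := @ae_ev _ X _ _ Q0 X1; rewrite mevalXU => /(_ Qi); apply: aeS => R; rewrite mevalXU.
have hz d F R : F \is d.-homog -> F.@[z R] = (coord (val R) i)^-1 ^+ d * ev F R.
  by move=> hF; rewrite -(dhomogXn_prod _ _ hF); apply: meval_eq => j; rewrite mulrC.
pose J : set form := fun B => exists A : form, ae (fun R => B.@[z R] * f R = A.@[z R]).
have [[A h]|J1] := pselect (J 1).
  by exists A; apply: aeS h => R; rewrite meval1 mul1r.
have pJ : proper_ideal J.
  split=> //.
  - by exists 0; apply: aeT => R; rewrite !meval0 mul0r.
  - move=> B B' [A h] [A' h']; exists (A + A'); apply: ae2 h h' _ => R e e'.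
    by rewrite !mevalD mulrDl e e'.
  - move=> D B [A h]; exists (D * A); apply: aeS h => R e.
    by rewrite !mevalM -mulrA e.
have [v vJ] := weak_nullstellensatz C_uncountable pJ.
have JF F : vanishing F -> F.@[v] = 0.
  move=> [[d hF] F0]; apply: vJ; exists 0; apply: aeT => R.
  by rewrite (hz d) // F0 mulr0 mul0r meval0.
(* ['X_i - 1] vanishes on the chart, hence lies in [J]; this places the common zero in the chart. *)
have vi : v i = 1.
  have /eqP : ('X_i - 1 : form).@[v] = 0.
    apply: vJ; exists 0; apply: aeS aeX => R Ri.
    by rewrite mevalB mevalXU meval1 /z divff // subrr mul0r meval0.
  by rewrite mevalB mevalXU meval1 subr_eq0 => /eqP.
have [|P [c [c0 cP]]] := @point_of _ _ v i; first by rewrite vi oner_neq0.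
have [cX _ _] := locus_irreducible X.
have XP : locus X P.
  case: cX => S hS e; rewrite e /= => F SF; have [d hF] := hS F SF.
  apply/eqP; rewrite (meval_coord_eq0 hF c0 cP); apply/eqP/JF; split; first by exists d.
  by move=> Q; move: (val Q) (pt_locus Q) => P'; rewrite e; apply.
pose Q : pt X := exist _ P (mem_set XP).
have [c' [d [F [H [hF hH HQ _ fE]]]]] := rf Q.
suff HQ0 : ev H Q = 0 by rewrite HQ0 eqxx in HQ.
apply/eqP; rewrite (meval_coord_eq0 hH c0 cP); apply/eqP/vJ; exists F.
apply: ae3 fE aeX (ae_ev hH HQ) _ => R -> Ri HR.
by rewrite (hz d F) // (hz d H) // -mulrA [ev H R * _]mulrC divfK.
Qed.

(** For large M, multiplication by [f] maps the forms of degree M, restricted to the curve, to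
    themselves. So [f] is pointwise an eigenvalue of a fixed matrix, hence algebraic over [C], hence
    constant. *)
Lemma regular_constant f : (forall Q, reg Q f) -> exists c, ae (fun R => f R = c).
Proof.
move=> rf.
have /choice[A hA] i : exists A : form, ae (fun R => coord (val R) i != 0 ->
    f R = A.@[fun j => coord (val R) j / coord (val R) i]).
  have [Xi|nXi] := pselect (exists Q : pt X, coord (val Q) i != 0).
    by have [A h] := regular_polynomial rf Xi; exists A; apply: aeS h => R ->.
  by exists 0; apply: aeT => R Ri; case: nXi; exists R.
pose N := (\max_i msize (A i)).+1.
have /choice[B hB] i : exists B : form, B \is N.-homog /\ ae (fun R =>
    coord (val R) i ^+ N * f R = ev B R).
  have [|B hB BE] := @homogenization i (A i) N; first exact/leqW/(leq_bigmax i).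
  have [Xi|nXi] := pselect (exists Q : pt X, coord (val Q) i != 0); last first.
    exists 0; split; first exact: dhomog0.
    apply: aeT => R; have -> : coord (val R) i = 0.
      by apply/eqP; apply: contrapT => /negP Ri; apply: nXi; exists R.
    by rewrite meval0 expr0n mul0r.
  exists B; split=> //; have [Q Qi] := Xi.
  have X1 : ('X_i : form) \is 1.-homog by rewrite dhomogX /= mdeg1.
  have := @ae_ev _ X _ _ Q X1; rewrite mevalXU => /(_ Qi) aeX.
  by apply: ae2 (hA i) aeX _ => R h; rewrite mevalXU => Ri; rewrite h // BE.
(* In a monomial of degree m N in m variables some exponent is at least N, so [hB] applies to one of
   its factors. *)
pose M := (m * N)%N; pose I := 'X_{1..m < M.+1}.
(* The index type [I] contains all monomials of degree at most M; those of smaller degree are made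
   to contribute 0. *)
pose e (R : pt X) (u : I) : C := if mdeg u == M then \prod_j coord (val R) j ^+ u j else 0.
have /choice[a ha] (u : I) : exists a : I -> C, ae (fun R => f R * e R u = \sum_v a v * e R v).
  have [uM|uM] := eqVneq (mdeg u) M; last first.
    exists (fun=> 0); apply: aeT => R; rewrite /e (negPf uM) mulr0 big1 // => v _.
    by rewrite mul0r.
  have [i ui] : exists i, (N <= u i)%N.
    apply: contrapT => h; have : (mdeg u < M)%N; last by rewrite uM ltnn.
    have lt i : (u i <= N.-1)%N.
      by rewrite -ltnS leqNgt; apply/negP => Ni; apply: h; exists i.
    rewrite mdegE; apply: (@leq_ltn_trans (\sum_(i < m) N.-1)); first exact: leq_sum.
    by rewrite sum_nat_const card_ord /M ltn_mul2l /N /=.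
  pose F : form := 'X_[u - U_(i) *+ N] * B i.
  have uE : (u : 'X_{1..m}) = (u - U_(i) *+ N + U_(i) *+ N)%MM.
    rewrite submK //; apply/mnm_lepP => j; rewrite mulmnE mnmE.
    by case: eqP => [<-|_]; rewrite ?mul1n ?mul0n.
  have hF : F \is M.-homog.
    have [hB1 _] := hB i; rewrite -uM [in mdeg _]uE mdegD mdegMn mdeg1 mul1n.
    by apply: dhomogM => //; rewrite dhomogX /=.
  exists (fun v => F@_v); have [_ hB2] := hB i; apply: aeS hB2 => R hR.
  transitivity (ev F R).
    rewrite /F mevalM -hR mulrA [RHS]mulrC /e uM eqxx; congr (_ * _).
    by rewrite -[coord (val R) i](mevalXU (coord (val R))) -meval_exp -mevalM mpolyXn -mpolyXD -uE mevalX.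
  rewrite {1}(mpolywE (k := M.+1) (p := F)); last first.
    rewrite msizeE; apply/bigmax_leqP_seq => u' u'F _; rewrite ltnS.
    by move/dhomogP: hF => /(_ u' u'F) <-.
  rewrite meval_sum; apply: eq_bigr => v _; rewrite mevalZ /e mevalX.
  case: eqP => [//|/eqP vM]; rewrite mulr0 (dhomog_nemf_coeff hF) ?mul0r //.
pose K := #|{: I}|; pose AM := \matrix_(i < K, j < K) a (enum_val j) (enum_val i).
have [Q _] : exists Q : pt X, True by exact: ae_ex (aeT (fun=> Logic.I)).
have [c rfQ] := rf Q.
apply: (algebraic_constant rfQ (p := char_poly AM)).
  exact/monic_neq0/char_poly_monic.
apply: aeS (ae_fin ha) => R hR; apply/eqP; rewrite -/(root _ _) -eigenvalue_root_char.
apply/eigenvalueP; exists (\row_i e R (enum_val i)).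
  apply/rowP => j; rewrite !mxE hR.
  transitivity (\sum_(v in {: I}) a (enum_val j) v * e R v); last exact: eq_bigl.
  by rewrite [RHS]big_enum_val; apply: eq_bigr => i _; rewrite !mxE mulrC.
have [i Ri] := coord_neq0 (val R).
have uM : (mdeg (U_(i) *+ M)%MM < M.+1)%N by rewrite mdegMn mdeg1 mul1n.
apply/rV0Pn; exists (enum_rank (BMultinom uM)); rewrite mxE enum_rankK /e /=.
rewrite mdegMn mdeg1 mul1n eqxx; apply/prodf_neq0 => j _; rewrite mulmnE mnmE.
by case: (eqVneq i j) => [<-|_]; [rewrite mul1n expf_neq0|rewrite mul0n expr0 oner_neq0].
Qed.

(** If [F] had no zero, the ratios ['X_j] / F would be regular everywhere, hence constant, and the
    curve would be a point. *)
Lemma linear_form_zero F : F \is 1.-homog -> exists Q : pt X, ev F Q = 0.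
Proof.
move=> hF; apply: contrapT => nz.
have F0 (Q : pt X) : ev F Q != 0 by apply/eqP => h; apply: nz; exists Q.
have /choice[a ha] j : exists c, ae (fun R => ev 'X_j R / ev F R = c).
  apply: regular_constant => Q; exists (ev 'X_j Q / ev F Q).
  by apply: (@rv_form _ _ 1) => //; rewrite dhomogX /= mdeg1.
have [R hR] := ae_ex (ae_fin ha); have [R' [hR' RR']] := ae_ex (aeI (ae_fin ha) (ae_neq R)).
apply: RR'; apply: val_inj; apply: (@coord_inj _ _ _ _ (ev F R' / ev F R)) => j.
have := hR j; rewrite -(hR' j) !mevalXU => /eqP; rewrite eqr_div // => /eqP e.
by rewrite mulrAC [ev F R' * _]mulrC e mulfK.
Qed.

(** Each F1 - c F0 has a zero on the curve; it is a point where F1 / F0 takes the value c as soon as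
    F0 and F1 have no common zero there. *)
Lemma pencil_exists : exists F0 F1 : form, [/\ F0 \is 1.-homog, F1 \is 1.-homog &
  forall c, exists Q : pt X, ev F0 Q != 0 /\ ev F1 Q / ev F0 Q = c].
Proof.
have [Q _] : exists Q : pt X, True by exact: ae_ex (aeT (fun=> Logic.I)).
have [i0 Qi0] := coord_neq0 (val Q).
have X1 j : ('X_j : form) \is 1.-homog by rewrite dhomogX /= mdeg1.
have /finite_seqP[s sE] : ae (fun R => ev ('X_i0 : form) R != 0).
  by have := @ae_ev _ X _ _ Q (X1 i0); rewrite mevalXU; apply.
(* [F1] takes at R the value of [p R] at x, so it suffices that x is not a root of the finitely many
   nonzero polynomials belonging to the zeros of F0. *)
pose p (R : pt X) := \poly_(i < m) coord (val R) (inord i).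
have p0 : \prod_(R <- s) p R != 0.
  rewrite prodf_seq_neq0; apply/allP => R _ /=; have [i Ri] := coord_neq0 (val R).
  apply: contraNneq Ri => /(congr1 (fun q : {poly C} => q`_i)).
  by rewrite coef0 coef_poly ltn_ord inord_val => ->.
have [x px] := closed_nonrootP _ p0.
pose F1 : form := \sum_(j < m) x ^+ j *: 'X_j.
have hF1 : F1 \is 1.-homog by apply: rpred_sum => j _; exact/dhomogZ/X1.
exists 'X_i0, F1; split=> // c.
have [R] := @linear_form_zero (F1 - c *: 'X_i0) (rpredB hF1 (dhomogZ c (X1 i0))).
rewrite mevalB mevalZ => /eqP; rewrite subr_eq0 => /eqP e; exists R.
have Ri0 : ev ('X_i0 : form) R != 0.
  apply: contraT => /negPn/eqP Ri0; move: px; rewrite rootE horner_prod prodf_seq_eq0 => /hasP[].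
  exists R; first by have : [set` s] R by rewrite -sE /= Ri0 eqxx.
  have := e; rewrite Ri0 mulr0 /F1 meval_sum => h; apply/eqP; rewrite -[RHS]h.
  rewrite /p horner_poly; apply: eq_bigr => j _.
  by rewrite inord_val mevalZ mevalXU mulrC.
by split=> //; rewrite e mulfK.
Qed.

End GlobalFunctions.

(** * The residue theorem for functions with at most two simple poles *)

Section SimplePoles.
Variables (C : closedFieldType) (Y : curve C).
Hypothesis C_uncountable : ~ countable [set: C].
Hypothesis char0 : [pchar C] =i pred0.
Variables (phi : pt Y -> C) (B : seq (pt Y)).
Hypothesis phi_reg : forall Q, Q \notin B -> reg Q phi.
Hypothesis phi_pole : forall Q, Q \in B -> uniformizer Q (fun R => (phi R)^-1).
Implicit Types (Q R : pt Y) (f g : pt Y -> C) (c : C) (p q : {poly C}).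

(* Rational functions with poles of order at most j at the points of B and no
   other pole; [v] gives their coefficients of order j. *)
Definition poles_le j f (v : pt Y -> C) : Prop :=
  (forall Q, Q \notin B -> reg Q f) /\
  forall Q, Q \in B -> rv Q (fun R => f R / phi R ^+ j) (v Q).

Lemma phi_neq0 Q0 : Q0 \in B -> ae (fun R => phi R != 0).
Proof.
by move=> /phi_pole/uniformizer_neq0; apply: aeS => R; rewrite invr_eq0.
Qed.

Hypothesis B_neq0 : exists Q0, Q0 \in B.

Lemma phi_ne0 : ae (fun R => phi R != 0).
Proof. by have [Q0 /phi_neq0] := B_neq0. Qed.

Lemma poles_le0 f v : poles_le 0 f v -> exists c, ae (fun R => f R = c).
Proof.
move=> [rf pf]; apply: regular_constant => // Q.
have [QB|/rf//] := boolP (Q \in B); exists (v Q).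
by apply: eq_rv (pf Q QB) => R; rewrite divr1.
Qed.

Lemma poles_leB j f v g w : poles_le j f v -> poles_le j g w ->
  poles_le j (fun R => f R - g R) (fun Q => v Q - w Q).
Proof.
move=> [rf pf] [rg pg]; split=> [Q QB|Q QB].
  by have [c hc] := rf Q QB; have [d hd] := rg Q QB; exists (c - d); exact: rvB.
by apply: eq_rv (rvB (pf Q QB) (pg Q QB)) => R; rewrite mulrBl.
Qed.

Lemma poles_leM j f v i g w : poles_le j f v -> poles_le i g w ->
  poles_le (j + i) (fun R => f R * g R) (fun Q => v Q * w Q).
Proof.
move=> [rf pf] [rg pg]; split=> [Q QB|Q QB].
  by have [c hc] := rf Q QB; have [d hd] := rg Q QB; exists (c * d); exact: rvM.
by apply: eq_rv (rvM (pf Q QB) (pg Q QB)) => R; rewrite exprD mulf_div.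
Qed.

Lemma poles_le_drop j f v : poles_le j.+1 f v -> (forall Q, Q \in B -> v Q = 0) ->
  exists w, poles_le j f w.
Proof.
move=> [rf pf] v0.
have /choice[w hw] Q : exists c, Q \in B -> rv Q (fun R => f R / phi R ^+ j) c.
  have [QB|] := boolP (Q \in B); last by exists 0.
  have [_ u] := phi_pole QB; have h := pf Q QB; rewrite v0 // in h.
  have [g [c rg] gE] := u _ h; exists c => _; apply: rv_ae rg.
  apply: ae2 gE phi_ne0 _ => R e phiR; apply: (mulfI (_ : (phi R)^-1 != 0)).
    by rewrite invr_eq0.
  by rewrite -e exprSr invfM mulrA mulrC.
by exists w; split=> // Q /hw.
Qed.

Lemma poles_le_poly j p : (size p <= j.+1)%N ->
  poles_le j (fun R => p.[phi R]) (fun=> p`_j).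
Proof.
move=> sp; split=> [Q /phi_reg[c hc]|Q QB]; first by exists p.[c]; exact: rv_horner.
have [rt _] := phi_pole QB.
pose G i R := p`_i * ((phi R)^-1) ^+ (j - i).
have hG : rv Q (fun R => \sum_(i < j.+1) G i R) (\sum_(i < j.+1) p`_i * (0 : C) ^+ (j - i)).
  by apply: rv_sum => i; apply: rvZ; exact: rvX.
rewrite -[p`_j](_ : \sum_(i < j.+1) p`_i * (0 : C) ^+ (j - i) = p`_j); last first.
  rewrite big_ord_recr /= subnn expr0 mulr1 big1 ?add0r // => i _.
  by rewrite expr0n subn_eq0 leqNgt ltn_ord mulr0.
apply: rv_ae hG; apply: aeS phi_ne0 => R phiR.
rewrite (horner_coef_wide _ sp) big_distrl; apply: eq_bigr => i _ /=.
rewrite /G -mulrA; congr (_ * _).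
have ij : (i <= j)%N by rewrite -ltnS.
apply: (mulIf (_ : phi R ^+ j != 0)); first by rewrite expf_neq0.
rewrite divfK ?expf_neq0 // -[in phi R ^+ j](subnK ij) exprD mulrA -exprMn mulVf //.
by rewrite expr1n mul1r.
Qed.

Lemma inverse_at_pole c Q : Q \in B -> rv Q (fun R => (phi R - c)^-1) 0.
Proof.
move=> QB; have [rtQ _] := phi_pole QB.
have r1 : rv Q (fun R => 1 - c * (phi R)^-1) 1.
  by have := rvB (rv_cst Q 1) (rvZ c rtQ); rewrite mulr0 subr0.
apply: rv_ae (rvM0 rtQ (rvV r1 (oner_neq0 _))).
apply: aeS phi_ne0 => R phiR; rewrite -invfM; congr (_^-1).
by rewrite mulrBr mulr1 mulrCA divff // mulr1.
Qed.

(** Otherwise 1 / (phi - c) would be regular everywhere, hence constant, and equal to 0 by its value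
    at a pole. *)
Lemma point_over c : exists2 Q, Q \notin B & rv Q phi c.
Proof.
apply: contrapT => h; have [Q0 Q0B] := B_neq0.
have [rt _] := phi_pole Q0B.
have r0 Q : Q \in B -> rv Q (fun R => (phi R - c)^-1) 0 by exact: inverse_at_pole.
have [Q|d gd] := @regular_constant _ _ C_uncountable (fun R => (phi R - c)^-1).
  have [/r0|QB] := boolP (Q \in B); first by exists 0.
  have [e he] := phi_reg QB; exists (e - c)^-1; apply: rvV; first exact: rvB (rv_cst Q c).
  by rewrite subr_eq0; apply/eqP => ec; apply: h; exists Q; rewrite -?ec.
have d0 : d = 0 by apply: rv_uniq (r0 _ Q0B); apply: rv_ae (rv_cst Q0 d); apply: aeS gd => R.
have phic : ae (fun R => phi R = c).
  by apply: aeS gd => R /eqP; rewrite d0 invr_eq0 subr_eq0 => /eqP.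
have c0 : c^-1 = 0.
  by apply: rv_uniq rt; apply: rv_ae (rv_cst Q0 c^-1); apply: aeS phic => R ->.
have [R [e /eqP]] := ae_ex (aeI phic phi_ne0); apply.
by rewrite e -[c]invrK c0 invr0.
Qed.

Lemma phi_poly0 p : ae (fun R => p.[phi R] = 0) -> p = 0.
Proof.
move=> p0; apply/eqP; apply: contrapT => /negP pn0.
have [x px] := closed_nonrootP _ pn0; have [Q _ hQ] := point_over x.
move/negP: px; apply; apply/eqP; apply: rv_ae0 (rv_horner p hQ) _.
exact: p0.
Qed.

Section Decomposition.
Variables (k : nat) (s : pt Y -> C) (sv : pt Y -> C) (y y' : pt Y).
Hypothesis yB : B = [:: y; y'].
Hypothesis s_poles : poles_le k s sv.
Hypothesis sv_neq : sv y != sv y'.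
Hypothesis k_min : forall j f v, (j < k)%N -> poles_le j f v ->
  exists2 p : {poly C}, (size p <= j.+1)%N & ae (fun R => f R = p.[phi R]).

(** The leading coefficients of [f] at the two poles are matched by a phi^j + b phi^(j-k) s: two
    equations in a and b, solvable because [sv] separates the poles. The difference has smaller pole
    order. *)
Lemma decomposition j f v : poles_le j f v -> exists p q : {poly C}, [/\ (size p <= j.+1)%N,
  (size q <= j.+1 - k)%N & ae (fun R => f R = p.[phi R] + q.[phi R] * s R)].
Proof.
elim: j f v => [|j IH] f v hf.
  have [c fc] := poles_le0 hf; exists c%:P, 0; rewrite size_polyC size_poly0; split=> //.
    by case: (_ == _).
  by apply: aeS fc => R ->; rewrite hornerC horner0 mul0r addr0.
have [jk|kj] := ltnP j.+1 k.
  have [p sp fE] := k_min jk hf; exists p, 0; rewrite size_poly0; split=> //.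
  by apply: aeS fE => R ->; rewrite horner0 mul0r addr0.
pose b := (v y - v y') / (sv y - sv y'); pose a := v y - b * sv y.
have svn : sv y - sv y' != 0 by rewrite subr_eq0.
have sX i (c : C) : (size (c *: 'X^i) <= i.+1)%N by rewrite (leq_trans (size_scale_leq _ _)) // size_polyXn.
have h1 := poles_le_poly (sX j.+1 a).
have h2 := poles_leM (poles_le_poly (sX (j.+1 - k)%N b)) s_poles.
rewrite subnK // in h2.
have hg := poles_leB (poles_leB hf h1) h2.
have [Q|w hw] := poles_le_drop hg.
  rewrite !coefZ !coefXn !eqxx !mulr1 yB !inE => /orP[] /eqP->.
    by rewrite /a; ring.
  rewrite /a -[b * sv y'](subrK (b * sv y)) -mulrBr -[sv y' - _]opprB mulrN /b divfK //.
  by ring.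
have [p [q [sp sq gE]]] := IH _ _ hw.
exists (p + a *: 'X^(j.+1)), (q + b *: 'X^(j.+1 - k)); split.
- rewrite (leq_trans (size_polyD _ _)) // geq_max sX andbT.
  exact: leqW.
- rewrite (leq_trans (size_polyD _ _)) // geq_max (leq_trans sq) ?leq_sub2r //=.
  by rewrite [(j.+2 - k)%N]subSn // sX.
- apply: aeS gE => R e; rewrite !hornerD -[f R](subrK (a *: 'X^(j.+1)).[phi R]).
  rewrite -[f R - _](subrK ((b *: 'X^(j.+1 - k)).[phi R] * s R)) e.
  ring.
Qed.

Lemma decomposition_value j p q : (size p <= j.+1)%N -> (size q <= j.+1 - k)%N -> forall Q,
  Q \in B -> rv Q (fun R => (p.[phi R] + q.[phi R] * s R) / phi R ^+ j)
    (p`_j + (if (k <= j)%N then q`_(j - k) else 0) * sv Q).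
Proof.
move=> sp sq Q QB; have [_ h1] := poles_le_poly sp.
have [kj|jk] := leqP k j.
  have sq' : (size q <= (j - k).+1)%N by rewrite -subSn.
  have := poles_leM (poles_le_poly sq') s_poles; rewrite subnK // => -[_ h2].
  by apply: eq_rv (rvD (h1 Q QB) (h2 Q QB)) => R; rewrite mulrDl.
have q0 : q = 0 by apply/eqP; rewrite -size_poly_leq0 (leq_trans sq) // leqn0 subn_eq0.
rewrite mul0r addr0; apply: eq_rv (h1 Q QB) => R.
by rewrite q0 horner0 mul0r addr0.
Qed.

(** In the top pole order j, the coefficient of [s] differs at the two poles while those of powers
    of [phi] agree; so both top coefficients vanish, and one of them is a leading coefficient. *)
Lemma decomposition_uniq p q : ae (fun R => p.[phi R] + q.[phi R] * s R = 0) -> p = 0 /\ q = 0.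
Proof.
move=> e; pose j := maxn (size p).-1 (k + (size q).-1).
have kj : (k + (size q).-1 <= j)%N by rewrite leq_max leqnn orbT.
have sp : (size p <= j.+1)%N by rewrite (leq_trans (leqSpred _)) // ltnS leq_maxl.
have sq : (size q <= j.+1 - k)%N by rewrite (leq_trans (leqSpred _)) // ltn_subRL ltnS.
have val0 Q : Q \in B -> p`_j + q`_(j - k) * sv Q = 0.
  move=> QB; have := decomposition_value sp sq QB.
  rewrite (leq_trans (leq_addr _ _) kj) => h.
  by apply: rv_ae0 h _; apply: aeS e => R ->; rewrite mul0r.
have q0 : q`_(j - k) = 0.
  have h : p`_j + q`_(j - k) * sv y = p`_j + q`_(j - k) * sv y'.
    by rewrite !val0 // yB !inE eqxx ?orbT.
  have /eqP : q`_(j - k) * (sv y - sv y') = 0.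
    by rewrite mulrBr; move/addrI: h => ->; rewrite subrr.
  by rewrite mulf_eq0 subr_eq0 (negPf sv_neq) orbF => /eqP.
have p0 : p`_j = 0.
  by have := val0 y; rewrite q0 mul0r addr0 yB mem_head => /(_ isT).
have [pq|qp] := leqP (size p).-1 (k + (size q).-1).
  have {}q0 : q = 0.
    apply/eqP; rewrite -lead_coef_eq0 /lead_coef -[(size q).-1](addKn k).
    by rewrite -(maxn_idPr pq) -/j q0.
  split=> //; apply: phi_poly0; apply: aeS e => R.
  by rewrite q0 horner0 mul0r addr0.
have {}p0 : p = 0.
  by apply/eqP; rewrite -lead_coef_eq0 /lead_coef -(maxn_idPl (ltnW qp)) -/j p0.
by rewrite p0 size_poly0 in qp.
Qed.

End Decomposition.

Lemma phi_neq c : ae (fun R => phi R - c != 0).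
Proof.
have [Q _ rQ] := point_over c.
have [h|//] := rv_dichotomy (rvB rQ (rv_cst Q c)).
suff /eqP : 'X - c%:P = 0 :> {poly C} by rewrite polyXsubC_eq0.
by apply: phi_poly0; apply: aeS h => R; rewrite hornerXsubC.
Qed.

(* The residue theorem for [phi] times the form [a dphi]. Let [s] have the least
   possible pole order among the functions regular off [B] that are not
   polynomials in [phi]. Then the functions regular off [B] are the
   [p(phi) + q(phi) s], and, up to subtracting a polynomial in [phi] from [s],
   [s^2 = D(phi)]. Apply this to [P(phi) a], where [P] clears the poles of [a]
   off [B]: as [a] is a form over [dphi], every root of [P] is one of [p], so
   [p = 0] by degrees, and the leading coefficients of [q(phi) s] at the two
   poles are opposite. *)
Lemma form_at_poles (y y' : pt Y) (a va : pt Y -> C) Q0 a0 :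
  B = [:: y] \/ B = [:: y; y'] /\ va y' = 0 -> rv Q0 a a0 ->
  (forall Q c, Q \notin B -> rv Q phi c -> rv Q (fun R => (phi R - c) * a R) 0) ->
  (forall Q, Q \in B -> rv Q (fun R => a R * phi R ^+ 2) (va Q)) -> va y = 0.
Proof.
move=> By ra a_local a_pole; apply/eqP; apply: contrapT => /negP vay.
have yB : y \in B by case: By => [->|[->]]; rewrite mem_head.
have /finite_seqP[zs zsE] := rv_reg ra.
have a_reg Q : Q \notin zs -> reg Q a.
  move=> Qz; exists (a Q); apply: contrapT => h; move/negP: Qz; apply.
  by have : [set` zs] Q by rewrite -zsE.
have /choice[cv hcv] Q : exists c, Q \notin B -> rv Q phi c.
  have [QB|/phi_reg[c hc]] := boolP (Q \in B); [by exists 0|by exists c].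
(* The values 0 and 1 only ensure that d is at least 2: the poles of P(phi) a have order at most d -
   2, because a phi^2 is regular at the points of [B]. *)
pose cs := undup ([:: 0; 1] ++ map cv zs); pose d := size cs.
have d2 : (2 <= d)%N.
  rewrite (@uniq_leq_size _ [:: 0; 1]) //= ?inE 1?eq_sym ?oner_neq0 // => c.
  by rewrite mem_undup mem_cat => ->.
pose P := \prod_(c <- cs) ('X - c%:P).
have sP : size P = d.+1 by rewrite size_prod_XsubC.
have Pd : P`_d = 1.
  by have /monicP := monic_prod_XsubC cs xpredT id; rewrite lead_coefE -/P sP.
pose f R := P.[phi R] * a R.
have f_zero Q c : c \in cs -> Q \notin B -> rv Q phi c -> rv Q f 0.
  move=> ccs QB rQ; have [P1 PE] : exists P1, P = P1 * ('X - c%:P).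
    by apply/factor_theorem; rewrite root_prod_XsubC.
  have := rvM0 (a_local Q c QB rQ) (rv_horner P1 rQ); apply: eq_rv => R.
  by rewrite /f PE hornerM hornerXsubC; ring.
have hf : poles_le (d - 2) f va.
  split=> [Q QB|Q QB].
    have [Qz|Qz] := boolP (Q \in zs); last first.
      have [c hc] := a_reg Q Qz; exists (P.[cv Q] * c).
      exact: rvM (rv_horner P (hcv Q QB)) hc.
    exists 0; apply: f_zero (hcv Q QB) => //.
    by rewrite mem_undup mem_cat map_f ?orbT.
  have sP' : (size P <= d.+1)%N by rewrite sP.
  have [_ h] := poles_le_poly sP'; have {h} := rvM (h Q QB) (a_pole Q QB).
  rewrite Pd mul1r; apply: rv_ae; apply: aeS phi_ne0 => R phiR.
  have -> : phi R ^+ d = phi R ^+ (d - 2) * phi R ^+ 2 by rewrite -exprD subnK.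
  rewrite /f; have : phi R ^+ (d - 2) != 0 by rewrite expf_neq0.
  by move: (phi R ^+ (d - 2)) => z z0; field; rewrite z0.
have psmall (p : {poly C}) : (size p <= (d - 2).+1)%N -> (forall c, c \in cs -> p.[c] = 0) -> p = 0.
  move=> sp pc; apply: (@roots_geq_poly_eq0 _ p cs).
  - by apply/allP => c ccs; apply/eqP/pc.
  - exact: undup_uniq.
  - by rewrite (leq_trans sp) // -subSn // leq_subLR -/d addnC addn2 ltnW.
have f0 : ~ ae (fun R => f R = 0).
  move=> h; case/eqP: vay; have [_ hB] := hf; apply: rv_ae0 (hB y yB) _.
  by apply: aeS h => R ->; rewrite mul0r.
have polyf p : (size p <= (d - 2).+1)%N -> ~ ae (fun R => f R = p.[phi R]).
  move=> sp fE; apply: f0; suff p0 : p = 0 by apply: aeS fE => R ->; rewrite p0 horner0.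
  apply: psmall => // c ccs; have [Q QB rQ] := point_over c.
  apply: rv_uniq (rv_horner p rQ) _; apply: rv_ae (f_zero Q c ccs QB rQ); exact: fE.
pose bad j := `[< exists f v, poles_le j f v /\
  ~ exists2 p : {poly C}, (size p <= j.+1)%N & ae (fun R => f R = p.[phi R]) >].
have ex : exists j, bad j.
  exists (d - 2)%N; apply/asboolP; exists f, va; split=> // -[p sp].
  exact: polyf.
case: (ex_minnP ex) => k /asboolP[s [sv [hs nps]]] kmin.
have k_min j g v : (j < k)%N -> poles_le j g v ->
    exists2 p : {poly C}, (size p <= j.+1)%N & ae (fun R => g R = p.[phi R]).
  move=> jk hg; apply: contrapT => ng; have : (k <= j)%N; last by rewrite leqNgt jk.
  by apply: kmin; apply/asboolP; exists g, v.
(* Otherwise subtracting c phi^k would lower the pole order of [s], against its minimality. *)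
have nconst c : ~ (forall Q, Q \in B -> sv Q = c).
  move=> svc; apply: nps; have sX : (size (c *: 'X^k) <= k.+1)%N.
    by rewrite (leq_trans (size_scale_leq _ _)) // size_polyXn.
  case: k kmin hs k_min sX => [|k] kmin hs k_min sX.
    have [e he] := poles_le0 hs; exists e%:P; first by rewrite size_polyC; case: (_ == _).
    by apply: aeS he => R ->; rewrite hornerC.
  have [Q QB|w hw] := poles_le_drop (poles_leB hs (poles_le_poly sX)).
    by rewrite coefZ coefXn eqxx mulr1 svc // subrr.
  have [p sp hp] := k_min k _ _ (ltnSn k) hw; exists (p + c *: 'X^(k.+1)).
    rewrite (leq_trans (size_polyD _ _)) // geq_max sX andbT; exact: leqW.
  by apply: aeS hp => R h; rewrite hornerD -h subrK.
(* At a single pole [sv] is trivially constant, so this case is already contradictory. *)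
case: By => [BE|[BE vay']].
  by apply: (nconst (sv y)) => Q; rewrite BE inE => /eqP->.
have sv_neq : sv y != sv y'.
  apply/negP => /eqP svE; apply: (nconst (sv y)) => Q.
  by rewrite BE !inE => /orP[] /eqP->.
have [b [al [sb sal ssE]]] := decomposition BE hs sv_neq k_min (poles_leM hs hs).
have two0 : 2%:R != 0 :> C by have /pcharf0P-> := char0.
(* Completing the square in the quadratic equation of [s] over C[phi]. *)
pose s1 R := s R - (2%:R^-1 *: al).[phi R].
have sal2 : (size (2%:R^-1 *: al) <= k.+1)%N.
  by rewrite (leq_trans (size_scale_leq _ _)) // (leq_trans sal) // -addSn addnK.
have hs1 := poles_leB hs (poles_le_poly sal2); rewrite -/s1 in hs1.
set sv1 := (fun Q => _) in hs1.
have sv1_neq : sv1 y != sv1 y' by rewrite /sv1 (inj_eq (addIr _)).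
pose D := b + 4%:R^-1 *: (al * al).
have s1E : ae (fun R => s1 R * s1 R = D.[phi R]).
  apply: aeS ssE => R e; rewrite /D hornerD !hornerZ hornerM.
  transitivity (s R * s R - al.[phi R] * s R + 4%:R^-1 * (al.[phi R] * al.[phi R])).
    by rewrite /s1 hornerZ; field; rewrite two0; have /pcharf0P-> := char0.
  by rewrite e addrK.
have sD : (size D <= (k + k).+1)%N.
  rewrite (leq_trans (size_polyD _ _)) // geq_max sb /=.
  rewrite (leq_trans (size_scale_leq _ _)) // (leq_trans (size_polyMleq _ _)) //.
  have {}sal : (size al <= k.+1)%N by rewrite (leq_trans sal) // -addSn addnK.
  rewrite (leq_trans (_ : _ <= (k.+1 + k.+1).-1)%N) //; last by rewrite addSn addnS.
  by rewrite -!subn1 leq_sub2r // leq_add.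
have sv1_sq Q : Q \in B -> sv1 Q * sv1 Q = D`_(k + k).
  move=> QB; have [_ h] := poles_leM hs1 hs1; have [_ h'] := poles_le_poly sD.
  apply: rv_uniq (h Q QB) _; apply: rv_ae (h' Q QB).
  by apply: aeS s1E => R ->.
have dec := decomposition BE hs1 sv1_neq k_min.
have [p [q [sp sq fE]]] := dec _ _ _ hf.
have p_root c : c \in cs -> p.[c] = 0.
  move=> ccs; apply/eqP; apply: contrapT => /negP pc.
  (* The norm of f = p + q s1: the product of f and f - 2 p is -N. Over a value c with p(c) nonzero,
     the factor f - 2 p is a unit, so f is divisible by phi - c along with N, even at ramified
     points. Decomposing f / (phi - c) then shows that X - c divides p. *)
  pose N := p * p - q * q * D.
  have f2E : ae (fun R => f R * (f R - 2%:R * p.[phi R]) = - N.[phi R]).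
    apply: ae2 fE s1E _ => R -> e; rewrite /N hornerD hornerN !hornerM -e; ring.
  have f2 Q : Q \notin B -> rv Q phi c ->
      rv Q (fun R => f R - 2%:R * p.[phi R]) (- (2%:R * p.[c])).
    move=> QB rQ; have := rvB (f_zero Q c ccs QB rQ) (rvZ 2%:R (rv_horner p rQ)).
    by rewrite sub0r.
  have [N1 N1E] : exists N1, N = N1 * ('X - c%:P).
    apply/factor_theorem; rewrite /root; have [Q QB rQ] := point_over c.
    rewrite -oppr_eq0; apply/eqP; apply: rv_uniq (rvN (rv_horner N rQ)) _.
    have := rvM0 (f_zero Q c ccs QB rQ) (f2 Q QB rQ).
    by apply: rv_ae; exact: f2E.
  pose g R := f R / (phi R - c).
  have hg : poles_le (d - 2) g (fun=> 0).
    split=> [Q QB|Q QB].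
      have rQ := hcv Q QB; have [cQ|cQ] := eqVneq (cv Q) c.
        rewrite cQ in rQ; have r2 := f2 Q QB rQ.
        have n2 : - (2%:R * p.[c]) != 0 by rewrite oppr_eq0 mulf_neq0.
        exists (- N1.[c] * (- (2%:R * p.[c]))^-1).
        apply: rv_ae (rvM (rvN (rv_horner N1 rQ)) (rvV r2 n2)).
        apply: ae3 (phi_neq c) f2E (rv_neq0 r2 n2) _ => R n1 e n3.
        apply: (mulIf n3); apply: (mulIf n1); rewrite /g divfK // mulrAC divfK //.
        by rewrite e N1E hornerM hornerXsubC mulNr.
      have [rf _] := hf; have [e he] := rf Q QB; exists (e * (cv Q - c)^-1).
      by apply: rvM he (rvV (rvB rQ (rv_cst Q c)) _); rewrite subr_eq0.
    have [_ pf] := hf; have := rvM0 (inverse_at_pole c QB) (pf Q QB).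
    by apply: eq_rv => R; rewrite /g; ring.
  have [p1 [q1 [_ _ gE]]] := dec _ _ _ hg.
  have [|/eqP] := @decomposition_uniq _ _ _ _ _ BE hs1 sv1_neq (p - p1 * ('X - c%:P)) (q - q1 * ('X - c%:P)).
    apply: ae3 (phi_neq c) fE gE _ => R n1 e1 e2.
    rewrite 2!hornerD 2!hornerN 2!hornerM !hornerXsubC.
    have : f R = g R * (phi R - c) by rewrite /g divfK.
    rewrite e1 e2; move: (s1 R) (q.[_]) (p.[_]) => S A B0 e.
    transitivity (B0 + A * S - (p1.[phi R] + q1.[phi R] * S) * (phi R - c)); first by ring.
    by rewrite e subrr.
  rewrite subr_eq0 => /eqP pE _; move/negP: pc; apply.
  by rewrite pE hornerM hornerXsubC subrr mulr0.
have p0 : p = 0 by exact: psmall.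
have val Q : Q \in B -> va Q = (if (k <= d - 2)%N then q`_(d - 2 - k) else 0) * sv1 Q.
  move=> QB; have [_ h] := hf; apply: rv_uniq (h Q QB) _.
  have := decomposition_value hs1 sp sq QB; rewrite p0 coef0 add0r.
  by apply: rv_ae; apply: aeS fE => R ->; rewrite p0.
(* The values of [sv1] at the two poles are distinct with equal squares, hence both nonzero. With p
   = 0, the vanishing of [va y'] therefore kills the coefficient of q, and with it [va y]. *)
have y'B : y' \in B by rewrite BE !inE eqxx orbT.
have sv1y' : sv1 y' != 0.
  apply: contraNneq sv1_neq => e; have := sv1_sq y yB; rewrite -(sv1_sq y' y'B) e mulr0.
  by move=> /eqP; rewrite mulf_eq0 orbb.
move/eqP: (val y' y'B); rewrite vay' eq_sym mulf_eq0 (negPf sv1y') orbF => /eqP e.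
by move: vay; rewrite (val y yB) e mul0r eqxx.
Qed.

End SimplePoles.

(** * Zeros of regular differential forms *)

Section FormZeros.
Variables (C : closedFieldType) (Y : curve C).
Implicit Types (P Q R : pt Y) (f g t : pt Y -> C) (c : C) (w : diff_form Y).

Definition form_zero w Q : Prop := forall D, derivation_at Q D -> w Q D = 0.

Lemma rv_regular Q f c : rv Q f c -> exists2 f', regular_at Q f' & ae (fun R => f' R = f R).
Proof.
move=> rf; pose f' R := if R == Q then c else f R.
have ff' : ae (fun R => f' R = f R).
  by apply: aeS (ae_neq Q) => R /eqP RQ; rewrite /f' (negPf RQ).
exists f' => //; apply: rv_regular_at; rewrite /f' eqxx.
by apply: rv_ae rf; apply: aeS ff'.
Qed.

Lemma frame_regular Q E e N t : frame Q E e N t ->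
  exists2 t', regular_at Q t' & der_at E N Q t' != 0.
Proof.
move=> [dE Ec NQ ut [c c0 rc]]; have [t' rt' tt'] := rv_regular ut.1.
exists t' => //; rewrite (@der_atE _ _ E N Q t' c) //.
by apply: rv_ae rc; apply: aeS (der_ae dE tt') => R ->.
Qed.

Lemma form_zeroP w Q E e N t : frame Q E e N t -> regular_form w ->
  form_zero w Q <-> w Q (der_at E N Q) = 0.
Proof.
move=> fr rw; have [dE Ec NQ _ _] := fr.
have h0 := der_at_derivation dE Ec NQ; split=> [|w0 D hD]; first exact.
have [t' rt' nt'] := frame_regular fr.
apply: (mulIf nt'); have := form_wedge rw hD h0 rt'.
by rewrite w0 !mul0r.
Qed.

Lemma form_nonzero_ae w Q : regular_form w -> ~ form_zero w Q ->
  ae (fun R => ~ form_zero w R).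
Proof.
move=> rw nw; have [E [e [N [t fr]]]] := frame_exists Q.
have [dE Ec NQ _ _] := fr.
have wn : w Q (der_at E N Q) != 0.
  by apply/eqP => h; apply: nw; apply/(form_zeroP fr rw).
apply: ae2 (rv_neq0 (form_rv dE Ec NQ rw) wn) (ae_ev (gder_norm dE) NQ) _ => R wR NR zR.
by move/eqP: wR; apply; apply: zR; exact: (der_at_derivation dE Ec NR).
Qed.

Lemma regular_form_lincomb w w' c : regular_form w -> regular_form w' ->
  regular_form (fun Q D => c * w Q D + w' Q D).
Proof.
move=> rw rw' P; have [U [k [a [b [oU UP ab wE]]]]] := rw P.
have [U' [k' [a' [b' [oU' UP' ab' wE']]]]] := rw' P.
have sub (V V' : set (pt Y)) f : zopen V -> V' `<=` V -> regular_on V f -> regular_on V' f.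
  by move=> oV V'V rf; apply: regular_on_rv => R /V'V; exact: regular_on_rvE.
pose pick (A : 'I_k -> pt Y -> C) (A' : 'I_k' -> pt Y -> C) (i : 'I_(k + k')) :=
  match fintype.split i with inl j => A j | inr j => A' j end.
exists (U `&` U'), (k + k')%N, (pick (fun i R => c * a i R) a'), (pick b b'); split=> //.
- by apply: ae_zopen; apply: aeI; [exact: zopen_ae UP|exact: zopen_ae UP'].
- move=> i; rewrite /pick; case: fintype.splitP => j _.
    have [ra rb] := ab j; split; last by apply: sub rb => // R [].
    apply: regular_on_rv => R [UR _]; apply: rvZ; exact: regular_on_rvE UR.
  by have [ra rb] := ab' j; split; [apply: sub ra|apply: sub rb] => // R [].
move=> Q D [UQ UQ'] hD; rewrite big_split_ord /= (wE Q D) // (wE' Q D) // big_distrr /=.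
congr (_ + _); apply: eq_bigr => i _; rewrite /pick.
  have -> : fintype.split (lshift k' i) = inl i by exact: (unsplitK (inl i)).
  by rewrite mulrA.
by have -> : fintype.split (rshift k i) = inr i by exact: (unsplitK (inr i)).
Qed.

Lemma regular_form_sum (I : Type) (r : seq I) (c : I -> C) (w : I -> diff_form Y) :
  (forall i, regular_form (w i)) ->
  regular_form (fun Q D => \sum_(i <- r) c i * w i Q D).
Proof.
move=> rw; elim: r => [|i r IH].
  move=> P; exists setT, 0%N, (fun _ _ => 0), (fun _ _ => 0); split=> //.
  - by apply: ae_zopen; exact: aeT.
  - by case.
  - by move=> R D _ _; rewrite big_nil big_ord0.
rewrite (_ : (fun _ => _) = fun Q D => c i * w i Q D + \sum_(j <- r) c j * w j Q D).
  exact: regular_form_lincomb.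
by apply: funext => Q; apply: funext => D; rewrite big_cons.
Qed.

(** Vanishing at [Q] is one linear condition on forms, as cotangent spaces are lines; two
    independent forms have a nontrivial combination that satisfies it. *)
Lemma form_vanishing_at (g : nat) Q : genus_is Y g -> (2 <= g)%N ->
  exists w, [/\ regular_form w, form_zero w Q & exists R, ~ form_zero w R].
Proof.
case: g => [|[|g]] // [w [rw wi _]] _.
have [E [e [N [t fr]]]] := frame_exists Q; have [dE Ec NQ _ _] := fr.
pose D := der_at E N Q; pose i0 : 'I_g.+2 := ord0; pose i1 : 'I_g.+2 := ord_max.
have [c [c_neq0 c_zero]] : exists c : 'I_g.+2 -> C,
    (exists i, c i != 0) /\ \sum_i c i * w i Q D = 0.
  have [w0|w0] := eqVneq (w i0 Q D) 0.
    exists (fun i => (i == i0)%:R); split; first by exists i0; rewrite eqxx oner_neq0.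
    rewrite (bigD1 i0) //= w0 mulr0 add0r big1 // => i /negPf ->.
    by rewrite mul0r.
  exists (fun i => (i == i1)%:R * w i0 Q D - (i == i0)%:R * w i1 Q D); split.
    by exists i1; rewrite eqxx mul1r (_ : (i1 == i0) = false) // mul0r subr0.
  under eq_bigr do rewrite mulrBl; rewrite sumrB (bigD1 i1) //= [X in _ - X](bigD1 i0) //=.
  rewrite !eqxx !big1 ?addr0 => [|i /negPf->|i /negPf->]; rewrite ?mul0r //.
  by rewrite !mul1r mulrC subrr.
pose v : diff_form Y := fun R D => \sum_i c i * w i R D.
have rv_v : regular_form v by exact: regular_form_sum.
exists v; split=> //.
  by apply/(form_zeroP fr).
apply: contrapT => h; have [i /eqP] := c_neq0; apply; apply: wi => R D' hD'.
apply: contrapT => nz; apply: h; exists R => /(_ D' hD').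
exact: nz.
Qed.

End FormZeros.

(** * A function with simple poles times a regular form *)

Section FormAtPoles.
Variables (C : closedFieldType) (Y : curve C).
Hypothesis C_uncountable : ~ countable [set: C].
Hypothesis char0 : [pchar C] =i pred0.
Variables (phi : pt Y -> C) (B : seq (pt Y)).
Hypothesis phi_reg : forall Q, Q \notin B -> reg Q phi.
Hypothesis phi_pole : forall Q, Q \in B -> uniformizer Q (fun R => (phi R)^-1).
Hypothesis B_neq0 : exists Q0, Q0 \in B.
Variable w : diff_form Y.
Hypothesis rw : regular_form w.
Implicit Types (Q R : pt Y).

Let psi R := (phi R)^-1.
Let phi_nz : ae (fun R => phi R != 0) := phi_ne0 phi_pole B_neq0.

Lemma phi_nonconstant c : ~ ae (fun R => phi R = c).
Proof.
move=> h; have [R [e]] := ae_ex (aeI h (phi_neq C_uncountable phi_reg phi_pole B_neq0 c)).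
by rewrite e subrr eqxx.
Qed.

(** At a pole 1 / phi is itself a parameter, and the parameter [t] of the frame is a multiple of it;
    so the derivation cannot send 1 / phi into the maximal ideal. *)
Lemma der_pole Q E e N t : Q \in B -> frame Q E e N t ->
  [/\ exists2 d, d != 0 & rv Q (der E N psi) d, ae (fun R => der E N psi R != 0) &
      ae (fun R => der E N phi R * psi R ^+ 2 = - der E N psi R)].
Proof.
move=> QB fr; have [dE Ec NQ ut [c c0 rc]] := fr; have [rpsi psiU] := phi_pole QB.
have [d rd] := der_rv dE rpsi NQ.
have [g [g0 rg] tE] := psiU t ut.1.
have [d' rd'] := der_rv dE rg NQ.
have cE : c = 0 * d' + g0 * d.
  apply: rv_uniq rc _; apply: rv_ae (rvD (rvM rpsi rd') (rvM rg rd)).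
  by apply: ae2 (der_ae dE tE) (derivM dE rpsi rg) _ => R -> ->.
have d0 : d != 0.
  by apply: contraNneq c0 => d0; rewrite cE d0 mul0r mulr0 addr0.
split; [by exists d|exact: rv_neq0 rd d0|].
have [Q0 [Q0B phi0]] := ae_ex (aeI (rv_reg rpsi) phi_nz).
have rphi : rv Q0 phi (phi Q0).
  rewrite -[phi Q0]invrK; apply: eq_rv (rvV Q0B _) => [R|]; last by rewrite invr_eq0.
  by rewrite invrK.
have one : ae (fun R => phi R * psi R = 1) by apply: aeS phi_nz => R /divff.
apply: ae3 (aeI (der_ae dE one) (der_cst dE (Ec 1))) (derivM dE rphi Q0B) phi_nz _ => R [e1 e2] e3 nz.
apply/eqP; rewrite -addr_eq0; apply/eqP; transitivity (psi R * (phi R * der E N psi R + psi R * der E N phi R)).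
  by rewrite mulrDr /psi [_ * (phi R * _)]mulrA mulVf // mul1r; ring.
by rewrite -e3 e1 e2 mulr0.
Qed.

(** [form_at_poles] is applied to a = w / d phi, which by [form_wedge] can be computed with the
    frame of any point. At a pole, a phi^2 = - w / d(1/phi) has a value that is 0 exactly when [w]
    vanishes there. *)
Lemma form_vanishes y y' : B = [:: y] \/ B = [:: y; y'] /\ form_zero w y' -> form_zero w y.
Proof.
move=> By; have yB : y \in B by case: By => [->|[->]]; rewrite mem_head.
have [E0 [e0 [N0 [t0 fr0]]]] := frame_exists y; have [dE0 Ec0 N0y _ _] := fr0.
pose a R := w R (der_at E0 N0 R) / der E0 N0 phi R.
have der_neq0 Q E e N t : frame Q E e N t -> ae (fun R => der E N phi R != 0).
  move=> fr; have [QB|QB] := boolP (Q \in B).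
    have [_ h1 h2] := der_pole QB fr; apply: ae2 h1 h2 _ => R nz e'.
    by apply: contraNneq nz => d0; rewrite -oppr_eq0 -e' d0 mul0r.
  have [c rc] := phi_reg QB; exact: (nonconstant_der char0 fr rc (@phi_nonconstant c)).
have rphi : ae (fun R => rv R phi (phi R)).
  have [Q1 Q1B _] := point_over C_uncountable phi_reg phi_pole B_neq0 0.
  by have [c /rv_reg] := phi_reg Q1B.
have der_own Q E e N t : frame Q E e N t -> ae (fun R => rv R (der E N phi) (der E N phi R)).
  move=> [dE Ec NQ _ _].
  have [Q1 [r1 N1]] := ae_ex (aeI rphi (ae_ev (gder_norm dE) NQ)).
  by have [c /rv_reg] := der_rv dE r1 N1.
have aE Q E e N t : frame Q E e N t ->
    ae (fun R => a R = w R (der_at E N R) / der E N phi R).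
  move=> fr; have [dE Ec NQ _ _] := fr.
  apply: ae3 (aeI (der_neq0 _ _ _ _ _ fr) (der_neq0 _ _ _ _ _ fr0))
    (aeI rphi (aeI (der_own _ _ _ _ _ fr) (der_own _ _ _ _ _ fr0)))
    (aeI (ae_ev (gder_norm dE) NQ) (ae_ev (gder_norm dE0) N0y)) _.
  move=> R [d1 d2] [/rv_regular_at rR [o1 o2]] [NR N0R].
  have := form_wedge rw (der_at_derivation dE0 Ec0 N0R) (der_at_derivation dE Ec NR) rR.
  rewrite (der_atE o1) (der_atE o2) /a => e1.
  by apply/eqP; rewrite eqr_div // e1.
have [Q0 [a0 ra]] : exists Q0 a0, rv Q0 a a0.
  have [Q0 [NQ0 [r0 n0]]] := ae_ex (aeI (ae_ev (gder_norm dE0) N0y)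
    (aeI (der_own _ _ _ _ _ fr0) (der_neq0 _ _ _ _ _ fr0))).
  by exists Q0, (w Q0 (der_at E0 N0 Q0) * (der E0 N0 phi Q0)^-1); apply: rvM (form_rv dE0 Ec0 NQ0 rw) (rvV r0 n0).
have pole Q : Q \in B -> exists2 v, rv Q (fun R => a R * phi R ^+ 2) v & (v = 0 <-> form_zero w Q).
  move=> QB; have [E [e [N [t fr]]]] := frame_exists Q; have [dE Ec NQ _ _] := fr.
  have [[d d0 rd] dn dphi] := der_pole QB fr.
  exists (- (w Q (der_at E N Q) / d)).
    apply: rv_ae (rvN (rvM (form_rv dE Ec NQ rw) (rvV rd d0))).
    apply: ae3 (aeI (aE _ _ _ _ _ fr) phi_nz) dn dphi _ => R [-> nz] n1 e1.
    have e2 : der E N phi R = - der E N psi R * phi R ^+ 2.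
      by rewrite -e1 /psi -mulrA -exprMn mulVf // expr1n mulr1.
    rewrite e2; move: (w R _) (der E N psi R) (phi R) n1 nz => u v z v0 z0.
    by rewrite mulNr invrN mulrN mulNr invfM -2!mulrA mulVf ?mulr1 ?expf_neq0.
  rewrite (form_zeroP fr rw); split=> [/eqP|->]; last by rewrite mul0r oppr0.
  by rewrite oppr_eq0 mulf_eq0 invr_eq0 (negPf d0) orbF => /eqP.
have /choice[va hva] Q : exists v, Q \in B ->
    rv Q (fun R => a R * phi R ^+ 2) v /\ (v = 0 <-> form_zero w Q).
  have [/pole[v hv zv]|_] := boolP (Q \in B); [by exists v|by exists 0].
have [_ zy] := hva y yB; apply/zy.
apply: (form_at_poles C_uncountable char0 phi_reg phi_pole B_neq0 _ ra (y' := y')) => [|Q c QB rQ|Q /hva[] //].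
  case: By => [BE|[BE zy']]; [by left|right; split=> //].
  by have [|_ ->] := hva y'; rewrite // BE !inE eqxx orbT.
(* If phi - c has order k + 1 at [Q], its derivative has order k, so (phi - c) / d phi vanishes at
   [Q]. *)
have [E [e [N [t fr]]]] := frame_exists Q; have [dE Ec NQ ut [d d0 rd]] := fr.
have rfc : rv Q (fun R => phi R - c) 0 by rewrite -(subrr c); exact: rvB rQ (rv_cst Q c).
have [|k [g [g0 [rg g00 fE]]]] := finite_order ut rfc.
  by move=> h; apply: (@phi_nonconstant c); apply: aeS h => R /eqP; rewrite subr_eq0 => /eqP.
case: k fE => [|k] fE.
  case/eqP: g00; apply: (rv_uniq rg); apply: rv_ae rfc.
  by apply: aeS fE => R ->; rewrite mul1r.
have [u [ru uE]] := der_order dE NQ ut.1 rd rg fE.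
have /pcharf0P pc := char0.
have u0 : k.+1%:R * g0 * d != 0 by rewrite !mulf_neq0 // pc.
have h := rvM0 ut.1 (rvM rg (rvM (form_rv dE Ec NQ rw) (rvV ru u0))).
apply: rv_ae h; apply: ae3 (aeI uE (der_subC c dE Ec rQ)) (aeI fE (aE _ _ _ _ _ fr))
  (aeI (rv_neq0 ru u0) (uniformizer_neq0 ut)) _ => R [e1 e2] [-> ->] [uR tR].
rewrite -e2 e1 exprS; have : t R ^+ k != 0 by rewrite expf_neq0.
by move: (t R ^+ k) => T T0; field; rewrite T0 uR.
Qed.

End FormAtPoles.

(** * Divisors *)

Section Orders.
Variables (C : closedFieldType) (X : curve C).
Implicit Types (P Q R : pt X) (f g t : pt X -> C) (c : C).

Lemma vanishes_regular P k f : vanishes_to P k f -> regular_at P f.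
Proof.
elim: k f => [//|k IH] f /= [m [a [b [ra vb /eq_near_ae[e1 e2]]]]].
apply: rv_regular_at; rewrite e2.
apply: rv_ae (rv_sum _ (fun i => rvM (regular_at_rv (ra i).1) (regular_at_rv (IH _ (vb i))))).
by apply: aeS e1 => R ->.
Qed.

Lemma vanishes_factor P t k f : uniformizer P t -> vanishes_to P k f ->
  exists2 g, reg P g & ae (fun R => f R = t R ^+ k * g R).
Proof.
move=> [rt ut]; elim: k f => [|k IH] f /=.
  by move=> /regular_at_rv rf; exists f; [exists (f P)|apply: aeT => R; rewrite mul1r].
move=> [m [a [b [ra vb /eq_near_ae[fE _]]]]].
have /choice[al hal] i : exists al, reg P al /\ ae (fun R => a i R = t R * al R).
  have [rai ai0] := ra i; have [|al h1 h2] := ut (a i); last by exists al.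
  by rewrite -ai0; exact: regular_at_rv.
have /choice[be hbe] i : exists be, reg P be /\ ae (fun R => b i R = t R ^+ k * be R).
  by have [be h1 h2] := IH _ (vb i); exists be.
exists (fun R => \sum_i al i R * be i R).
  have /choice[c hc] i := (hal i).1; have /choice[d hd] i := (hbe i).1.
  by exists (\sum_i c i * d i); apply: rv_sum => i; exact: rvM.
apply: ae3 fE (ae_fin (fun i => (hal i).2)) (ae_fin (fun i => (hbe i).2)) _ => R -> e1 e2.
by rewrite big_distrr; apply: eq_bigr => i _ /=; rewrite e1 e2 exprS; ring.
Qed.

Lemma factor_vanishes P t k f g : uniformizer P t -> regular_at P f -> reg P g ->
  ae (fun R => f R = t R ^+ k * g R) -> vanishes_to P k f.
Proof.
move=> [rt _]; elim: k f => [|k IH] f rf rg fE //=.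
have regular_rep h c : rv P h c -> exists h', [/\ regular_at P h', h' P = c & ae (fun R => h' R = h R)].
  move=> rh; have [h' rh' hE] := rv_regular rh; exists h'; split=> //.
  apply: (rv_uniq (regular_at_rv rh')); apply: rv_ae rh.
  by apply: aeS hE => R ->.
have [t' [rt' t'P tE]] := regular_rep _ _ rt.
have [d rd] := rg; have [h [rh _ hE]] := regular_rep _ _ (rvM (rvX k rt) rd).
exists 1%N, (fun _ => t'), (fun _ => h); split=> // [_|].
  exact: (IH h).
have rf' := regular_at_rv rf; have e : ae (fun R => f R = \sum_(i < 1) t' R * h R).
  by apply: ae3 fE tE hE _ => R -> -> ->; rewrite big_ord1 exprS mulrA.
apply: (ae_eq_near e); rewrite big_ord1 t'P mul0r.
apply: (rv_uniq rf'); rewrite -(mul0r (h P)) -t'P.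
apply: rv_ae (rvM (regular_at_rv rt') (regular_at_rv rh)).
by apply: aeS e => R ->; rewrite big_ord1.
Qed.

(** Quantified over all parameters, so that it can be used with u - u(P) where that is one and with
    the parameter of a frame elsewhere. *)
Definition ord_at P f (z : int) : Prop := forall t, uniformizer P t ->
  exists e e0, [/\ rv P e e0, e0 != 0 & ae (fun R => f R = t R ^ z * e R)].

Lemma order_ord P f k : order_at P f k -> ord_at P f k%:Z.
Proof.
move=> [vf nvf] t ut; have [g rg fE] := vanishes_factor ut vf.
have rf := vanishes_regular vf.
have [|j [e [e0 [re e00 fE']]]] := finite_order ut (regular_at_rv rf).
  move=> f0; apply: nvf; apply: (factor_vanishes (t := t) (g := fun=> 0)) => //.
    by exists 0; exact: rv_cst.
  by apply: aeS f0 => R ->; rewrite mulr0.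
have tn := uniformizer_neq0 ut.
have [jk|kj|jk] := ltngtP j k; last by exists e, e0; rewrite -jk.
- case/eqP: e00; have [d rd] := rg; apply: (rv_uniq re).
  have h : rv P (fun R => t R ^+ (k - j) * g R) 0.
    apply: (rvM0 _ rd); have := rvX (k - j) ut.1.
    by rewrite expr0n subn_eq0 leqNgt jk.
  apply: rv_ae h; apply: ae3 tn fE fE' _ => R tR e1 e2.
  apply: (mulfI (expf_neq0 j tR)); rewrite -e2 e1 mulrA -exprD subnKC //.
  exact: ltnW.
- case: nvf; have [d rd] : reg P (fun R => t R ^+ (j - k.+1) * e R).
    by exists (0 ^+ (j - k.+1) * e0); apply: (rvM (rvX _ ut.1) re).
  apply: (factor_vanishes ut rf (ex_intro _ d rd)).
  by apply: aeS fE' => R ->; rewrite mulrA -exprD subnKC.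
Qed.

Lemma ord_ae P f g z : ae (fun R => f R = g R) -> ord_at P f z -> ord_at P g z.
Proof.
move=> fg h t ut; have [e [e0 [re e00 fE]]] := h t ut; exists e, e0; split=> //.
by apply: ae2 fg fE _ => R <-.
Qed.

Lemma ordM P f g z z' : ord_at P f z -> ord_at P g z' ->
  ord_at P (fun R => f R * g R) (z + z').
Proof.
move=> hf hg t ut; have [e [e0 [re e00 fE]]] := hf t ut.
have [e' [e0' [re' e00' gE]]] := hg t ut.
exists (fun R => e R * e' R), (e0 * e0'); split; [exact: rvM|by rewrite mulf_neq0|].
by apply: ae3 fE gE (uniformizer_neq0 ut) _ => R -> -> tR; rewrite expfzDr //; ring.
Qed.

Lemma ordV P f z : ord_at P f z -> ord_at P (fun R => (f R)^-1) (- z).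
Proof.
move=> hf t ut; have [e [e0 [re e00 fE]]] := hf t ut.
exists (fun R => (e R)^-1), e0^-1; split; [exact: rvV|by rewrite invr_eq0|].
by apply: aeS fE => R ->; rewrite invfM invr_expz.
Qed.

Lemma is_div_ord f (D : divisor X) P : is_div f D -> ord_at P f (coeff P D).
Proof.
move=> /(_ P)[a [b [k [l [oa ob [U [oU [Q UQ] fE]] ->]]]]].
have h := ordM (order_ord oa) (ordV (order_ord ob)).
move=> t ut; apply: (ord_ae _ h ut).
have [e [e0 [re e00 bE]]] := order_ord ob ut.
apply: ae3 (zopen_ae oU UQ) (aeI bE (rv_neq0 re e00)) (uniformizer_neq0 ut) _ => R UR [bR eR] tR.
have bn : b R != 0 by rewrite bR mulf_neq0 // expfz_neq0.
by rewrite -(fE R UR) mulfK.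
Qed.

Lemma prin_function (D : divisor X) : prin D -> exists f, forall P, ord_at P f (coeff P D).
Proof.
have ord1 P : ord_at P (fun=> 1) 0.
  move=> t ut; exists (fun=> 1), 1; split; [exact: rv_cst|exact: oner_neq0|].
  by apply: aeT => R; rewrite mul1r.
have sumE (s : seq (divisor X)) : (forall E, E \in s -> principal E) ->
    exists f, forall P, ord_at P f (coeff P (\sum_(E <- s) E)).
  elim: s => [|E s IH] hs.
    by exists (fun=> 1) => P; rewrite big_nil coeff0; exact: ord1.
  have [f hf] := hs E (mem_head _ _).
  have [|g hg] := IH; first by move=> E' E's; apply: hs; rewrite in_cons E's orbT.
  exists (fun R => f R * g R) => P; rewrite big_cons coeffD.
  exact: (ordM (@is_div_ord f E P hf) (hg P)).
move=> [s [s' [/sumE[f hf] /sumE[g hg] ->]]].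
exists (fun R => f R * (g R)^-1) => P; rewrite coeffB.
exact: ordM (hf P) (ordV (hg P)).
Qed.

End Orders.

(** * Logarithmic derivatives *)

Section CoefficientDerivation.
Variables (C : closedFieldType) (X : curve C).
Local Notation form := {mpoly C[(ambient X).+1]}.
Implicit Types (P Q R : pt X) (f t u : pt X -> C) (F H : form).

Definition leibniz (D : C -> C) := forall x y, D (x * y) = x * D y + D x * y.

Section Rules.
Variables (D : {additive C -> C}) (DM : leibniz D).

Lemma leibniz1 : D 1 = 0.
Proof. by apply: (addrI (D 1)); have := DM 1 1; rewrite !mul1r mulr1 addr0 => <-. Qed.

Lemma map_leibniz F H : map_mpoly D (F * H) = map_mpoly D F * H + F * map_mpoly D H.
Proof.
apply/mpolyP => k; rewrite mcoeff_map_mpoly mcoeffD !mcoeffM raddf_sum -big_split.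
by apply: eq_bigr => i _ /=; rewrite DM !mcoeff_map_mpoly addrC.
Qed.

Lemma map_killed F : (forall k, D F@_k = 0) -> map_mpoly D F = 0.
Proof. by move=> h; apply/mpolyP => k; rewrite mcoeff_map_mpoly h mcoeff0. Qed.

Lemma map_meval F (v : 'I_(ambient X).+1 -> C) : (forall i, D (v i) = 0) ->
  D F.@[v] = (map_mpoly D F).@[v].
Proof.
move=> Dv; elim/mpoly_ind: F => [c|i|F H hF hH|F H hF hH].
- by rewrite map_mpolyC !mevalC.
- rewrite mevalXU Dv map_killed ?meval0 // => k; rewrite mcoeffX.
  by case: (_ == _); rewrite ?raddf0 ?leibniz1.
- by rewrite mevalD [LHS]raddfD [map_mpoly D _]raddfD /= mevalD hF hH.
- by rewrite mevalM map_leibniz DM mevalD !mevalM hF hH addrC.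
Qed.

Lemma map_homog F d : F \is d.-homog -> map_mpoly D F \is d.-homog.
Proof.
move=> /dhomogP hF; apply/dhomogP => k; rewrite mcoeff_msupp mcoeff_map_mpoly => Dk.
apply: hF; rewrite mcoeff_msupp; apply: contraNneq Dk => ->.
by rewrite raddf0.
Qed.

End Rules.

Definition coefs F : seq C := [seq F@_k | k <- msupp F].

Lemma map_coefs (D : {additive C -> C}) F : (forall c, c \in coefs F -> D c = 0) ->
  map_mpoly D F = 0.
Proof.
move=> h; apply: map_killed => k; have [kF|kF] := boolP (k \in msupp F).
  by apply: h; exact: map_f.
by rewrite memN_msupp_eq0 // raddf0.
Qed.

(* [S] generates a field of definition of [X]. *)
Lemma curve_constants : exists S : seq C, forall D : {additive C -> C}, leibniz D ->
  (forall c, c \in S -> D c = 0) -> @graded_derivation C X (map_mpoly D) 0 1.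
Proof.
have [s sI sG] := noetherian_fg [set F : form | forall Q : pt X, ev F Q = 0]
  (@noetherian_mpoly C (ambient X).+1).
exists (flatten (map coefs s)) => D DM DS; split.
- by move=> F H; rewrite raddfD.
- exact: map_leibniz.
- by move=> d F hF; rewrite addn0; exact: map_homog.
- exact: dhomog1.
move=> d F _ /sG[a ->] Q; rewrite [map_mpoly D _]raddf_sum meval_sum big1 // => i _.
have si : s`_i \in s by rewrite mem_nth.
rewrite /= map_leibniz // [X in _ + _ * X]map_coefs ?mulr0 ?addr0.
  by rewrite mevalM (sI _ si Q) mulr0.
move=> c ci; apply: DS; apply/flattenP; exists (coefs s`_i) => //.
exact: map_f.
Qed.

Section Log.
Variables (D : {additive C -> C}) (DM : leibniz D).
Hypothesis dE : @graded_derivation C X (map_mpoly D) 0 1.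
Local Notation dd := (der (map_mpoly D) (1 : form)).

Lemma ev1 Q : ev (1 : form) Q = 1.
Proof. by rewrite meval1. Qed.

Lemma ev1_neq0 Q : ev (1 : form) Q != 0.
Proof. by rewrite ev1 oner_neq0. Qed.

Lemma der_const c : ae (fun R => dd (fun=> c) R = D c).
Proof.
have [Q _] := ae_ex (@aeT C X setT (fun=> I)).
have h : represents (fun=> c) (c%:MP : form, 1 : form).
  split; [by exists 0%N; [by rewrite -[c]mulr1 mpolyCM mpolyC1 mul_mpolyC dhomogZ // dhomog1|exact: dhomog1]|by exists Q; exact: ev1_neq0|].
  by apply: aeT => R; rewrite /= ev1 mevalC divr1.
apply: aeS (der_represents dE h) => R ->.
have E1 : map_mpoly D (1 : form) = 0 by rewrite -mpolyC1 map_mpolyC leibniz1 // mpolyC0.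
by rewrite /quot_rule E1 map_mpolyC !mevalC mulr0 subr0 mulr1 expr1n !divr1.
Qed.

Definition dlog f R := dd f R / f R.

Lemma dlogM Q f g c d : rv Q f c -> rv Q g d -> ae (fun R => f R != 0) -> ae (fun R => g R != 0) ->
  ae (fun R => dlog (fun R => f R * g R) R = dlog f R + dlog g R).
Proof.
move=> rf rg f0 g0; apply: ae3 (derivM dE rf rg) f0 g0 _ => R e fR gR.
rewrite /dlog e; move: (dd f R) (dd g R) (f R) (g R) fR gR => a b x y x0 y0.
by field; rewrite x0 y0.
Qed.

Lemma dlog_ae f g : ae (fun R => f R = g R) -> ae (fun R => dlog f R = dlog g R).
Proof. by move=> h; apply: ae2 h (der_ae dE h) _ => R e1 e2; rewrite /dlog e1 e2. Qed.

Lemma dlogX Q f c k : rv Q f c -> ae (fun R => f R != 0) ->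
  ae (fun R => dlog (fun R => f R ^+ k) R = k%:R * dlog f R).
Proof.
move=> rf f0; elim: k => [|k IH].
  by apply: aeS (der_const 1) => R; rewrite /dlog => ->; rewrite leibniz1 // !mul0r.
have fk0 : ae (fun R => f R ^+ k != 0) by apply: aeS f0 => R; exact: expf_neq0.
apply: ae3 IH (dlogM rf (rvX k rf) f0 fk0) (dlog_ae (aeT (fun R => exprS (f R) k))) _ => R e1 e2 ->.
by rewrite e2 e1 -natr1; ring.
Qed.

Lemma dlog_ord f t e Q (e0 : C) z : uniformizer Q t -> rv Q e e0 -> e0 != 0 ->
  ae (fun R => f R = t R ^ z * e R) -> ae (fun R => dlog f R = z%:~R * dlog t R + dlog e R).
Proof.
move=> ut re e00 fE; have tn := uniformizer_neq0 ut; have en := rv_neq0 re e00.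
case: z fE => k fE.
  have tk : ae (fun R => t R ^+ k != 0) by apply: aeS tn => R; exact: expf_neq0.
  by apply: ae3 (dlog_ae fE) (dlogM (rvX k ut.1) re tk en) (dlogX k ut.1 tn) _ => R -> -> ->.
have tk : ae (fun R => t R ^+ k.+1 != 0) by apply: aeS tn => R; exact: expf_neq0.
have fn : ae (fun R => f R != 0).
  by apply: ae3 fE en tk _ => R -> n1 n2; rewrite mulf_neq0 // invr_eq0.
have eE : ae (fun R => f R * t R ^+ k.+1 = e R).
  by apply: ae2 fE tk _ => R -> n; rewrite mulrAC NegzE -invr_expz mulVf // mul1r.
have [Q0 [rt [re' [tQ eQ]]]] := ae_ex (aeI (rv_reg ut.1) (aeI (rv_reg re) (aeI tk en))).
have rf : rv Q0 f (e Q0 * (t Q0 ^+ k.+1)^-1).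
  apply: rv_ae (rvM re' (rvV (rvX k.+1 rt) tQ)).
  by apply: ae2 eE tk _ => R <- n; rewrite mulfK.
apply: ae3 (dlog_ae eE) (dlogM rf (rvX k.+1 rt) fn tk) (dlogX k.+1 rt tn) _ => R <- -> ->.
by rewrite NegzE mulrNz; ring.
Qed.

Lemma rv_dlog Q e e0 : rv Q e e0 -> e0 != 0 -> reg Q (dlog e).
Proof.
move=> re e00; have [d rd] := der_rv dE re (ev1_neq0 Q).
by exists (d * e0^-1); apply: rvM rd (rvV re e00).
Qed.

(** When [D] kills the coordinates of [Q], applying it to coefficients commutes with evaluation at
    [Q]; the maximal ideal is preserved, and logarithmic derivatives acquire no pole at [Q]. *)
Lemma der_rational Q t : (forall i, D (Defs.coord (val Q) i) = 0) -> rv Q t 0 -> rv Q (dd t) 0.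
Proof.
move=> DQ [d [F [H [hF hH HQ tQ tE]]]].
have := der_form dE hF hH HQ tE (ev1_neq0 Q).
suff -> : quot_rule (map_mpoly D) 1 F H Q = 0 by [].
have FQ : ev F Q = 0.
  by move/esym/eqP: tQ; rewrite mulf_eq0 invr_eq0 (negPf HQ) orbF => /eqP.
by rewrite /quot_rule -map_meval // FQ raddf0 !mul0r subr0 !mul0r.
Qed.

End Log.

(** [S] precedes [t0] and [f]: the value t0 = u(P) can then be chosen transcendental over [S],
    although [f] depends on P. The coordinates of [Qs] are put into [S] so that zeros and poles of
    [f] there do no harm. *)
Lemma log_derivative u F H (Qs : seq (pt X)) : [pchar C] =i pred0 -> represents u (F, H) ->
  exists S : seq C, forall t0 : C, ~ algebraic_over S t0 ->
  forall f (n : pt X -> int), (forall R, ord_at R f (n R)) -> exists h : pt X -> C,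
    (forall R, uniformizer R (fun R' => u R' - t0) ->
       rv R (fun R' => (u R' - t0) * h R') (- (n R)%:~R)) /\
    (forall R, n R = 0 \/ R \in Qs -> reg R h).
Proof.
move=> char0 uFH; have [S0 hS0] := curve_constants.
pose cs (Q : pt X) := [seq Defs.coord (val Q) i | i <- enum 'I_(ambient X).+1].
pose S := S0 ++ coefs F ++ coefs H ++ flatten (map cs Qs).
exists S => t0 nt0 f n fn.
have [D0 [DD DM0 DS0 Dt0]] := derivation_over char0 nt0.
have D0B : zmod_morphism D0.
  by move=> x y; apply: (addIr (D0 y)); rewrite subrK -DD subrK.
pose D : {additive C -> C} := HB.pack D0 (GRing.isZmodMorphism.Build C C D0 D0B).
have DM : leibniz D by exact: DM0.
have DS c : c \in S -> D c = 0 by exact: DS0.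
have Dt : D t0 = 1 by exact: Dt0.
have dE : @graded_derivation C X (map_mpoly D) 0 1.
  by apply: hS0 => // c cS; apply: DS; rewrite mem_cat cS.
have EF : map_mpoly D F = 0.
  by apply: map_coefs => c cF; apply: DS; rewrite !mem_cat cF orbT.
have EH : map_mpoly D H = 0.
  by apply: map_coefs => c cF; apply: DS; rewrite !mem_cat cF !orbT.
have du : ae (fun R => der (map_mpoly D) (1 : form) u R = 0).
  apply: aeS (der_represents dE uFH) => R ->.
  by rewrite /quot_rule EF EH !meval0 mul0r mulr0 subr0 !mul0r.
have DQ Q : Q \in Qs -> forall i, D (Defs.coord (val Q) i) = 0.
  move=> QQs i; apply: DS; rewrite !mem_cat; do 3 (apply/orP; right).
  by apply/flattenP; exists (cs Q); [exact: map_f|apply: map_f; rewrite mem_enum].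
have dtau : ae (fun R => der (map_mpoly D) (1 : form) (fun R => u R - t0) R = -1).
  have [[d hF hH] [Q HQ] uE] := uFH.
  have ru : rv Q u (ev F Q / ev H Q) by exists d, F, H.
  apply: ae3 (derivD dE ru (rv_cst Q (- t0))) du (der_const DM dE (- t0)) _ => R -> -> ->.
  by rewrite add0r raddfN Dt.
exists (dlog D f); split=> [R ut|R nR].
  have [e [e0 [re e00 fE]]] := fn R _ ut; have [d rd] := rv_dlog dE re e00.
  have h := rvD (rv_cst R (- (n R)%:~R)) (rvM ut.1 rd); rewrite mul0r addr0 in h.
  apply: rv_ae h.
  apply: ae3 (dlog_ord DM dE ut re e00 fE) dtau (uniformizer_neq0 ut) _ => R' -> e1 n1.
  rewrite {2}/dlog e1; move: (u R' - t0) (dlog D e R') (_%:~R) n1 => x y z x0.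
  by field.
have [E [e1 [N [t [_ _ _ ut _]]]]] := frame_exists R.
have [e [e0 [re e00 fE]]] := fn R _ ut; have [d rd] := rv_dlog dE re e00.
case: nR => [nR|/DQ RQ].
  exists d; apply: rv_ae rd; apply: aeS (dlog_ord DM dE ut re e00 fE) => R' ->.
  by rewrite nR mul0r add0r.
have [g [c rg] gE] := ut.2 _ (der_rational DM dE RQ ut.1).
exists ((n R)%:~R * c + d); apply: rv_ae (rvD (rvZ (n R)%:~R rg) rd).
apply: ae3 (dlog_ord DM dE ut re e00 fE) gE (uniformizer_neq0 ut) _ => R' -> e2 n1.
by rewrite {2}/dlog e2 [t R' * _]mulrC mulfK.
Qed.

End CoefficientDerivation.

(** * The quotient curve *)

Section Pullback.
Variables (C : closedFieldType) (X Y : curve C) (k : pt X -> pt Y).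
Hypothesis kr : regular_map k.
Hypothesis kfin : forall A, ae A -> ae (fun R => A (k R)).

Lemma rv_pullback R f c : rv (k R) f c -> rv R (fun R' => f (k R')) c.
Proof.
move=> [d [F [H [hF hH HR -> fE]]]].
pose f1 (Q : pt Y) := ev F Q / ev H Q; pose V : set (pt Y) := fun Q => ev H Q != 0.
have oV : zopen V by exact: (@zopen_form _ Y d H).
have rV : regular_on V f1 by apply: regular_on_rv => Q VQ; exact: (rv_form hF hH VQ).
have [oU hU] := kr oV.
have rU : rv R (f1 \o k) (f1 (k R)) by exact: regular_on_rvE (hU f1 rV) R HR.
apply: rv_ae rU; have := kfin fE; apply: aeS => R' /= ->.
by [].
Qed.

End Pullback.

Lemma nonconstant_unramified (C : closedFieldType) (X : curve C) (Q : pt X) f c :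
  [pchar C] =i pred0 -> rv Q f c -> ~ ae (fun R => f R = c) ->
  ae (fun P => uniformizer P (fun R => f R - f P)).
Proof.
move=> char0 rf fc; have [E [e [N [t fr]]]] := frame_exists Q.
have [dE Ec NQ _ _] := fr; have [d rd] := der_rv dE rf NQ.
apply: ae3 (aeI (nonconstant_der char0 fr rf fc) (rv_reg rd)) (rv_reg rf)
  (ae_ev (gder_norm dE) NQ) _ => P [dP rdP] rP NP.
exact: unramified dE Ec NP rP rdP dP.
Qed.

Lemma separating_function (C : closedFieldType) (X : curve C) (P Q : pt X) : P <> Q ->
  exists f, [/\ rv P f (f P), rv Q f (f Q) & f P != f Q].
Proof.
move=> PQ.
have homU i : ('X_i : {mpoly C[(ambient X).+1]}) \is 1.-homog by rewrite dhomogX; apply/eqP; exact: mdeg1.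
have [i Pi] := coord_neq0 (val P); have [j Qj] := coord_neq0 (val Q).
have [c [HP HQ]] : exists c : C, ev ('X_i + c *: 'X_j) P != 0 /\ ev ('X_i + c *: 'X_j) Q != 0.
  pose pol (R : pt X) := (Defs.coord (val R) j)%:P * 'X + (Defs.coord (val R) i)%:P.
  have polE R c : (pol R).[c] = ev ('X_i + c *: 'X_j) R.
    by rewrite /pol !hornerE mevalD mevalZ !mevalXU addrC mulrC.
  have pn : pol P * pol Q != 0.
    rewrite mulf_neq0 //.
      by apply: contraNneq Pi => e; have := congr1 (coefp 0) e; rewrite /pol /= coefD coefMX !coefC /= add0r => ->.
    apply: contraNneq Qj => e; have := congr1 (coefp 1) e.
    by rewrite /pol /= coefD coefMX !coefC /= addr0 => ->.
  have [c] := closed_nonrootP _ pn.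
  rewrite /root hornerM mulf_eq0 negb_or !polE => /andP[h1 h2].
  by exists c.
set H := 'X_i + c *: 'X_j in HP HQ.
have hH : H \is 1.-homog by rewrite dhomogD // dhomogZ.
apply: contrapT => h; apply: PQ; apply: val_inj.
apply: (@coord_inj _ _ _ _ (ev H P / ev H Q)) => l.
have : ev 'X_l P / ev H P = ev 'X_l Q / ev H Q.
  apply/eqP; apply: contrapT => /negP ne; apply: h.
  by exists (fun R => ev 'X_l R / ev H R); split=> //; exact: rv_form.
rewrite !mevalXU => e; rewrite -[LHS](divfK HP) e -mulrA [RHS]mulrC.
by congr (_ * _); exact: mulrC.
Qed.

Section Quotient.
Variables (C : closedFieldType) (X Y : curve C) (gT : finGroupType) (G : {group gT}).
Variables (s : aut_group X G) (p : pt X -> pt Y).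
Hypothesis XGY : is_quotient s p.
Implicit Types (P R : pt X) (y : pt Y).

Lemma act_inj x : x \in G -> injective (s x).
Proof.
move=> Gx; apply: (can_inj (g := s x^-1%g)) => P.
by rewrite -aut_actM ?groupV // mulVg aut_act1.
Qed.

Lemma act_ae x (A : set (pt X)) : x \in G -> ae A -> ae (fun R => A (s x R)).
Proof.
move=> Gx; rewrite /ae => hA.
apply: (sub_finite_set (B := s x @^-1` (~` A))) => //.
by apply: finite_preimage hA => P Q _ _; exact: act_inj.
Qed.

Lemma rv_act x R f c : x \in G -> rv (s x R) f c -> rv R (fun R' => f (s x R')) c.
Proof.
move=> Gx; apply: rv_pullback; first exact: aut_act_regular.
by move=> A; exact: act_ae.
Qed.

Lemma quotient_act x R : x \in G -> p (s x R) = p R.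
Proof.
by case: XGY => _ _ fib _ _ Gx; apply/esym/(fib R (s x R)).2; exists x.
Qed.

Lemma quotient_ae (A : set (pt Y)) : ae A -> ae (fun R => A (p R)).
Proof.
have [_ psurj fib _ _] := XGY; have /choice[sg sgE] := psurj.
rewrite /ae => hA.
apply: (@sub_finite_set _ _ ((fun z : gT * pt Y => s z.1 (sg z.2)) @` ([set: gT] `*` ~` A))).
  move=> R nA; have [x Gx xR] := (fib (sg (p R)) R).1 (sgE (p R)).
  by exists (x, p R).
by apply: finite_image; apply: finite_setX.
Qed.

Lemma ae_quotient (A : set (pt Y)) : ae (fun R => A (p R)) -> ae A.
Proof.
have [_ psurj _ _ _] := XGY; rewrite /ae => hA.
apply: (@sub_finite_set _ _ (p @` (~` (fun R => A (p R))))); last exact: finite_image.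
by move=> y nA; have [R RE] := psurj y; exists R; rewrite // /setC /= RE.
Qed.

Lemma rv_quotient R f c : rv (p R) f c -> rv R (fun R' => f (p R')) c.
Proof. by apply: rv_pullback; [case: XGY|exact: quotient_ae]. Qed.

(** [is_quotient] descends regularity only over open sets and with actual values. Hence [f1],
    corrected at p(P), and the open set [V] of points whose whole fibre is good. *)
Lemma rv_descent P f c : rv P (fun R => f (p R)) c -> rv (p P) f c.
Proof.
have [_ psurj fib opn reg_iff] := XGY => rP.
pose V y := (forall R, p R = y -> rv R (fun R' => f (p R')) (f y)) \/ y = p P.
pose f1 y := if y == p P then c else f y.
have f1E : ae (fun y => f1 y = f y).
  by apply: aeS (ae_neq (p P)) => y /eqP h; rewrite /f1 (negPf h).
have orbit R : p R = p P -> rv R (fun R' => f (p R')) c.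
  move=> e; have [x Gx xR] := (fib R P).1 e; rewrite -xR in rP.
  apply: eq_rv (rv_act Gx rP) => R' /=.
  by rewrite quotient_act.
have aV : ae V.
  apply: ae_quotient; have h : ae (fun R => forall x, x \in G ->
      rv (s x R) (fun R' => f (p R')) (f (p (s x R)))).
    apply: (ae_fin (A := fun x R => x \in G -> _)) => x.
    have [Gx|] := boolP (x \in G); last by move=> _; apply: aeT.
    by apply: aeS (act_ae Gx (rv_reg rP)).
  apply: aeS h => R hR; left => R' e; have [x Gx <-] := (fib R R').1 (esym e).
  have := hR x Gx; rewrite quotient_act //.
have oV := ae_zopen aV.
have h : regular_on V f1.
  apply/reg_iff => //; apply: regular_on_rv => R VR.
  have fE : ae (fun R' => f (p R') = (f1 \o p) R') by apply: aeS (quotient_ae f1E) => R' <-.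
  apply: rv_ae fE _; rewrite /= /f1; have [e|ne] := eqVneq (p R) (p P); first exact: orbit.
  by case: VR => [|e]; [exact|rewrite e eqxx in ne].
have := regular_on_rvE oV h (or_intror erefl : V (p P)).
by rewrite {2}/f1 eqxx; apply: rv_ae.
Qed.

(** Each x other than 1 moves some point, by faithfulness. For a function f separating that point
    from its image, f o x - f is not 0, so it vanishes only on a finite set, which contains almost
    all fixed points of x. *)
Lemma free_ae : ae (fun R => forall x, x \in G -> s x R = R -> x = 1%g).
Proof.
apply: (ae_fin (A := fun x R => x \in G -> s x R = R -> x = 1%g)) => x.
have [Gx|nGx] := boolP (x \in G); last by apply: aeT.
have [->|x1] := eqVneq x 1%g; first exact: aeT.
have [R0 R0x] : exists R0, s x R0 <> R0.
  apply: contrapT => h; move/eqP: x1; apply; apply: (aut_act_faithful (a := s) Gx) => R.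
  by apply: contrapT => ne; apply: h; exists R.
have [f [r1 r2 ne]] := separating_function R0x.
have := rv_neq0 (rvB (rv_act Gx r1) r2); rewrite subr_eq0 => /(_ ne).
by apply: aeS => R /eqP nz _ e; case: nz; rewrite e subrr.
Qed.

Lemma rv_sum_in P (f : gT -> pt X -> C) (c : gT -> C) :
  (forall x, x \in G -> rv P (f x) (c x)) ->
  rv P (fun R => \sum_(x in G) f x R) (\sum_(x in G) c x).
Proof.
move=> h; rewrite big_mkcond; pose fG x R := if x \in G then f x R else 0.
pose cG x := if x \in G then c x else 0.
have hG x : rv P (fG x) (cG x).
  by rewrite /fG /cG; case: (boolP (x \in G)) => [/h|_] //; exact: rv_cst.
apply: eq_rv (rv_sum (index_enum gT) hG) => R.
by rewrite [RHS]big_mkcond.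
Qed.

(* [h] behaves like the logarithmic derivative, with respect to the parameter
   [t0 = u P], of a function with divisor [\sum_x a_x (x P - x Q)]. *)
Definition polar (a : gT -> C) (u : pt X -> C) P (h : pt X -> C) : Prop :=
  (forall R, p R <> p P -> reg R h) /\
  forall x, x \in G -> rv (s x P) (fun R => (u R - u P) * h R) (- a x).

Section Polar.
Variables (a : gT -> C) (w : pt Y -> C).
Local Notation u := (fun R : pt X => w (p R)).

(** [u] is constant on orbits, so u - u(P) passes through the translations. The second factor is a
    family in x because it is either another polar function or the constants a_x. *)
Lemma polar_sum P h (h' : gT -> pt X -> C) (v : gT -> C) : polar a u P h ->
  (forall x, x \in G -> rv (s x P) (h' x) (v x)) ->
  rv P (fun R => (u R - u P) * \sum_(x in G) h (s x R) * h' x (s x R)) (- \sum_(x in G) a x * v x).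
Proof.
move=> [_ hP] hv; rewrite -sumrN.
apply: eq_rv (rv_sum_in (f := fun x R => (u R - u P) * (h (s x R) * h' x (s x R))) _) => [R|x Gx].
  by rewrite mulr_sumr.
rewrite -mulNr; apply: eq_rv (rv_act Gx (rvM (hP x Gx) (hv x Gx))) => R.
by rewrite quotient_act // mulrA.
Qed.

Lemma product_descends (h h' : pt X -> C) : exists phi : pt Y -> C, forall R,
  phi (p R) = \sum_(x in G) h (s x R) * h' (s x R).
Proof.
have [_ psurj fib _ _] := XGY; have /choice[sg sgE] := psurj.
exists (fun y => \sum_(x in G) h (s x (sg y)) * h' (s x (sg y))) => R.
have [z Gz <-] := (fib (sg (p R)) R).1 (sgE (p R)).
rewrite [RHS](reindex_inj (mulIg z^-1%g)) /=; apply: eq_big => [x|x Gx].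
  by rewrite groupMr ?groupV.
rewrite quotient_act // sgE; rewrite -aut_actM ?groupM ?groupV //.
by rewrite mulgKV.
Qed.

Hypothesis char0 : [pchar C] =i pred0.
Hypothesis C_uncountable : ~ countable [set: C].
Variables (form : diff_form Y) (P P' : pt X) (h h' : pt X -> C).
Hypothesis form_reg : regular_form form.
Hypotheses (hP : polar a u P h) (hP' : polar a u P' h').
Hypothesis PP' : p P <> p P'.
Hypothesis wP : uniformizer (p P) (fun y => w y - w (p P)).
Hypothesis wP' : uniformizer (p P') (fun y => w y - w (p P')).
Hypothesis h'P : forall x, x \in G -> rv (s x P) h' (h' (s x P)).
Hypothesis residue_neq0 : \sum_(x in G) a x * h' (s x P) != 0.

Lemma polar_form : form_zero form (p P') -> form_zero form (p P).
Proof.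
move=> zP'; have [phi phiE] := product_descends h h'.
have regX R : p R <> p P -> p R <> p P' -> reg (p R) phi.
  move=> n1 n2.
  have /choice[c hc] x : exists c, x \in G -> rv (s x R) (fun R' => h R' * h' R') c.
    have [Gx|] := boolP (x \in G); last by exists 0.
    have [|c1 r1] := hP.1 (s x R); first by rewrite quotient_act.
    have [|c2 r2] := hP'.1 (s x R); first by rewrite quotient_act.
    by exists (c1 * c2) => _; exact: rvM.
  exists (\sum_(x in G) c x); apply: rv_descent.
  apply: eq_rv (rv_sum_in (f := fun x R' => h (s x R') * h' (s x R')) _) => [R'|x Gx].
    by rewrite phiE.
  exact: rv_act Gx (hc x Gx).
have /choice[v hv] x : exists c, x \in G -> rv (s x P') h c.
  have [Gx|] := boolP (x \in G); last by exists 0.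
  have [|c1 r1] := hP.1 (s x P'); last by exists c1.
  by rewrite quotient_act // => e; apply: PP'.
pose r := - \sum_(x in G) a x * h' (s x P).
pose r' := - \sum_(x in G) a x * v x.
have rP : rv (p P) (fun y => (w y - w (p P)) * phi y) r.
  apply: rv_descent; have := polar_sum (h' := fun _ => h') hP h'P.
  by apply: eq_rv => R; rewrite phiE.
have rP' : rv (p P') (fun y => (w y - w (p P')) * phi y) r'.
  apply: rv_descent; have := polar_sum (h' := fun _ => h) hP' hv.
  by apply: eq_rv => R; rewrite phiE; congr (_ * _); apply: eq_bigr => x _; exact: mulrC.
have pole y c : uniformizer y (fun y' => w y' - w y) ->
    rv y (fun y' => (w y' - w y) * phi y') c -> c != 0 -> uniformizer y (fun y' => (phi y')^-1).
  move=> uy ry c0; apply: (uniformizer_mul uy (rvV ry c0)); first by rewrite invr_eq0.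
  by apply: aeS (uniformizer_neq0 uy) => y' n; rewrite invfM mulrA divff // mul1r.
have psurj y : exists R, p R = y by case: XGY.
have r0 : r != 0 by rewrite oppr_eq0.
(* The coefficient [r'] at p(P') is not controlled; if it is 0, then [phi] is regular there and p(P)
   is its only pole. *)
have [r'0|r'0] := eqVneq r' 0.
  apply: (@form_vanishes _ _ C_uncountable char0 phi [:: p P] _ _ _ _ form_reg _ (p P')) => [y|y||].
  - have [R <-] := psurj y; rewrite inE => /eqP n.
    have [e|/eqP n'] := eqVneq (p R) (p P'); last exact: regX.
    rewrite e; rewrite r'0 in rP'; have [g rg gE] := wP'.2 _ rP'.
    have [c rc] := rg; exists c; apply: rv_ae rc.
    apply: ae2 gE (uniformizer_neq0 wP') _ => y' e' n'.
    by apply: (mulfI n').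
  - by rewrite inE => /eqP ->; exact: pole wP rP r0.
  - by exists (p P); rewrite inE.
  - by left.
apply: (@form_vanishes _ _ C_uncountable char0 phi [:: p P; p P'] _ _ _ _ form_reg _ (p P')) => [y|y||].
- have [R <-] := psurj y; rewrite !inE negb_or => /andP[/eqP n /eqP n'].
  exact: regX.
- rewrite !inE => /orP[] /eqP ->; [exact: pole wP rP r0|exact: pole wP' rP' r'0].
- by exists (p P); rewrite inE eqxx.
- by right.
Qed.

End Polar.

End Quotient.

(** * The action on the Jacobian *)

Section Faithful.
Variables (C : closedFieldType) (X Y : curve C) (gT : finGroupType) (G : {group gT}).
Variables (s : aut_group X G) (p : pt X -> pt Y).
Hypothesis XGY : is_quotient s p.
Hypothesis char0 : [pchar C] =i pred0.
Hypothesis C_uncountable : ~ countable [set: C].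
Implicit Types (P Q R : pt X) (y : pt Y) (a : gT -> int).

Lemma intr_eq0_char0 (z : int) : (z%:~R == 0 :> C) = (z == 0).
Proof.
have /pcharf0P pc := char0; case: z => k; first by rewrite pc.
by rewrite NegzE mulrNz oppr_eq0 pc.
Qed.

Lemma coeff_push_ring a (D : div0 X) R :
  coeff R (val (push_ring s a D)) = \sum_(x in G) coeff (s x^-1%g R) (val D) * a x.
Proof.
rewrite /push_ring !raddf_sum; apply: eq_bigr => x Gx /=.
rewrite -(@coeff_push _ _ (s x) (s x^-1%g)) => [|P|P].
- rewrite -[LHS]/(coeff R (val (push0 (s x) D *~ a x))) !raddfMz /=.
  by rewrite -mulrzr intz.
- by rewrite -aut_actM ?groupV // mulVg aut_act1.
- by rewrite -aut_actM ?groupV // mulgV aut_act1.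
Qed.

Section Pencil.
Variables (F0 F1 : {mpoly C[(ambient Y).+1]}).
Hypotheses (hF0 : F0 \is 1.-homog) (hF1 : F1 \is 1.-homog).
Hypothesis pencil : forall c, exists y, ev F0 y != 0 /\ ev F1 y / ev F0 y = c.

Definition pencil_function (y : pt Y) : C := ev F1 y / ev F0 y.
Local Notation w := pencil_function.
Local Notation u := (fun R : pt X => w (p R)).

Lemma pencil_nonconstant c : ~ ae (fun y => w y = c).
Proof.
move=> wc; have [y [F0y yc]] := pencil (c + 1).
have hF : F1 - c *: F0 \is 1.-homog by apply: rpredB; rewrite // dhomogZ.
have : ev (F1 - c *: F0) y = 0.
  apply: (@ae_ev0 _ Y _ _ _ hF); apply: ae2 wc (ae_ev hF0 F0y) _ => R <- n.
  by rewrite mevalB mevalZ divfK // subrr.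
rewrite mevalB mevalZ => /eqP; rewrite subr_eq0 => /eqP e.
move: yc; rewrite e mulfK // => /eqP; rewrite -subr_eq0 opprD addrA subrr sub0r oppr_eq0.
by rewrite oner_eq0.
Qed.

(** [u] takes every value of [C], whereas [T] and the finite complement of [A] exclude only
    countably many. *)
Lemma generic_point (A : set (pt X)) (T : set C) : ae A -> countable T ->
  exists P, A P /\ ~ T (u P).
Proof.
move=> hA hT; apply: contrapT => h; apply: C_uncountable.
apply: (@sub_countable _ _ _ (T `|` u @` (~` A))).
  apply: subset_card_le => c _; have [y [_ yc]] := pencil c.
  have [_ psurj _ _ _] := XGY; have [R Ry] := psurj y.
  have uR : u R = c by rewrite /= Ry.
  have [AR|nAR] := pselect (A R); last by right; exists R.
  by left; apply: contrapT => nT; apply: h; exists R; rewrite uR.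
rewrite (_ : _ `|` _ = \bigcup_(b in [set: bool]) if b then T else u @` (~` A)).
  apply: bigcup_countable => // -[] _ //; apply: finite_set_countable.
  exact: finite_image.
apply/seteqP; split=> [c [Tc|Tc]|c [[] _ Tc]]; by [exists true|exists false|left|right].
Qed.

Definition generic (P : pt X) : Prop :=
  [/\ forall x, x \in G -> uniformizer (s x P) (fun R => u R - u P),
      uniformizer (p P) (fun y => w y - w (p P)) &
      forall x, x \in G -> s x P = P -> x = 1%g].

Lemma pencil_rv : exists y, rv y w (w y).
Proof.
have [y [F0y _]] := pencil 0; exists y.
exact: rv_form hF1 hF0 F0y.
Qed.

Lemma generic_ae : ae generic.
Proof.
have [y ry] := pencil_rv; have [_ psurj _ _ _] := XGY; have [R0 Ry] := psurj y.
have rR0 : rv R0 u (w y) by apply: (rv_quotient XGY); rewrite Ry.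
have uU := nonconstant_unramified char0 rR0 (fun h => pencil_nonconstant (ae_quotient XGY h)).
have wU := nonconstant_unramified char0 ry (@pencil_nonconstant _).
have h : ae (fun P => forall x, x \in G -> uniformizer (s x P) (fun R => u R - u P)).
  apply: (ae_fin (A := fun x P => x \in G -> uniformizer (s x P) (fun R => u R - u P))) => x.
  have [Gx|_] := boolP (x \in G); last by apply: aeT.
  apply: aeS (act_ae s Gx uU) => R hR _; move: hR.
  by rewrite (quotient_act XGY).
by apply: ae3 h (quotient_ae XGY wU) (free_ae s) _.
Qed.

(** [S] depends on [Q] but not on P. The base point gives P - Q degree 0, and its orbit is passed to
    [log_derivative] as the list of constant points. *)
Lemma polar_exists a Q : (forall D : div0 X, prin (val (push_ring s a D))) ->
  exists S : seq C, forall P, generic P -> p P <> p Q -> ~ algebraic_over S (u P) ->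
    exists h, polar s p (fun x => (a x)%:~R) u P h.
Proof.
move=> aJ; have [y ry] := pencil_rv; have [_ psurj _ _ _] := XGY; have [R0 Ry] := psurj y.
have rR0 : rv R0 u (w y) by apply: (rv_quotient XGY); rewrite Ry.
have [[F H] uFH] := rv_represents rR0.
have [S hS] := log_derivative [seq s x Q | x <- enum G] char0 uFH.
exists S => P [tP _ freeP] PQ uP.
pose D : divisor X := << P >> - << Q >>.
have D0 : degree0 D by rewrite /degree0 degB !degU subrr.
have [f hf] := prin_function (aJ (Sub D D0)).
have [h [h1 h2]] := hS _ uP _ _ hf.
have coefE R : coeff R (val (push_ring s a (Sub D D0 : div0 X))) =
    \sum_(x in G) ((s x P == R)%:R - (s x Q == R)%:R) * a x.
  rewrite coeff_push_ring; apply: eq_bigr => x Gx; congr (_ * _).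
  rewrite SubK coeffB !coeffU !mul1r.
  have e (P1 : pt X) : (P1 == s x^-1%g R) = (s x P1 == R).
    apply/eqP/eqP => [->|<-]; first by rewrite -aut_actM ?groupV // mulgV aut_act1.
    by rewrite -aut_actM ?groupV // mulVg aut_act1.
  by rewrite !e.
exists h; split=> [R RP|x Gx].
  apply: h2; have [RQ|RQ] := boolP (R \in [seq s x Q | x <- enum G]); [by right|left].
  rewrite coefE big1 // => x Gx.
  have -> : (s x P == R) = false.
    by apply/negP => /eqP e; apply: RP; rewrite -e (quotient_act XGY).
  have -> : (s x Q == R) = false; last by rewrite subrr mul0r.
  by apply: contraNF RQ => /eqP <-; apply/mapP; exists x; rewrite ?mem_enum.
(* The coefficient at xP is a single [a x], since the orbit of P is free and disjoint from that of
   [Q]. *)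
suff <- : coeff (s x P) (val (push_ring s a (Sub D D0 : div0 X))) = a x by exact: h1 (tP x Gx).
rewrite coefE (bigD1 x) //= big1 => [|z /andP[Gz zx]].
  rewrite eqxx (_ : (s x Q == s x P) = false) ?subr0 ?mul1r ?addr0 //.
  by apply/negP => /eqP /(@act_inj _ _ _ _ s x Gx) e; apply: PQ; rewrite e.
have -> : (s z P == s x P) = false.
  apply/negP => /eqP e; move/eqP: zx; apply; apply: (mulgI x^-1%g); rewrite mulVg.
  apply: freeP; first by rewrite groupM ?groupV.
  by rewrite aut_actM ?groupV // e -aut_actM ?groupV // mulVg aut_act1.
have -> : (s z Q == s x P) = false; last by rewrite subrr mul0r.
apply/negP => /eqP e; apply: PQ.
by rewrite -(quotient_act XGY _ Gx) -e (quotient_act XGY).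
Qed.

End Pencil.

Section FaithfulJacobian.
Variables (g : nat).
Hypotheses (gY : genus_is Y g) (g_ge2 : (2 <= g)%N).

Lemma jacobian_faithful a : (forall D : div0 X, prin (val (push_ring s a D))) ->
  forall x, x \in G -> a x = 0.
Proof.
move=> aJ x0 Gx0; apply/eqP; apply: contrapT => /negP ax0.
have [F0 [F1 [hF0 hF1 pen]]] := pencil_exists Y C_uncountable.
pose w := pencil_function F0 F1; pose u R := w (p R).
have gen := generic_ae hF0 hF1 pen.
have gpt A T := @generic_point F0 F1 pen A T.
have [Q _] := ae_ex (@aeT C X setT (fun=> I)).
have [S hS] := polar_exists hF0 hF1 pen Q aJ.
have ne Q' : ae (fun R => p R <> p Q') := quotient_ae XGY (ae_neq (p Q')).
(* P' is fixed first: the conditions on P involve [h'] and a form vanishing at p(P'). *)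
have [P' [[gP' P'Q] uP']] := gpt _ _ (aeI gen (ne Q)) (countable_algebraic_over S).
have [h' hP'] := hS P' gP' P'Q uP'.
have [om [rom om0 [y0 ny0]]] := form_vanishing_at (p P') gY g_ge2.
pose psi R := \sum_(x in G) (a x)%:~R * h' (s x R).
have psi_ae : ae (fun R => psi R != 0).
  have r : rv P' (fun R => (u R - u P') * psi R) (- \sum_(x in G) (a x)%:~R * (a x)%:~R).
    have := polar_sum XGY hP' (fun x _ => rv_cst (s x P') (a x)%:~R).
    by apply: eq_rv => R; congr (_ * _); apply: eq_bigr => x _; exact: mulrC.
  (* Positivity of the sum of squares is used in [int]; [C] has no order here. *)
  have nz : - \sum_(x in G) (a x)%:~R * (a x)%:~R != 0 :> C.
    rewrite oppr_eq0; under eq_bigr do rewrite -intrM; rewrite -rmorph_sum intr_eq0_char0.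
    rewrite psumr_neq0 => [|x _]; last by rewrite -expr2 sqr_ge0.
    by apply/hasP; exists x0; rewrite ?mem_index_enum // Gx0 -expr2 exprn_even_gt0.
  by apply: aeS (rv_neq0 r nz) => R; rewrite mulf_eq0 negb_or => /andP[].
have h'_ae : ae (fun P => forall x, x \in G -> rv (s x P) h' (h' (s x P))).
  have [R RP'] := ae_ex (ne P'); have [c rc] := hP'.1 R RP'.
  apply: (ae_fin (A := fun x P => x \in G -> rv (s x P) h' (h' (s x P)))) => x.
  have [Gx|_] := boolP (x \in G); last by apply: aeT.
  by apply: aeS (act_ae s Gx (rv_reg rc)) => P.
have om_ae := quotient_ae XGY (form_nonzero_ae rom ny0).
have [P [[[gP PQ] [PP' [psiP [h'P omP]]]] uP]] := gpt _ _
  (aeI (aeI gen (ne Q)) (aeI (ne P') (aeI psi_ae (aeI h'_ae om_ae)))) (countable_algebraic_over S).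
have [h hP] := hS P gP PQ uP; apply: omP.
have [_ wP _] := gP; have [_ wP' _] := gP'.
exact: (polar_form XGY char0 C_uncountable rom hP hP' PP' wP wP' h'P psiP om0).
Qed.
End FaithfulJacobian.
End Faithful.

(** * Uncountability of the ground field, and the conclusion *)

Lemma real_uncountable (R : realType) : ~ countable [set: R].
Proof.
move=> /countable_injP[f f_inj].
have /choice[e eE] k : exists x : R, forall x', f x' = k -> x' = x.
  have [[x <-]|h] := pselect (exists x, f x = k); last by exists 0 => x' fx'; case: h; exists x'.
  by exists x => x' fx'; apply: f_inj; rewrite ?in_setT.
(* Cantor's nested intervals: step k keeps the first or the last closed third, whichever avoids
   [e k]. The supremum of the left ends lies in all of them. *)
pose step (k : nat) (ab : R * R) :=
  if ab.1 + (ab.2 - ab.1) / 3 < e k then (ab.1, ab.1 + (ab.2 - ab.1) / 3)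
  else (ab.1 + (ab.2 - ab.1) / 3 * 2, ab.2).
pose I := fix I k : R * R := if k is k'.+1 then step k' (I k') else (0, 1).
have I_lt k : (I k).1 < (I k).2.
  by elim: k => [|k] /=; rewrite ?ltr01 // /step; case: (I k) => a b /=; case: ifP => _ /=; lra.
have IS k : (I k).1 <= (I k.+1).1 /\ (I k.+1).2 <= (I k).2.
  by move: (I_lt k); rewrite /= /step; case: (I k) => a b /=; case: ifP => _ /=; lra.
have I_le j k : (j <= k)%N -> (I j).1 <= (I k).1 /\ (I k).2 <= (I j).2.
  elim: k => [|k IH]; first by rewrite leqn0 => /eqP->.
  rewrite leq_eqVlt => /predU1P[->//|/IH[h1 h2]]; have [h3 h4] := IS k.
  by split; [exact: le_trans h3|exact: le_trans h2].
have ub k : ubound [set (I j).1 | j in [set: nat]] (I k).2.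
  move=> _ [j _ <-]; have [h1 _] := I_le j (maxn j k) (leq_maxl _ _).
  have [_ h2] := I_le k (maxn j k) (leq_maxr _ _).
  by apply: le_trans h1 (le_trans _ h2); exact: ltW.
set E := [set _ | _ in _] in ub; pose x := sup E.
have E0 : E !=set0 by exists (I 0%N).1, 0%N.
have x_ge k : (I k).1 <= x by apply: ub_le_sup; [exists (I 0%N).2; exact: ub|exists k].
have x_le k : x <= (I k).2 by apply: ge_sup.
have xe : x = e (f x) by exact: eE.
move: (x_ge (f x).+1) (x_le (f x).+1) (I_lt (f x)) => /=; rewrite /step -xe.
by case: (I (f x)) => a b /=; case: ifP => /= h; lra.
Qed.

Lemma complex_uncountable (R : realType) : ~ countable [set: R[i]].
Proof.
move=> /countable_injP[f f_inj]; apply: (@real_uncountable R).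
apply/countable_injP; exists (fun x => f (Complex x 0)) => x y _ _ /f_inj.
by rewrite !in_setT => /(_ isT isT) [].
Qed.

Lemma push_ring_prin_of_rho (C : closedFieldType) (X : curve C) (gT : finGroupType)
  (G : {group gT}) (s : aut_group X G) a : (forall z, rho s a z = 0) ->
  forall D : div0 X, prin (val (push_ring s a D)).
Proof.
move=> rho0 D; have := rho0 (\pi_(jacobian X)%qT D); rewrite rho_pi => /eqP.
by rewrite -[X in _ == X](raddf0 (\pi_(jacobian X)%qT)) -Quotient.idealrBE subr0 => /asboolP.
Qed.

Theorem theorem3p1 (R : realType) (X Y : curve R[i])
    (gT : finGroupType) (G : {group gT}) (s : aut_group X G)
    (p : pt X -> pt Y) (XGY : is_quotient s p)
    (g : nat) (gY : genus_is Y g) (g_ge2 : (2 <= g)%N)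
    (n : nat) (W : mx_representation rat G n) (irrW : mx_irreducible W)
    (m : nat) (m_gt0 : (0 < m)%N)
    (mW : forall x, x \in G ->
            m%:R * isotypical_idempotent W x \is a Num.int) :
  isotypical_component s W m <> [set 0].
Proof.
move=> W0; pose a x := numq (m%:R * isotypical_idempotent W x).
have rho0 z : rho s a z = 0.
  have : isotypical_component s W m (rho s a z) by exists z.
  by rewrite W0.
have char0 : [pchar R[i]] =i pred0 by exact: pchar_num.
have a0 := jacobian_faithful XGY char0 (@complex_uncountable R) gY g_ge2
  (push_ring_prin_of_rho rho0).
(* The idempotent acts as the identity on [W]; if all its coefficients were 0, the nonzero space of
   [W] would have zero identity. *)
have [_ W1 _] := irrW; case/eqP: W1.
rewrite -(isotypical_idempotent_id irrW) big1 // => x Gx.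
have /intrP[z zE] := mW x Gx; have := a0 x Gx; rewrite /a zE numq_int => z0.
move/eqP: zE; rewrite z0 mulf_eq0 pnatr_eq0 gtn_eqF //= => /eqP ->.
by rewrite scale0r.
Qed.
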